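(* Let $X$ and $Y$ be independent random variables, $X$ non-degenerate with cdf $F$ and $Y\ge0$, let $(X_i,Y_i)$, $i\ge1$, be i.i.d. copies of $(X,Y)$, and let $T_n=\sum_{i=1}^nX_iY_i/\sum_{i=1}^nY_i$ (with $0/0:=0$). Assume that $Y\in D(\beta)$ for some $\beta\in(0,1)$ and that there exists $\varepsilon>0$ such that $E|X|^{\beta+\varepsilon}<\infty$. Then $T_n\overset{\mathrm{D}}{\longrightarrow}T$, where for $x\in\mathbb{R}$ $$P\{T\le x\}=\frac12+\frac{1}{\pi\beta}\arctan\left[\frac{\int|u-x|^\beta\,\mathrm{sgn}(x-u)F(\mathrm{d}u)}{\int|u-x|^\beta F(\mathrm{d}u)}\tan\frac{\pi\beta}{2}\right].$$
   Context: $Y\in D(\beta)$ means that for some function $L$ slowly varying at infinity, $P\{Y>y\}=y^{-\beta}L(y)$ for $y>0$. *)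

(* Defs.v *)
From HB Require Import structures.
From mathcomp Require Import all_boot all_order all_algebra finmap.
From mathcomp Require Import all_classical all_reals all_analysis.
From mathcomp Require Import measurable_realfun.

Set Implicit Arguments.
Unset Strict Implicit.
Unset Printing Implicit Defensive.

Import Order.TTheory GRing.Theory Num.Theory.
Import numFieldTopology.Exports numFieldNormedType.Exports.

Local Open Scope classical_set_scope.
Local Open Scope ring_scope.

Section Independence.
Context {d} {Omega : measurableType d} {R : realType} (P : probability Omega R).

Definition independent_rv {d1 d2} {E1 : measurableType d1}
    {E2 : measurableType d2} (X : Omega -> E1) (Y : Omega -> E2) : Prop :=
  forall A B, measurable A -> measurable B ->
    P (X @^-1` A `&` Y @^-1` B) = (P (X @^-1` A) * P (Y @^-1` B))%E.

Definition mutually_independent {d1} {E : measurableType d1}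
    (Z : nat -> Omega -> E) : Prop :=
  forall (J : {fset nat}) (A : nat -> set E),
    (forall i, i \in J -> measurable (A i)) ->
    P (\bigcap_(i in [set` J]) Z i @^-1` A i)
      = (\prod_(i <- J) P (Z i @^-1` A i))%E.

Definition same_law {d1} {E : measurableType d1} (Z Z' : Omega -> E) : Prop :=
  forall A, measurable A -> P (Z @^-1` A) = P (Z' @^-1` A).

Definition iid_copies {d1} {E : measurableType d1} (Z : Omega -> E)
    (Zs : nat -> Omega -> E) : Prop :=
  mutually_independent Zs /\ forall i, same_law (Zs i) Z.

Definition nondegenerate_rv (X : Omega -> R) : Prop :=
  ~ exists c : R, P [set w | X w = c] = 1%E.

End Independence.

(* As is customary for regular variation, L need only be positive and
   measurable on a neighbourhood of +oo. *)
Definition slowly_varying {R : realType} (L : R -> R) : Prop :=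
  (exists A : R, measurable_fun `[A, +oo[ L /\ forall y, A <= y -> 0 < L y) /\
  (forall t, 0 < t -> L (t * y) / L y @[y --> +oo] --> (1 : R)).

Definition in_D {d} {Omega : measurableType d} {R : realType}
    {P : probability Omega R} (beta : R) (Y : {RV P >-> R}) : Prop :=
  exists L : R -> R, slowly_varying L /\
    forall y, 0 < y -> ccdf Y y = (y `^ (- beta) * L y)%:E.

Definition cvg_in_distribution {d} {Omega : measurableType d} {R : realType}
    {P : probability Omega R} (S : nat -> {RV P >-> R})
    {d'} {Omega' : measurableType d'} {P' : probability Omega' R}
    (T : {RV P' >-> R}) : Prop :=
  forall x : R, {for x, continuous (cdf T)} ->
    cdf (S n) x @[n --> \oo] --> cdf T x.

Lemma measurable_inv {R : realType} : measurable_fun [set: R] (@GRing.inv R).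
Proof.
rewrite -(setUv [set (0 : R)]); apply/measurable_funU => //.
  exact: measurableC.
split; first exact: measurable_fun_set1.
apply: subspace_continuous_measurable_fun; first exact: measurableC.
apply: continuous_in_subspaceT => x /set_mem/= /eqP x0; exact: inv_continuous.
Qed.

Section WeightedMean.
Context {d} {Omega : measurableType d} {R : realType} {P : probability Omega R}.
Variables (Xs Ys : nat -> {RV P >-> R}) (n : nat).

(* Sequences are indexed from 0. Since 0^-1 = 0, the quotient is 0 whenever
   the denominator vanishes. *)
Definition weighted_mean (w : Omega) : R :=
  (\sum_(i < n) Xs i w * Ys i w) / \sum_(i < n) Ys i w.

Lemma measurable_weighted_mean : measurable_fun [set: Omega] weighted_mean.
Proof.
apply: measurable_funM.
  apply: measurable_sum => i; exact: measurable_funM.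
apply: (measurableT_comp measurable_inv); exact: measurable_sum.
Qed.

HB.instance Definition _ := isMeasurableFun.Build _ _ _ _ weighted_mean
  measurable_weighted_mean.

Definition weighted_mean_rv : {RV P >-> R} := weighted_mean.

End WeightedMean.

(* Main.v *)
(** For a function psi put S = sum psi(X_i) Y_i, M = sum |psi(X_i)| Y_i and q = S / M; since
    T_n <= x means S >= 0 for psi(u) = x - u, it is enough to understand the law of q.
    For 0 <= alpha < pi/2, c = cos alpha and s = sin alpha, the derivative in alpha of
    atan (q tan alpha) is q / (c^2 + s^2 q^2), the real part of Omega / Theta with
    Omega = c S + i s M and Theta = c M + i s S. As e^(-t Theta) is a product over the
    independent summands, 1 / Theta = int_0^oo e^(-t Theta) dt reduces the mean of
    (Omega - kappa Theta) / Theta to the behaviour, as t tends to 0, of one-summand means.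
    The tails of psi(X)^+ Y and psi(X)^- Y are regularly varying with weights
    c_+- = E (psi^+-)(X)^beta, so an Abelian argument shows that these means are negligible
    for the right constant kappa, and, with p = (c_+ - c_-) / (c_+ + c_-),
      E [q / (c^2 + s^2 q^2)] --> p / (cos^2 (beta alpha) + p^2 sin^2 (beta alpha)).
    Integration in alpha gives E atan (q tan alpha) --> beta^-1 atan (p tan (beta alpha)).
    When alpha tends to pi/2 the left side becomes pi (P (S > 0) - P (S < 0)) / 2; replacing
    psi by l psi^+ - psi^- with l decreasing to 1 gives a bound that includes {S = 0}. *)
Require Import Defs.
From HB Require Import structures.
From mathcomp Require Import all_boot all_order all_algebra finmap.
From mathcomp Require Import all_classical all_reals all_analysis.
From mathcomp Require Import measurable_realfun ring lra.
Import Order.TTheory GRing.Theory Num.Theory.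
Import numFieldTopology.Exports numFieldNormedType.Exports.
Local Open Scope classical_set_scope.
Local Open Scope ring_scope.

Set Implicit Arguments.
Unset Strict Implicit.
Unset Printing Implicit Defensive.

(** [T_n <= x] concerns only the sign of S, hence a scale-free ratio: no normalising sequence and no
    stable law enter, only ratios of tails of Y. The angle stays below pi/2 because c M = Re Theta
    must damp every exponential; at pi/2 the kernel becomes 1/q, unbounded near 0. Uniformity in n
    comes from a comparison of derivatives. By independence the mean residual of the whole sum is at
    most a small multiple of E (M e^(-t c M)), and - c times this mean is the derivative of E e^(-t
    c M), which lies in [0, 1]. The estimate therefore holds on an interval of t chosen before n.
    The limits in n and in alpha cannot be exchanged directly, since q may concentrate near 0. On
    the event that the unskewed sum is nonnegative and M > 0, the ratio of the skewed sum is at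
    least (l - 1) / (l + 1), which removes this obstacle. Only upper bounds for P (S >= 0) are
    proved; psi and - psi together squeeze the cdf. Complex numbers appear as pairs of reals, and
    the Gamma integral on a rotated ray comes from a differential equation in the angle instead of a
    contour argument. *)

(** * Real-valued integrals: domination, dominated convergence, bounded functions *)

Section RintegralTheory.
Context d (T : measurableType d) (R : realType) (mu : {measure set T -> \bar R}).
Implicit Types (D : set T) (f g : T -> R).

Lemma le_Rintegrable D f g : measurable D -> measurable_fun D f ->
  (forall x, D x -> `|f x| <= g x) -> mu.-integrable D (EFin \o g) ->
  mu.-integrable D (EFin \o f).
Proof.
move=> mD mf fg ig; apply: (le_integrable mD _ _ ig); first exact/measurable_EFinP.
by move=> x Dx /=; rewrite lee_fin (le_trans (fg _ Dx)) ?ler_norm.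
Qed.

Lemma integrable_measurable D f :
  mu.-integrable D (EFin \o f) -> measurable_fun D f.
Proof. by move=> /measurable_int /measurable_EFinP. Qed.

Lemma RintegrableD D f g : measurable D ->
  mu.-integrable D (EFin \o f) -> mu.-integrable D (EFin \o g) ->
  mu.-integrable D (EFin \o (fun x => f x + g x)).
Proof.
by move=> mD fi gi; rewrite /comp; under eq_fun do rewrite EFinD; exact: integrableD.
Qed.

Lemma RintegrableZ D f k : measurable D -> mu.-integrable D (EFin \o f) ->
  mu.-integrable D (EFin \o (fun x => k * f x)).
Proof.
by move=> mD fi; rewrite /comp; under eq_fun do rewrite EFinM; exact: integrableZl.
Qed.

Lemma ler_norm_Rintegral D f g : measurable D -> measurable_fun D f ->
  mu.-integrable D (EFin \o g) -> (forall x, D x -> `|f x| <= g x) ->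
  `|\int[mu]_(x in D) f x| <= \int[mu]_(x in D) g x.
Proof.
move=> mD mf ig fg; have fi := le_Rintegrable mD mf fg ig.
apply: le_trans (le_normr_Rintegral mD fi) _.
by apply: le_Rintegral => //; exact: integrable_norm.
Qed.

Lemma Rintegral_cvg D (f_ : nat -> T -> R) f g : measurable D ->
  (forall n, measurable_fun D (f_ n)) -> mu.-integrable D (EFin \o g) ->
  (forall n x, D x -> `|f_ n x| <= g x) ->
  (forall x, D x -> f_ n x @[n --> \oo] --> f x) ->
  mu.-integrable D (EFin \o f) /\
  \int[mu]_(x in D) f_ n x @[n --> \oo] --> \int[mu]_(x in D) f x.
Proof.
move=> mD mf ig fg ff.
have ffE x : D x -> (f_ n x)%:E @[n --> \oo] --> (f x)%:E.
  by move=> Dx; apply: cvg_EFin; [exact: nearW|exact: ff].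
have mfe : measurable_fun D (EFin \o f).
  by apply: (@emeasurable_fun_cvg _ _ _ _ (fun n x => (f_ n x)%:E)) => // n; exact/measurable_EFinP.
have H : {ae mu, forall x n, D x -> (`|(f_ n x)%:E| <= (EFin \o g) x)%E}.
  by apply: aeW => x n Dx /=; rewrite lee_fin fg.
have [fi _ cvf] := @dominated_convergence _ _ _ mu _ mD (fun n x => (f_ n x)%:E)
  (EFin \o f) (EFin \o g) (fun n => (measurable_EFinP D (f_ n)).2 (mf n)) mfe (aeW _ ffE) ig H.
split => //; apply: fine_cvg; rewrite fineK //; exact: integrable_fin_num.
Qed.

End RintegralTheory.

Section BoundedExpectation.
Context d (T : measurableType d) (R : realType) (P : probability T R).
Implicit Types f g : T -> R.

Lemma bounded_integrable f C : measurable_fun [set: T] f ->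
  (forall x, `|f x| <= C) -> P.-integrable setT (EFin \o f).
Proof.
move=> mf fC; apply: measurable_bounded_integrable => //.
  by rewrite -ge0_fin_numE// fin_num_measure.
by exists C; split; [exact: num_real|move=> M CM x _ /=; rewrite (le_trans (fC x))// ltW].
Qed.

Lemma Rintegral_cstT (c : R) : \int[P]_x c = c.
Proof. by rewrite Rintegral_cst// [X in fine X]probability_setT mulr1. Qed.

Lemma Rintegral_indic (A : set T) : measurable A -> \int[P]_x \1_A x = fine (P A).
Proof. by move=> mA; rewrite /Rintegral integral_indic// setIT. Qed.

End BoundedExpectation.

(** * Derivative calculus on the real line *)

Section DeriveCombinators.
Context {R : realType}.
Implicit Types (f g : R -> R) (x a b : R).

(* A copy of [is_derive] that is not a class, so that unification rather than
   instance search determines the derivative. *)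
Definition has_deriv f x a := is_derive x 1 f a.

Lemma has_deriv_add f g x a b : has_deriv f x a -> has_deriv g x b ->
  has_deriv (fun y => f y + g y) x (a + b).
Proof. by move=> df dg; exact: is_deriveD. Qed.

Lemma has_deriv_opp f x a : has_deriv f x a -> has_deriv (fun y => - f y) x (- a).
Proof. by move=> df; exact: is_deriveN. Qed.

Lemma has_deriv_mul f g x a b : has_deriv f x a -> has_deriv g x b ->
  has_deriv (fun y => f y * g y) x (a * g x + f x * b).
Proof.
move=> df dg; have H := is_deriveM df dg; apply: (is_derive_eq H).
by rewrite /GRing.scale/= addrC (mulrC a).
Qed.

Lemma has_deriv_inv f x a : f x != 0 -> has_deriv f x a ->
  has_deriv (fun y => (f y)^-1) x (- a / f x ^+ 2).
Proof.
move=> fx0 df; have H := is_deriveV fx0 df; apply: (is_derive_eq H).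
by rewrite /GRing.scale/= mulNr mulNr mulrC.
Qed.

Lemma has_deriv_exp f x a : has_deriv f x a ->
  has_deriv (fun y => expR (f y)) x (expR (f x) * a).
Proof. by move=> df; exact: (is_derive1_comp (f := expR)). Qed.

Lemma has_deriv_cos f x a : has_deriv f x a ->
  has_deriv (fun y => cos (f y)) x (- sin (f x) * a).
Proof. by move=> df; exact: (is_derive1_comp (f := cos)). Qed.

Lemma has_deriv_sin f x a : has_deriv f x a ->
  has_deriv (fun y => sin (f y)) x (cos (f x) * a).
Proof. by move=> df; exact: (is_derive1_comp (f := sin)). Qed.

Lemma has_deriv_atan f x a : has_deriv f x a ->
  has_deriv (fun y => atan (f y)) x ((1 + f x ^+ 2)^-1 * a).
Proof. by move=> df; exact: (is_derive1_comp (f := atan)). Qed.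

Lemma has_deriv_id x : has_deriv (fun y : R => y) x 1.
Proof. exact: is_derive_id. Qed.

Lemma has_deriv_cst x a : has_deriv (fun _ : R => a) x 0.
Proof. exact: is_derive_cst. Qed.

Lemma has_deriv_powR f x a p : 0 < f x -> has_deriv f x a ->
  has_deriv (fun y => f y `^ p) x (p * f x `^ (p - 1) * a).
Proof.
by move=> fx df; exact: (is_derive1_comp (is_derive1_powR p fx) df).
Qed.

Lemma has_deriv_pow f x a n : has_deriv f x a ->
  has_deriv (fun y => f y ^+ n.+1) x (n.+1%:R * f x ^+ n * a).
Proof.
move=> df; elim: n => [|n IH].
  by apply: (is_derive_eq (df : is_derive _ _ _ _)); rewrite expr0; ring.
rewrite (_ : (fun y => _) = fun y => f y * f y ^+ n.+1); last by apply/funext => y; rewrite exprS.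
have H : is_derive _ _ _ _ := has_deriv_mul df IH; apply: (is_derive_eq H).
by rewrite -(natr1 n.+1) !exprS; ring.
Qed.

Lemma has_derivW f x a b : has_deriv f x a -> a = b -> is_derive x 1 f b.
Proof. by move=> df <-. Qed.

Lemma has_deriv_continuous f x a : has_deriv f x a -> {for x, continuous f}.
Proof. by case=> df _; apply/differentiable_continuous/derivable1_diffP. Qed.

Lemma is_derive_derive1 f x a : is_derive x 1 f a -> derive1 f x = a.
Proof. by move=> df; rewrite derive1E; exact: derive_val. Qed.

Lemma continuous_MVT f f' (a b : R) : a < b ->
  (forall x : R, a < x < b -> is_derive x 1 f (f' x)) -> {within `[a, b], continuous f} ->
  exists2 c, a < c < b & f b - f a = f' c * (b - a).
Proof.
move=> ab df cf; have df' x : x \in `]a, b[ -> is_derive x 1 f (f' x).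
  by rewrite in_itv/= => /df.
have [c] := MVT ab df' cf.
by rewrite in_itv/= => cab ->; exists c.
Qed.

Lemma derive0_constant f (a b : R) : a <= b ->
  (forall x : R, a <= x <= b -> is_derive x 1 f 0) -> f b = f a.
Proof.
rewrite le_eqVlt => /predU1P[->//|ab] df.
have [||c _] := @continuous_MVT f (fun=> 0) _ _ ab.
- by move=> x /andP[ax xb]; apply: df; rewrite !ltW.
- apply: continuous_in_subspaceT => x /set_mem/=; rewrite in_itv/= => xab.
  exact: has_deriv_continuous (df _ xab).
by rewrite mul0r => /subr0_eq.
Qed.

End DeriveCombinators.

(** The derivative is synthesised from the shape of the function, with derivatives in the context
    used for the opaque pieces. Only side conditions remain, and [has_derivW] leaves the comparison
    with the announced value as a separate algebraic goal. *)
Ltac derive := repeat first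
  [ exact: has_deriv_id | exact: has_deriv_cst | eassumption
  | apply: has_deriv_add | apply: has_deriv_opp | apply: has_deriv_mul
  | apply: has_deriv_exp | apply: has_deriv_cos | apply: has_deriv_sin
  | apply: has_deriv_atan
  | apply: has_deriv_inv | apply: has_deriv_pow | apply: has_deriv_powR ].

(** * Fundamental theorem of calculus on the open half line *)

Section FTC_half_line.
Context {R : realType}.
Notation mu := (@lebesgue_measure R).
Variables (f F : R -> R).
Hypothesis dF : forall x : R, 0 < x -> is_derive x 1 F (f x).
Hypothesis cf : forall x : R, 0 < x -> {for x, continuous f}.

Lemma measurable_fun_Rpos : measurable_fun `](0%R : R), +oo[ f.
Proof.
apply: open_continuous_measurable_fun; first exact: interval_open.
by move=> x /set_mem/=; rewrite in_itv/= andbT; exact: cf.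
Qed.

(** The shift by 2 makes the first interval nondegenerate: a shift by 1 would start with the single
    point 1. *)
Let J n : set R := `[n.+2%:R^-1, n.+2%:R].

Let Jlt n : (n.+2%:R^-1 < n.+2%:R :> R).
Proof. by rewrite (@lt_trans _ _ 1) ?invf_lt1 ?ltr0n ?ltr1n. Qed.

Let JD n : `](0%R : R), +oo[ `&` J n = J n.
Proof.
apply/setIidPr => x; rewrite /J/= !in_itv/= andbT => /andP[xn _].
by rewrite (lt_le_trans _ xn)// invr_gt0.
Qed.

Let FTCJ n : (\int[mu]_(x in J n) (f x)%:E = (F n.+2%:R - F n.+2%:R^-1)%:E)%E.
Proof.
have pos (x : R) : n.+2%:R^-1 <= x -> 0 < x by move=> xn; rewrite (lt_le_trans _ xn)// invr_gt0.
rewrite EFinB; apply: (@continuous_FTC2 _ f F) => //.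
- apply: continuous_in_subspaceT => x /set_mem/=; rewrite in_itv/= => /andP[xn _].
  exact/cf/pos.
- split.
  + move=> x; rewrite in_itv/= => /andP[xn _].
    by have [] := dF (pos _ (ltW xn)).
  + apply: cvg_at_right_filter; apply: (has_deriv_continuous (dF _)).
    by rewrite invr_gt0.
  + by apply: cvg_at_left_filter; apply: (has_deriv_continuous (dF _)).
- by move=> x; rewrite in_itv/= => /andP[xn _]; apply/is_derive_derive1/dF/pos/ltW.
Qed.

Let measurable_funJ n : measurable_fun (J n) f.
Proof.
have mD : measurable (`](0%R : R), +oo[%classic : set R) by [].
by apply: (measurable_funS mD _ measurable_fun_Rpos); rewrite -(JD n); exact: subIsetl.
Qed.

Let J_eventually (x : R) : 0 < x -> \forall n \near \oo, J n x.
Proof.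
move=> x0; near=> n; rewrite /J/= in_itv/=; apply/andP; split.
  rewrite invf_ple ?posrE// (@le_trans _ _ n%:R) ?ler_nat ?leqW//.
  by near: n; exact: nbhs_infty_ger.
rewrite (@le_trans _ _ n%:R) ?ler_nat ?leqW//.
by near: n; exact: nbhs_infty_ger.
Unshelve. all: by end_near. Qed.

(** Exhaustion by the compact intervals [J n], with |f| as majorant. The boundary values enter as
    limits because the primitives used later contain a power of x that is not differentiable at
    0. *)
Lemma Rintegral_FTC_half_line (a b : R) :
  mu.-integrable `](0%R : R), +oo[ (EFin \o f) ->
  F x @[x --> 0^'+] --> a -> F x @[x --> +oo] --> b ->
  \int[mu]_(x in `](0%R : R), +oo[) f x = b - a.
Proof.
move=> fi Fa Fb.
have mf := integrable_measurable fi.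
have [||||_ cv] := @Rintegral_cvg _ _ _ mu `](0%R : R), +oo[ (fun n => f \_ (J n)) f (fun x => `|f x|) _ _ (integrable_norm fi).
- by [].
- move=> n; apply: (measurable_funS measurableT) => //.
  have mJ : measurable (J n) by exact: measurable_itv.
  apply/(measurable_restrictT f) => //; exact: measurable_funJ.
- by move=> n x _; rewrite /patch; case: ifP => // _; rewrite normr0.
- move=> x; rewrite /= in_itv/= andbT => x0.
  apply: cvg_near_cst; near=> n; rewrite /patch mem_set//.
  by near: n; exact: J_eventually.
have FJ n : \int[mu]_(x in `](0%R : R), +oo[) (f \_ (J n)) x = F n.+2%:R - F n.+2%:R^-1.
  by rewrite -Rintegral_mkcondr JD /Rintegral FTCJ.
have cvF : F n.+2%:R - F n.+2%:R^-1 @[n --> \oo] --> b - a.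
  have ny : (n.+2%:R : R) @[n --> \oo] --> +oo.
    apply/cvgryPge => M; near=> n; rewrite (@le_trans _ _ n%:R) ?ler_nat ?leqW//.
    by near: n; exact: nbhs_infty_ger.
  apply: cvgB; first exact: (cvg_comp _ _ ny Fb).
  move/cvg_at_rightP : Fa; apply; split; first by move=> n; rewrite invr_gt0.
  by apply/gtr0_cvgV0 => //; exact: nearW.
rewrite (funext FJ) in cv; exact: cvg_unique cv cvF.
Unshelve. all: by end_near. Qed.

(** For f >= 0 the integrals over [J n] are increments of F, all at most C, and Fatou's lemma passes
    this bound to the half line. *)
Lemma integrable_FTC_half_line (C : R) : (forall x : R, 0 < x -> 0 <= f x) ->
  (forall x y : R, 0 < x -> 0 < y -> F y - F x <= C) ->
  mu.-integrable `](0%R : R), +oo[ (EFin \o f).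
Proof.
move=> f0 FC.
pose g n x := ((f \_ (J n)) x)%:E.
have mg n : measurable_fun `](0%R : R), +oo[ (g n).
  apply/measurable_EFinP; apply: (measurable_funS measurableT) => //.
  have mJ : measurable (J n) by exact: measurable_itv.
  apply/(measurable_restrictT f) => //; exact: measurable_funJ.
have g0 n x : `](0%R : R), +oo[%classic x -> (0 <= g n x)%E.
  rewrite /= in_itv/= andbT => x0; rewrite /g lee_fin /patch.
  by case: ifP => // _; exact: f0.
have gf x : `](0%R : R), +oo[%classic x -> limn_einf (g ^~ x) = (f x)%:E.
  rewrite /= in_itv/= andbT => x0; apply: (cvg_limn_einf_sup _).1.
  apply: cvg_near_cst; near=> n; rewrite /g /patch mem_set//.
  by near: n; exact: J_eventually.
apply/integrableP; split; first by apply/measurable_EFinP; exact: measurable_fun_Rpos.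
have -> : (\int[mu]_(x in `](0%R : R), +oo[) `|(EFin \o f) x| =
    \int[mu]_(x in `](0%R : R), +oo[) limn_einf (g ^~ x))%E.
  apply: eq_integral => x /set_mem x0; rewrite gf//= ger0_norm//.
  by apply: f0; move: x0; rewrite /= in_itv/= andbT.
apply: le_lt_trans (fatou mu _ mg g0) _ => //.
apply: (@le_lt_trans _ _ C%:E); last exact: ltry.
rewrite limn_einf_lim; apply: lime_le; first exact: is_cvg_einfs.
apply: nearW => n; apply: (@le_trans _ _ (\int[mu]_(x in `](0%R : R), +oo[) g n x)%E).
  by apply: ereal_inf_lbound; exists n => /=.
have -> : (\int[mu]_(x in `](0%R : R), +oo[) g n x = (F n.+2%:R - F n.+2%:R^-1)%:E)%E.
  rewrite -FTCJ -(JD n) integral_mkcondr; apply: eq_integral => x _.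
  by rewrite /g /patch; case: ifP.
by rewrite lee_fin FC// invr_gt0.
Unshelve. all: by end_near. Qed.

End FTC_half_line.

(** * Integrals with the singularity w^(-b) at the origin *)

Section SingularIntegral.
Context {R : realType}.
Notation mu := (@lebesgue_measure R).
Notation pos := (`](0%R : R), +oo[%classic).
Implicit Types (b c w : R) (F : R -> R).

Lemma powRNr w b : 0 < w -> w `^ (1 - b) = w * w `^ (- b).
Proof. by move=> w0; rewrite powRD ?powRr1 ?ltW// (gt_eqF w0) implybT. Qed.

(** This majorant has an explicit bounded primitive, (1 - b)^-1 (w / (1 + w))^(1 - b). The quotient
    w / (1 + w) behaves like w at 0 and like 1 at infinity, so one function controls both ends. *)
Lemma integrable_singularity b : 0 < b < 1 ->
  mu.-integrable pos (EFin \o (fun w => (w / (1 + w)) `^ (- b) / (1 + w) ^+ 2)).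
Proof.
move=> /andP[b0 b1].
have pos1 w : 0 < w -> 0 < 1 + w by move=> w0; rewrite addr_gt0.
have posq w : 0 < w -> 0 < w / (1 + w) by move=> w0; rewrite divr_gt0// pos1.
have ltq w : 0 < w -> w / (1 + w) <= 1 by move=> w0; rewrite ler_pdivrMr ?pos1// mul1r; lra.
apply: (@integrable_FTC_half_line _ _ (fun w => (1 - b)^-1 * (w / (1 + w)) `^ (1 - b)) _ _ (1 - b)^-1).
- move=> w w0; apply: has_derivW.
    by derive; [exact: posq|rewrite lt0r_neq0// pos1].
  rewrite /=; have -> : 1 - b - 1 = - b by ring.
  by field; rewrite lt0r_neq0 ?pos1//=; lra.
- move=> w w0.
  apply: has_deriv_continuous; derive; first exact: posq.
    by rewrite lt0r_neq0// pos1.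
  by rewrite sqrf_eq0 lt0r_neq0// pos1.
- by move=> w w0; rewrite divr_ge0 ?powR_ge0 ?sqr_ge0.
- move=> x y x0 y0; have ib : 0 <= (1 - b)^-1 by rewrite invr_ge0; lra.
  rewrite -mulrBr -[leRHS]mulr1 ler_wpM2l//.
  rewrite lerBlDr ler_wpDr ?powR_ge0//.
  apply: (@le_trans _ _ (1 `^ (1 - b))); last by rewrite powR1.
  rewrite ge0_ler_powR ?nnegrE//; try lra.
  - exact/ltW/posq.
  - exact: ltq.
Qed.

Lemma integrable_sing b F C : 0 < b < 1 -> measurable_fun pos F ->
  (forall w, 0 < w -> `|F w| <= C / (1 + w) ^+ 2) ->
  mu.-integrable pos (EFin \o (fun w => w `^ (- b) * F w)).
Proof.
move=> b01 mF FC; have /andP[b0 b1] := b01.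
apply: (@le_Rintegrable _ _ _ mu _ _ (fun w => C * ((w / (1 + w)) `^ (- b) / (1 + w) ^+ 2))) => //.
- by apply: measurable_funM => //; apply: (measurable_funS measurableT) => //; exact: measurable_powR.
- move=> w; rewrite /= in_itv/= andbT => w0.
  rewrite normrM ger0_norm ?powR_ge0// mulrCA ler_pM ?powR_ge0 ?FC//.
  rewrite !powRN lef_pV2 ?posrE ?powR_gt0 ?divr_gt0//; try lra.
  rewrite ge0_ler_powR ?nnegrE ?divr_ge0//; try lra.
  by rewrite ler_pdivrMr; [nra|lra].
- by apply: RintegrableZ => //; exact: integrable_singularity.
Qed.

(** Write e^(c w) as the cube of e^(c w / 3), which is at least 1 + c w / 3 and hence at least (c /
    3) (1 + w) since c <= 1; this gives 27 = 3^3. *)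
Lemma expR_poly_bound c w : 0 < c <= 1 -> 0 <= w -> expR (- (c * w)) * (1 + w) ^+ 3 <= 27 / c ^+ 3.
Proof.
move=> /andP[c0 c1] w0.
rewrite ler_pdivlMr ?exprn_gt0// -mulrA -exprMn mulrC expRN ler_pdivrMr ?expR_gt0//.
have E : expR (c * w) = expR (c / 3 * w) ^+ 3 by rewrite -expRM_natl; congr expR; field.
rewrite E -[27]/(27%:R) (_ : 27%:R = 3 ^+ 3)//; last by rewrite -natrX.
rewrite -exprMn lerXn2r ?nnegrE ?mulr_ge0 ?expR_ge0//; try lra.
have := expR_ge1Dx (c / 3 * w); nra.
Qed.

(** Of the three powers of 1 + w, one may be spent on the factor w and two remain, as
    [integrable_sing] requires. *)
Lemma expR_decay c k w (g : R) : 0 < c <= 1 -> 0 <= k -> 0 <= w ->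
  `|g| <= k * expR (- (c * w)) ->
  `|g| <= k * (27 / c ^+ 3) / (1 + w) ^+ 2 /\ `|w * g| <= k * (27 / c ^+ 3) / (1 + w) ^+ 2.
Proof.
move=> c01 k0 w0 gk; have w1 : 0 < (1 + w) ^+ 2 by rewrite exprn_gt0//; lra.
have B := expR_poly_bound c01 w0.
have e0 := expR_ge0 (- (c * w)); set e := expR _ in gk B e0.
have Bk : k * e * (1 + w) ^+ 3 <= k * (27 / c ^+ 3) by rewrite -mulrA ler_wpM2l.
have ke0 : 0 <= k * e by rewrite mulr_ge0.
have Bk2 : (1 + w) * (k * e * (1 + w) ^+ 2) <= k * (27 / c ^+ 3).
  by apply: le_trans Bk; rewrite mulrCA -exprS.
have X0 : 0 <= k * e * (1 + w) ^+ 2 by rewrite mulr_ge0// ltW.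
split; rewrite ler_pdivlMr//.
  apply: (@le_trans _ _ (k * e * (1 + w) ^+ 2)); first by rewrite ler_wpM2r// ltW.
  by apply: le_trans Bk2; rewrite ler_peMl//; lra.
apply: (@le_trans _ _ (w * (k * e * (1 + w) ^+ 2))).
  by rewrite normrM (ger0_norm w0) -(mulrA w) ler_wpM2l// ler_wpM2r// ltW.
by apply: le_trans Bk2; rewrite ler_wpM2r//; lra.
Qed.

(** The function w^(1 - b) F w vanishes at both ends: it is at most C w^(1 - b) near 0 and at most C
    / w near infinity. Its derivative therefore has integral 0. *)
Lemma sing_by_parts b F F' C : 0 < b < 1 ->
  (forall w, 0 < w -> is_derive w 1 F (F' w)) ->
  (forall w, 0 < w -> {for w, continuous F'}) ->
  (forall w, 0 < w -> `|F w| <= C / (1 + w) ^+ 2) ->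
  (forall w, 0 < w -> `|w * F' w| <= C / (1 + w) ^+ 2) ->
  \int[mu]_(w in pos) (w `^ (- b) * (w * F' w)) =
  - (1 - b) * \int[mu]_(w in pos) (w `^ (- b) * F w).
Proof.
move=> b01 dF cF' FC F'C; have /andP[b0 b1] := b01.
have cF w : 0 < w -> {for w, continuous F} by move=> w0; exact: has_deriv_continuous (dF _ w0).
have mF : measurable_fun pos F by exact: (measurable_fun_Rpos cF).
have mF' : measurable_fun pos (fun w => w * F' w).
  by apply: measurable_funM => //; exact: (measurable_fun_Rpos cF').
have iF := integrable_sing b01 mF FC.
have iF' := integrable_sing b01 mF' F'C.
have C0 : 0 <= C.
  have := FC 1 ltr01; rewrite ler_pdivlMr; last by rewrite exprn_gt0//; lra.
  by apply: le_trans; rewrite mulr_ge0// exprn_ge0//; lra.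
have : \int[mu]_(w in pos) ((1 - b) * (w `^ (- b) * F w) + w `^ (- b) * (w * F' w)) = 0 - 0.
  apply: (@Rintegral_FTC_half_line _ _ (fun w => w `^ (1 - b) * F w)).
  - move=> w w0; have dFw := dF _ w0; apply: has_derivW; first by derive.
    rewrite /= powRNr// (_ : 1 - b - 1 = - b); last ring.
    by ring.
  - move=> w w0; have dFw := dF _ w0.
    have c1 := has_deriv_continuous (is_derive1_powR (- b) w0).
    apply: cvgD; first by apply: cvgM; [exact: cvg_cst|apply: cvgM; [exact: c1|exact: cF]].
    by apply: cvgM; [exact: c1|apply: cvgM; [exact: cvg_id|exact: cF']].
  - by apply: RintegrableD => //; apply: RintegrableZ.
  - apply: norm_cvg0.
    apply: (@squeeze_cvgr _ _ _ _ (cst 0) (fun w => C * w `^ (1 - b))).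
    + near=> w; have w0 : 0 < w by [].
      rewrite normr_ge0/= normrM ger0_norm ?powR_ge0// mulrC ler_wpM2r ?powR_ge0//.
      apply: le_trans (FC _ w0) _; rewrite ler_pdivrMr ?exprn_gt0//; try lra.
      by rewrite ler_peMr// expr2; nra.
    + exact: cvg_cst.
    + rewrite -[X in _ --> X](mulr0 C); apply: cvgM; first exact: cvg_cst.
      by apply: powR_cvg0; lra.
  - apply: norm_cvg0.
    apply: (@squeeze_cvgr _ _ _ _ (cst 0) (fun w => C * w^-1)).
    + near=> w; have w1 : 1 <= w by near: w; exact: nbhs_pinfty_ge.
      have w0 : 0 < w by lra.
      rewrite normr_ge0/= normrM ger0_norm ?powR_ge0//.
      apply: (@le_trans _ _ (w * (C / (1 + w) ^+ 2))).
        rewrite ler_pM ?powR_ge0 ?FC// -[leRHS](powRr1 (ltW w0)) ler_powR//; lra.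
      rewrite mulrCA ler_wpM2l// ler_pdivrMr ?exprn_gt0//; last lra.
      by rewrite mulrC ler_pdivlMr//; nra.
    + exact: cvg_cst.
    + rewrite -[X in _ --> X](mulr0 C); apply: cvgM; first exact: cvg_cst.
      by apply/gtr0_cvgV0; [exact: nbhs_pinfty_gt|exact: cvg_id].
rewrite RintegralD//; last exact: RintegrableZ.
by rewrite RintegralZl// => H; lra.
Unshelve. all: by end_near. Qed.

End SingularIntegral.

(** * Differentiation in a parameter, and the Gamma integral on a rotated ray *)

Section DiffUnderIntegral.
Context {R : realType} d (Y : measurableType d) (mu : {measure set Y -> \bar R}).

Lemma is_derive_Rintegral (f f' : R -> Y -> R) (B : set Y) (G : Y -> R) (a e : R) :
  measurable B -> 0 < e ->
  (forall x, `|x - a| < e -> mu.-integrable B (EFin \o f x)) ->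
  (forall x y, `|x - a| < e -> B y -> is_derive x 1 (f ^~ y) (f' x y)) ->
  mu.-integrable B (EFin \o G) ->
  (forall x y, `|x - a| < e -> B y -> `|f' x y| <= G y) ->
  is_derive a 1 (fun x => \int[mu]_(y in B) f x y) (\int[mu]_(y in B) f' a y).
Proof.
move=> mB e0 fi df iG f'G.
have Iae x : `]a - e, a + e[%classic x -> `|x - a| < e.
  by rewrite /= in_itv/= => /andP[? ?]; rewrite ltr_norml; apply/andP; split; lra.
have Ia : `]a - e, a + e[%classic a by rewrite /= in_itv/=; apply/andP; split; lra.
have d1 x y : `|x - a| < e -> B y -> partial1of2 f x y = f' x y.
  by move=> xe By; exact: is_derive_derive1 (df _ _ xe By).
have fi' x : `]a - e, a + e[%classic x -> mu.-integrable B (EFin \o f x) by move/Iae/fi.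
have df' x y : `]a - e, a + e[%classic x -> B y -> derivable (f ^~ y) x 1.
  by move=> /Iae xe By; have [] := df x y xe By.
have G0 y : 0 <= `|G y| by [].
have iG' : mu.-integrable B (EFin \o (fun y => `|G y|)) by exact: integrable_norm.
have Gub x y : `]a - e, a + e[%classic x -> B y -> `|partial1of2 f x y| <= `|G y|.
  by move=> /Iae xe By; rewrite d1// (le_trans (f'G _ _ xe By))// ler_norm.
have D := derivable_under_integral mB Ia fi' df' G0 iG' Gub.
have E := differentiation_under_integral mB Ia fi' df' G0 iG' Gub.
apply: DeriveDef => //; rewrite -derive1E E.
by apply: eq_Rintegral => y /set_mem By; rewrite d1// subrr normr0.
Qed.

End DiffUnderIntegral.

Section ComplexGamma.
Context {R : realType}.
Notation mu := (@lebesgue_measure R).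
Notation pos := (`](0%R : R), +oo[%classic).
Variable b : R.
Hypothesis b01 : 0 < b < 1.

(** [fc] + i [fs] is h = exp (- w e^(-i a)), and the primes denote derivatives in w. Since dh/da = -
    i w dh/dw, differentiation in the angle becomes integration by parts in w. *)
Let fc (a w : R) : R := expR (- (cos a * w)) * cos (sin a * w).
Let fs (a w : R) : R := expR (- (cos a * w)) * sin (sin a * w).
Let fc' (a w : R) : R := expR (- (cos a * w)) * (- (cos a * cos (sin a * w)) - sin a * sin (sin a * w)).
Let fs' (a w : R) : R := expR (- (cos a * w)) * (- (cos a * sin (sin a * w)) + sin a * cos (sin a * w)).

Let dfc (a w : R) : is_derive w 1 (fc a) (fc' a w).
Proof. by apply: has_derivW; [derive|rewrite /fc'; ring]. Qed.

Let dfs (a w : R) : is_derive w 1 (fs a) (fs' a w).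
Proof. by apply: has_derivW; [derive|rewrite /fs'; ring]. Qed.

Let cfc' (a w : R) : {for w, continuous (fc' a)}.
Proof. by apply: has_deriv_continuous; derive. Qed.

Let cfs' (a w : R) : {for w, continuous (fs' a)}.
Proof. by apply: has_deriv_continuous; derive. Qed.

Let cos_le1' (x : R) : `|cos x| <= 1.
Proof. by rewrite ler_norml cos_geN1 cos_le1. Qed.

Let sin_le1' (x : R) : `|sin x| <= 1.
Proof. by rewrite ler_norml sin_geN1 sin_le1. Qed.

Let mul_le1 (x y : R) : `|x| <= 1 -> `|y| <= 1 -> `|x * y| <= 1.
Proof. by move=> x1 y1; rewrite normrM mulr_ile1. Qed.

Let bound_fc (a w : R) : `|fc a w| <= 2 * expR (- (cos a * w)).
Proof.
rewrite normrM ger0_norm ?expR_ge0// mulrC ler_wpM2r ?expR_ge0//.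
by have := cos_le1' (sin a * w); lra.
Qed.

Let bound_fs (a w : R) : `|fs a w| <= 2 * expR (- (cos a * w)).
Proof.
rewrite normrM ger0_norm ?expR_ge0// mulrC ler_wpM2r ?expR_ge0//.
by have := sin_le1' (sin a * w); lra.
Qed.

Let bound_fc' (a w : R) : `|fc' a w| <= 2 * expR (- (cos a * w)).
Proof.
rewrite normrM ger0_norm ?expR_ge0// mulrC ler_wpM2r ?expR_ge0//.
apply: le_trans (ler_normB _ _) _; rewrite normrN.
have := mul_le1 (cos_le1' a) (cos_le1' (sin a * w)).
by have := mul_le1 (sin_le1' a) (sin_le1' (sin a * w)); lra.
Qed.

Let bound_fs' (a w : R) : `|fs' a w| <= 2 * expR (- (cos a * w)).
Proof.
rewrite normrM ger0_norm ?expR_ge0// mulrC ler_wpM2r ?expR_ge0//.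
apply: le_trans (ler_normD _ _) _; rewrite normrN.
have := mul_le1 (cos_le1' a) (sin_le1' (sin a * w)).
by have := mul_le1 (sin_le1' a) (cos_le1' (sin a * w)); lra.
Qed.

Let decay (c w : R) g : 0 < c -> c <= 1 -> 0 < w -> `|g| <= 2 * expR (- (c * w)) ->
  `|g| <= 2 * (27 / c ^+ 3) / (1 + w) ^+ 2 /\ `|w * g| <= 2 * (27 / c ^+ 3) / (1 + w) ^+ 2.
Proof. by move=> c0 c1 w0 gb; apply: expR_decay => //; rewrite ?c0// ltW. Qed.

(** [Icos] + i [Isin] is the Gamma integral of parameter 1 - b on a rotated ray, with value Gamma(1
    - b) e^(i (1 - b) a). Of Gamma(1 - b), which is [Icos 0], only the positivity will matter. *)
Definition Icos (a : R) :=
  \int[mu]_(w in pos) (w `^ (- b) * (expR (- (cos a * w)) * cos (sin a * w))).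
Definition Isin (a : R) :=
  \int[mu]_(w in pos) (w `^ (- b) * (expR (- (cos a * w)) * sin (sin a * w))).

Let mfc (a : R) : measurable_fun pos (fc a).
Proof. by apply: (@measurable_fun_Rpos R) => w _; exact: has_deriv_continuous (dfc a w). Qed.

Let mfs (a : R) : measurable_fun pos (fs a).
Proof. by apply: (@measurable_fun_Rpos R) => w _; exact: has_deriv_continuous (dfs a w). Qed.

Lemma integrable_Icos (a : R) : 0 < cos a -> mu.-integrable pos
  (EFin \o (fun w => w `^ (- b) * (expR (- (cos a * w)) * cos (sin a * w)))).
Proof.
move=> ca; apply: (@integrable_sing _ _ _ (2 * (27 / cos a ^+ 3)) b01 (mfc a)) => w w0.
by have [] := decay ca (cos_le1 a) w0 (bound_fc a w).
Qed.

Let near_cos (a : R) : 0 < cos a ->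
  exists2 e : R, 0 < e & forall x, `|x - a| < e -> cos a / 2 < cos x.
Proof.
move=> ca; have ca2 : cos a / 2 < cos a by lra.
have [e /= e0 H] : \forall x \near a, cos a / 2 < cos x.
  exact: (cvgr_gt _ (@continuous_cos R a)).
by exists e => // x xa; apply: H; rewrite /= distrC.
Qed.

(** In a neighbourhood of a the decay rate [cos x] stays above cos a / 2, which yields a majorant
    that does not depend on x. *)
Let dI (g f' : R -> R -> R) (a : R) : 0 < cos a ->
  (forall x, measurable_fun pos (g x)) ->
  (forall x w, `|g x w| <= 2 * expR (- (cos x * w))) ->
  (forall x w, `|f' x w| <= 2 * expR (- (cos x * w))) ->
  (forall x w : R, is_derive x 1 (g ^~ w) (w * f' x w)) ->
  is_derive a 1 (fun x => \int[mu]_(w in pos) (w `^ (- b) * g x w))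
    (\int[mu]_(w in pos) (w `^ (- b) * (w * f' a w))).
Proof.
move=> ca mg bg bf' dg; have [e e0 ce] := near_cos ca.
have c2 : 0 < cos a / 2 by lra.
have c2' : cos a / 2 <= 1 by have := cos_le1 a; lra.
have dG x w : `|x - a| < e -> pos w ->
    is_derive x 1 (fun y => w `^ (- b) * g y w) (w `^ (- b) * (w * f' x w)).
  move=> _ _; have dgw := dg x w; apply: has_derivW; first by derive.
  by rewrite mul0r add0r.
apply: (@is_derive_Rintegral _ _ _ mu (fun x w => w `^ (- b) * g x w)
  (fun x w => w `^ (- b) * (w * f' x w)) pos
  (fun w => w `^ (- b) * (2 * (27 / (cos a / 2) ^+ 3) / (1 + w) ^+ 2)) a e _ e0 _ dG) => //.
- move=> x xa; have cx := lt_trans c2 (ce _ xa).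
  apply: (@integrable_sing _ _ _ (2 * (27 / cos x ^+ 3)) b01 (mg x)) => w w0.
  by have [] := decay cx (cos_le1 x) w0 (bg x w).
- apply: (@integrable_sing _ _ _ (2 * (27 / (cos a / 2) ^+ 3)) b01).
    apply: (@measurable_fun_Rpos R) => w w0; apply: has_deriv_continuous; derive.
    by rewrite sqrf_eq0 lt0r_neq0//; lra.
  move=> w w0; rewrite ger0_norm// divr_ge0 ?sqr_ge0// mulr_ge0// divr_ge0// exprn_ge0//.
  exact: ltW.
- move=> x w xa; rewrite /= in_itv/= andbT => w0.
  rewrite normrM ger0_norm ?powR_ge0// ler_wpM2l ?powR_ge0//.
  have [] // := decay c2 c2' w0 (_ : `|f' x w| <= _).
  apply: le_trans (bf' _ _) _; rewrite ler_wpM2l// ler_expR lerN2 ler_wpM2r// ltW//.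
  exact: ce.
Qed.

Let dIcos (a : R) : 0 < cos a -> is_derive a 1 Icos (- (1 - b) * Isin a).
Proof.
move=> ca.
have <- : \int[mu]_(w in pos) (w `^ (- b) * (w * fs' a w)) = - (1 - b) * Isin a.
  apply: (@sing_by_parts _ _ (fs a) (fs' a) (2 * (27 / cos a ^+ 3)) b01) => // w w0.
  - by have [] := decay ca (cos_le1 a) w0 (bound_fs a w).
  - by have [] := decay ca (cos_le1 a) w0 (bound_fs' a w).
apply: (@dI fc fs') => // x w.
by apply: has_derivW; [derive|rewrite /fs' /=; ring].
Qed.

Let dIsin (a : R) : 0 < cos a -> is_derive a 1 Isin ((1 - b) * Icos a).
Proof.
move=> ca.
have E : \int[mu]_(w in pos) (w `^ (- b) * (w * fc' a w)) = - (1 - b) * Icos a.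
  apply: (@sing_by_parts _ _ (fc a) (fc' a) (2 * (27 / cos a ^+ 3)) b01) => // w w0.
  - by have [] := decay ca (cos_le1 a) w0 (bound_fc a w).
  - by have [] := decay ca (cos_le1 a) w0 (bound_fc' a w).
have -> : (1 - b) * Icos a = \int[mu]_(w in pos) (w `^ (- b) * (w * - fc' a w)).
  rewrite -[LHS]opprK -mulNr -E -mulN1r -RintegralZl//; last first.
    apply: (@integrable_sing _ _ _ (2 * (27 / cos a ^+ 3)) b01).
      by apply: (@measurable_fun_Rpos R) => w w0; apply: has_deriv_continuous; derive.
    by move=> w w0; have [] := decay ca (cos_le1 a) w0 (bound_fc' a w).
  by apply: eq_Rintegral => w _; ring.
apply: (@dI fs (fun x w => - fc' x w)) => // x w; rewrite ?normrN//.
by apply: has_derivW; [derive|rewrite /fc' /=; ring].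
Qed.

(** The derivatives of [Icos] and [Isin] are - (1 - b) [Isin] and (1 - b) [Icos], a rotation with
    angular speed 1 - b. Rotating back by (1 - b) x gives a constant vector, whose coordinates up to
    sign are the expressions in [E1] and [E2]. *)
Lemma Icos_Isin (a : R) : 0 <= a < pi / 2 ->
  Icos a = Icos 0 * cos ((1 - b) * a) /\ Isin a = Icos 0 * sin ((1 - b) * a).
Proof.
move=> /andP[a0 api].
have cpos (x : R) : 0 <= x <= a -> 0 < cos x.
  by move=> /andP[x0 xa]; apply: cos_gt0_pihalf; apply/andP; split; have := pi_gt0 R; lra.
have Isin0 : Isin 0 = 0.
  rewrite /Isin; under eq_Rintegral do rewrite sin0 mul0r sin0 !mulr0.
  by rewrite Rintegral_cst// mul0r.
have E1 : Icos a * cos ((1 - b) * a) + Isin a * sin ((1 - b) * a) =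
          Icos 0 * cos ((1 - b) * 0) + Isin 0 * sin ((1 - b) * 0).
  apply: (@derive0_constant _ (fun x => Icos x * cos ((1 - b) * x) + Isin x * sin ((1 - b) * x))) => // x xa.
  have d1 := dIcos (cpos _ xa); have d2 := dIsin (cpos _ xa).
  by apply: has_derivW; [derive|rewrite /=; ring].
have E2 : Icos a * sin ((1 - b) * a) - Isin a * cos ((1 - b) * a) =
          Icos 0 * sin ((1 - b) * 0) - Isin 0 * cos ((1 - b) * 0).
  apply: (@derive0_constant _ (fun x => Icos x * sin ((1 - b) * x) - Isin x * cos ((1 - b) * x))) => // x xa.
  have d1 := dIcos (cpos _ xa); have d2 := dIsin (cpos _ xa).
  by apply: has_derivW; [derive|rewrite /=; ring].
rewrite Isin0 mulr0 cos0 sin0 !mulr0 addr0 mulr1 in E1.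
rewrite Isin0 mulr0 cos0 sin0 !mulr0 mul0r subr0 in E2.
have CS := cos2Dsin2 ((1 - b) * a).
set C := cos ((1 - b) * a) in E1 E2 CS *; set S := sin ((1 - b) * a) in E1 E2 CS *.
split.
  rewrite -[LHS]mulr1 -CS -E1.
  have -> : Icos a * (C ^+ 2 + S ^+ 2) = (Icos a * C + Isin a * S) * C + (Icos a * S - Isin a * C) * S by ring.
  by rewrite E2 mul0r addr0.
rewrite -[LHS]mulr1 -CS -E1.
have -> : Isin a * (C ^+ 2 + S ^+ 2) = (Icos a * C + Isin a * S) * S - (Icos a * S - Isin a * C) * C by ring.
by rewrite E2 mul0r subr0.
Qed.

(** From w <= e^w and b < 1 one has w^(-b) >= e^(-w), so the integrand is at least e^(-2 w), whose
    integral is 1/2. *)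
Lemma Icos0_gt0 : 0 < Icos 0.
Proof.
have c0 : 0 < cos (0 : R) by rewrite cos0.
apply: (@lt_le_trans _ _ (2^-1)); first by rewrite invr_gt0.
have d2 (w : R) : is_derive w 1 (fun y => - 2^-1 * expR (- (2 * y))) (expR (- (2 * w))).
  by apply: has_derivW; [derive|rewrite /=; field].
have c2 (w : R) : {for w, continuous (fun y : R => expR (- (2 * y)))}.
  by apply: has_deriv_continuous; derive.
have i2 : mu.-integrable pos (EFin \o (fun w : R => expR (- (2 * w)))).
  apply: (@integrable_FTC_half_line _ _ (fun y => - 2^-1 * expR (- (2 * y))) _ _ 1) => // x y x0 y0.
  have ex1 : expR (- (2 * x)) <= 1 by rewrite -[leRHS]expR0 ler_expR oppr_le0 mulr_ge0// ltW.
  have := expR_ge0 (- (2 * y)); move: ex1; set u := expR _; set v := expR _; lra.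
have e1 : expR (- (2 * w)) @[w --> 0^'+] --> (1 : R).
  apply: cvg_at_right_filter; have c20 : expR (- (2 * w)) @[w --> (0 : R)] --> expR (- (2 * 0)) := c2 0.
  by move: c20; rewrite mulr0 oppr0 expR0.
have e0 : expR (- (2 * w)) @[w --> +oo] --> (0 : R).
  apply: (@cvg_comp _ _ _ (fun w : R => 2 * w) (fun w => expR (- w)) _ (+oo)).
    exact: gt0_cvgMry.
  exact: cvgr_expR.
have <- : \int[mu]_(w in pos) expR (- (2 * w)) = 2^-1.
  have -> : 2^-1 = - 2^-1 * 0 - - 2^-1 * 1 :> R by ring.
  apply: (@Rintegral_FTC_half_line _ _ (fun y => - 2^-1 * expR (- (2 * y)))) => //.
    by apply: cvgM => //; exact: cvg_cst.
  by apply: cvgM => //; exact: cvg_cst.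
apply: le_Rintegral => //; first exact: integrable_Icos.
move=> w; rewrite /= in_itv/= andbT => w0.
rewrite cos0 mul1r sin0 mul0r cos0 mulr1 (_ : - (2 * w) = - w + - w); last ring.
rewrite expRD ler_wpM2r ?expR_ge0// expRN powRN lef_pV2 ?posrE ?expR_gt0 ?powR_gt0//.
apply: (@le_trans _ _ (expR w `^ b)).
  rewrite ge0_ler_powR ?nnegrE ?expR_ge0 ?ltW//; first by case/andP: b01.
  by have := expR_ge1Dx w; lra.
rewrite -[leRHS]powRr1 ?expR_ge0// ler_powR//.
  by rewrite -expR0 ler_expR ltW.
by case/andP: b01 => _ /ltW.
Qed.

End ComplexGamma.

(** * Abelian theorem: from tails to exponentially damped means *)

Section LayerCake.
Context d (T : measurableType d) (R : realType) (P : probability T R).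
Notation mu := (@lebesgue_measure R).
Notation pos := (`](0%R : R), +oo[%classic).

Lemma Rintegral_FTC (Q Q' : R -> R) (a : R) : 0 <= a ->
  (forall v : R, is_derive v 1 Q (Q' v)) -> (forall v : R, {for v, continuous Q'}) ->
  (\int[mu]_(v in `[0%R, a]) (Q' v)%:E = (Q a - Q 0)%:E)%E.
Proof.
rewrite le_eqVlt => /predU1P[<-|a0] dQ cQ'.
  by rewrite subrr set_itv1 integral_set1.
rewrite EFinB; apply: continuous_FTC2 => //.
- by apply: continuous_in_subspaceT => x _; exact: cQ'.
- split.
  + by move=> x _; have [] := dQ x.
  + by apply: cvg_at_right_filter; exact: (has_deriv_continuous (dQ _)).
  + by apply: cvg_at_left_filter; exact: (has_deriv_continuous (dQ _)).
- by move=> x _; exact: is_derive_derive1.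
Qed.

(** Q (V) is the integral of Q' over (0, V), and the two integrations are exchanged on the set v < V
    w. Since Q' changes sign in the applications, Fubini with an integrable Q' is used instead of
    Tonelli. *)
Lemma layer_cake (V : T -> R) (Q Q' : R -> R) :
  measurable_fun setT V -> (forall w, 0 <= V w) ->
  (forall v : R, is_derive v 1 Q (Q' v)) -> (forall v : R, {for v, continuous Q'}) -> Q 0 = 0 ->
  mu.-integrable pos (EFin \o Q') ->
  \int[P]_w Q (V w) = \int[mu]_(v in pos) (Q' v * fine (P [set w : T | v < V w])).
Proof.
move=> mV V0 dQ cQ' Q00 iQ'.
pose q := Q' \_ pos.
pose A : set (T * measurableTypeR R) := [set z | z.2 < V z.1].
have mA : measurable A.
  rewrite (_ : A = (fun z => V z.1 - z.2) @^-1` `]0, +oo[%classic); last first.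
    by apply/seteqP; split=> z; rewrite /A /= in_itv/= andbT subr_gt0.
  rewrite -[X in measurable X]setTI.
  suff mm : measurable_fun setT (fun z : T * measurableTypeR R => V z.1 - z.2) by exact: mm.
  by apply: measurable_funB; [exact: measurableT_comp|exact: measurable_snd].
have mq : measurable_fun setT (q : measurableTypeR R -> R).
  apply/(measurable_restrictT Q') => //; exact: integrable_measurable iQ'.
have iq : mu.-integrable setT (EFin \o q).
  have -> : EFin \o q = (EFin \o Q') \_ pos by rewrite restrict_EFin.
  have mpos : measurable (pos : set (measurableTypeR R)) by exact: measurable_itv.
  by apply/(integrable_mkcond _ mpos).
pose f (z : T * measurableTypeR R) := (q z.2 * \1_A z)%:E.
have mf : measurable_fun setT f.
  apply/measurable_EFinP; apply: measurable_funM; last exact: measurable_indic.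
  exact: measurableT_comp.
have mfw w : measurable_fun setT (fun v : measurableTypeR R => q v * \1_A (w, v)).
  apply: measurable_funM => //.
  by apply: (measurableT_comp (measurable_indic mA)); exact: pair1_measurable.
have fle w v : `|q v * \1_A (w, v)| <= `|q v|.
  by rewrite normrM ler_piMr// indicE; case: (_ \in _); rewrite ?normr1 ?normr0.
have fi w : mu.-integrable setT (EFin \o (fun v : measurableTypeR R => q v * \1_A (w, v))).
  by apply: (@le_Rintegrable _ _ _ mu setT _ (fun v => `|q v|)) => //; exact: integrable_norm.
have iabs : (\int[mu]_v `|q v|%:E < +oo)%E by case/integrableP : iq.
have if_ : (P \x mu)%E.-integrable setT f.
  apply/(integrable12ltyP _ _ mf).
  apply: (@le_lt_trans _ _ (\int[P]_w (\int[mu]_v `|q v|%:E))%E); last first.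
    by rewrite integral_cst// [X in (_ * X)%E]probability_setT mule1.
  apply: ge0_le_integral => //=.
  - by move=> w _; exact: integral_ge0.
  - apply: (measurable_fun_fubini_tonelli_F (abse \o f)); first exact: measurableT_comp.
    by move=> z; exact: abse_ge0.
  - move=> w _; apply: ge0_le_integral => //=.
    + by apply/measurable_EFinP/measurableT_comp => //; exact: mfw.
    + by apply/measurable_EFinP/measurableT_comp.
    + by move=> v _; rewrite lee_fin fle.
have FT := Fubini if_.
have AE w v : ((w, v) \in A) = (v < V w).
  by apply/idP/idP => [/set_mem//|vV]; exact/mem_set.
have E1 w : (\int[mu]_v f (w, v) = (Q (V w))%:E)%E.
  rewrite -[Q (V w)]subr0 -Q00 -(Rintegral_FTC (V0 w) dQ cQ').
  have mQ' (D : set R) : measurable_fun D (EFin \o Q').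
    apply/measurable_EFinP; apply: (measurable_funS measurableT) => //.
    exact: continuous_measurable_fun.
  rewrite -integral_itv_bndo_bndc// -integral_itv_obnd_cbnd//.
  rewrite [RHS]integral_mkcond; apply: eq_integral => v _.
  rewrite /f /q /patch /= indicE AE !mem_setE !in_itv/= andbT.
  by case: (0 < v); case: (v < V w); rewrite /= ?mulr1 ?mulr0 ?mul0r.
have E2 (v : R) : (\int[P]_w f (w, v) = (q v * fine (P [set w : T | v < V w]))%:E)%E.
  have mB : measurable [set w : T | v < V w].
    rewrite (_ : [set w : T | v < V w] = V @^-1` `]v, +oo[%classic).
      by rewrite -[X in measurable X]setTI; exact: mV.
    by apply/seteqP; split=> w; rewrite /= in_itv/= andbT.
  have -> : (\int[P]_w f (w, v) = \int[P]_w ((q v)%:E * (\1_[set w : T | v < V w] w)%:E))%E.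
    apply: eq_integral => w _; rewrite /f EFinM !indicE AE.
    suff -> : (w \in [set w : T | v < V w]) = (v < V w) by [].
    by apply/idP/idP => [/set_mem//|vV]; exact/mem_set.
  rewrite integralZl//; last exact: integrable_indic.
  by rewrite integral_indic// setIT EFinM fineK// fin_num_measure.
rewrite /Rintegral; congr fine.
have -> : (\int[P]_w (Q (V w))%:E = \int[P]_w (\int[mu]_v f (w, v)))%E by apply: eq_integral => w _; rewrite E1.
rewrite FT [RHS]integral_mkcond; apply: eq_integral => v _.
by rewrite E2 /q /patch; case: ifP => // _; rewrite mul0r.
Qed.
End LayerCake.

Section Abelian.
Context d (T : measurableType d) (R : realType) (P : probability T R).
Notation mu := (@lebesgue_measure R).
Notation pos := (`](0%R : R), +oo[%classic).

(** Used to absorb constants into the majorant v^(-b) (1 + v) of the tail ratios. *)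
Lemma one_le_powR_mul (b v : R) : 0 < b < 1 -> 0 < v -> 1 <= v `^ (- b) * (1 + v).
Proof.
move=> /andP[b0 b1] v0; rewrite mulrC powRN ler_pdivlMr ?powR_gt0// mul1r.
apply: (@le_trans _ _ ((1 + v) `^ b)).
  by rewrite ge0_ler_powR ?nnegrE//; lra.
by rewrite -[leRHS]powRr1 ?ler_powR//; lra.
Qed.

Lemma fine_probability_le1 (A : set T) : measurable A -> fine (P A) <= 1.
Proof. by move=> mA; rewrite -lee_fin fineK ?fin_num_measure// probability_le1. Qed.

Lemma measurable_tail_set (V : T -> R) v : measurable_fun setT V -> measurable [set w | v < V w].
Proof.
move=> mV; rewrite (_ : [set w | v < V w] = V @^-1` `]v, +oo[%classic).
  by rewrite -[X in measurable X]setTI; exact: mV.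
by apply/seteqP; split=> w; rewrite /= in_itv/= andbT.
Qed.

Lemma measurable_tail (V : T -> R) : measurable_fun setT V ->
  measurable_fun setT (fun v : R => fine (P [set w | v < V w])).
Proof.
move=> mV; apply: nonincreasing_measurable => // x y xy.
rewrite fine_le ?fin_num_measure//; try exact: measurable_tail_set.
apply: le_measure; rewrite ?inE; try exact: measurable_tail_set.
by move=> w /=; exact: le_lt_trans.
Qed.

(** By the layer cake formula the scaled mean is the integral of Q' v times a tail ratio, and
    dominated convergence applies. The majorant has its own exponent b' because Potter bounds lose a
    little against the limiting exponent b. *)
Lemma abelian_limit (V : T -> R) (Q Q' g : R -> R) (b b' c C D t0 : R) :
  measurable_fun setT V -> (forall w, 0 <= V w) ->
  (forall v : R, is_derive v 1 Q (Q' v)) -> (forall v : R, {for v, continuous Q'}) -> Q 0 = 0 ->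
  0 < b' < 1 -> 0 < t0 ->
  (forall v, 0 < v -> fine (P [set w | v / t < V w]) / g t @[t --> 0^'+] --> c * v `^ (- b)) ->
  (forall t v, 0 < t < t0 -> 0 < v ->
     0 <= fine (P [set w | v / t < V w]) / g t <= C * (v `^ (- b') * (1 + v))) ->
  (forall v, 0 < v -> `|Q' v| * (1 + v) <= D / (1 + v) ^+ 2) ->
  (\int[P]_w Q (t * V w)) / g t @[t --> 0^'+] -->
    \int[mu]_(v in pos) (Q' v * (c * v `^ (- b))).
Proof.
move=> mV V0 dQ cQ' Q0 b'01 t00 Hlim Hdom Q'D.
have mQ' : measurable_fun pos Q' by exact: (@measurable_fun_Rpos R).
have iD : mu.-integrable pos (EFin \o (fun v => v `^ (- b') * (D / (1 + v) ^+ 2))).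
  apply: (@integrable_sing _ _ _ D b'01).
    apply: (@measurable_fun_Rpos R) => w w0; apply: has_deriv_continuous; derive.
    by rewrite sqrf_eq0 lt0r_neq0//; lra.
  move=> v v0; rewrite ger0_norm//; apply: le_trans (Q'D v v0).
  by rewrite mulr_ge0//; lra.
have iQ' : mu.-integrable pos (EFin \o Q').
  apply: (@le_Rintegrable _ _ _ mu pos _ (fun v => v `^ (- b') * (D / (1 + v) ^+ 2))) => //.
  move=> v; rewrite /= in_itv/= andbT => v0.
  apply: (@le_trans _ _ (`|Q' v| * (1 + v) * v `^ (- b'))).
    by rewrite -mulrA ler_peMr// mulrC one_le_powR_mul.
  by rewrite mulrC ler_wpM2l ?powR_ge0// Q'D.
have C0 : 0 <= C.
  have t02 : 0 < t0 / 2 < t0 by apply/andP; split; lra.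
  have /andP[h1 h2] := Hdom _ 1 t02 ltr01.
  have := le_trans h1 h2; rewrite pmulr_lge0// mulr_gt0 ?powR_gt0//; lra.
have key t : 0 < t -> (\int[P]_w Q (t * V w)) / g t =
    \int[mu]_(v in pos) (Q' v * (fine (P [set w | v / t < V w]) / g t)).
  move=> tp; rewrite (@layer_cake _ _ _ P (fun w => t * V w) Q Q')//; last 2 first.
  - exact: measurable_funM.
  - by move=> w; rewrite mulr_ge0// ltW.
  rewrite mulrC -RintegralZl//; last first.
    apply: (@le_Rintegrable _ _ _ mu pos _ (fun v => `|Q' v|)) => //.
    - apply: measurable_funM => //; apply: (measurable_funS measurableT) => //.
      by apply: measurable_tail; exact: measurable_funM.
    - move=> v _; rewrite normrM ler_piMr// ger0_norm ?fine_ge0//.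
      by apply: fine_probability_le1; apply: measurable_tail_set; exact: measurable_funM.
    - exact: integrable_norm.
  apply: eq_Rintegral => v _; rewrite mulrC -mulrA; congr (_ * _).
  congr (fine (P _) / _).
  by apply/seteqP; split=> w /=; rewrite ltr_pdivrMr// mulrC.
apply/cvg_at_rightP => u [u0 ucv].
have u0' : \forall n \near \oo, u n < t0 by exact: (cvgr_lt _ ucv).
have [N _ uN] := u0'.
rewrite -(cvg_shiftn N).
under eq_fun do rewrite key//.
apply: (Rintegral_cvg _ _ (RintegrableZ C _ iD) _ _).2 => //.
- move=> n; apply: measurable_funM => //; apply: measurable_funM => //.
  apply: (measurable_funS measurableT) => //.
  rewrite (_ : (fun v => _) = fun v => fine (P [set w | v < u (n + N)%N * V w])).
    by apply: measurable_tail; exact: measurable_funM.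
  apply/funext => v; congr (fine (P _)); apply/seteqP.
  by split=> w /=; rewrite ltr_pdivrMr// mulrC.
- move=> n v; rewrite /= in_itv/= andbT => v0.
  have un : 0 < u (n + N)%N < t0 by rewrite u0 uN//= leq_addl.
  have /andP[h1 h2] := Hdom _ v un v0.
  rewrite normrM (ger0_norm h1).
  apply: (@le_trans _ _ (`|Q' v| * (C * (v `^ (- b') * (1 + v))))); first by rewrite ler_wpM2l.
  rewrite mulrCA ler_wpM2l// mulrCA ler_wpM2l ?powR_ge0// Q'D//.
- move=> v; rewrite /= in_itv/= andbT => v0; apply: cvgM; first exact: cvg_cst.
  rewrite (cvg_shiftn N (fun n => fine (P [set w | v / u n < V w]) / g (u n))).
  by have /cvg_at_rightP := Hlim v v0; apply.
Qed.

(** This is the Abelian limit for Q v = v exp (- v e^(-i a)), taken in real and imaginary parts; the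
    boolean [k] selects the part. *)
Lemma sin_cos_abelian (V : T -> R) (g : R -> R) (b b' c C t0 a : R) :
  measurable_fun setT V -> (forall w, 0 <= V w) ->
  0 < b < 1 -> 0 < b' < 1 -> 0 < t0 -> 0 <= a < pi / 2 ->
  (forall v, 0 < v -> fine (P [set w | v / t < V w]) / g t @[t --> 0^'+] --> c * v `^ (- b)) ->
  (forall t v, 0 < t < t0 -> 0 < v ->
     0 <= fine (P [set w | v / t < V w]) / g t <= C * (v `^ (- b') * (1 + v))) ->
  (\int[P]_w (t * V w * (expR (- (cos a * (t * V w))) * cos (sin a * (t * V w))))) / g t
    @[t --> 0^'+] --> c * (b * Icos b 0) * cos ((1 - b) * a) /\
  (\int[P]_w (t * V w * (expR (- (cos a * (t * V w))) * sin (sin a * (t * V w))))) / g t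
    @[t --> 0^'+] --> c * (b * Icos b 0) * sin ((1 - b) * a).
Proof.
move=> mV V0 b01 b'01 t00 aI Hlim Hdom.
have ca : 0 < cos a.
  have /andP[a0 a1] := aI; have p0 := pi_gt0 R.
  by apply: cos_gt0_pihalf; apply/andP; split; lra.
have [Ec Es] := Icos_Isin b01 aI.
pose F (k : bool) v := expR (- (cos a * v)) * (if k then cos (sin a * v) else sin (sin a * v)).
pose F' (k : bool) v := if k then
  expR (- (cos a * v)) * (- (cos a * cos (sin a * v)) - sin a * sin (sin a * v)) else
  expR (- (cos a * v)) * (- (cos a * sin (sin a * v)) + sin a * cos (sin a * v)).
have dF k (v : R) : is_derive v 1 (F k) (F' k v).
  by case: k; rewrite /F /F'; apply: has_derivW; [derive|rewrite /=; ring|derive|rewrite /=; ring].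
have cF' k (v : R) : {for v, continuous (F' k)}.
  by case: k; rewrite /F'; apply: has_deriv_continuous; derive.
have cs1 x : `|cos x : R| <= 1 by rewrite ler_norml cos_geN1 cos_le1.
have sn1 x : `|sin x : R| <= 1 by rewrite ler_norml sin_geN1 sin_le1.
have mul1 (x y : R) : `|x| <= 1 -> `|y| <= 1 -> `|x * y| <= 1 by move=> *; rewrite normrM mulr_ile1.
have bF k v : `|F k v| <= expR (- (cos a * v)).
  rewrite normrM ger0_norm ?expR_ge0// ler_piMr ?expR_ge0//.
  by case: k; [exact: cs1|exact: sn1].
have bF' k v : `|F' k v| <= 2 * expR (- (cos a * v)).
  rewrite /F'; case: k; rewrite normrM ger0_norm ?expR_ge0// mulrC ler_wpM2r ?expR_ge0//.
    apply: le_trans (ler_normB _ _) _; rewrite normrN.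
    by have := mul1 _ _ (cs1 a) (cs1 (sin a * v)); have := mul1 _ _ (sn1 a) (sn1 (sin a * v)); lra.
  apply: le_trans (ler_normD _ _) _; rewrite normrN.
  by have := mul1 _ _ (cs1 a) (sn1 (sin a * v)); have := mul1 _ _ (sn1 a) (cs1 (sin a * v)); lra.
(* Four powers of 1 + v must be absorbed: one from F + v F', one from the tail majorant, two for
   integrability. The exponential is split into two factors of rate cos a / 2, each of which absorbs
   three powers at the cost of a factor D. *)
pose D := 27 / (cos a / 2) ^+ 3.
have cos2 : 0 < cos a / 2 <= 1 by have := cos_le1 a; move=> ?; apply/andP; split; lra.
have D0 : 0 < D by rewrite divr_gt0// exprn_gt0//; lra.
have bQ k v : 0 < v -> `|F k v + v * F' k v| * (1 + v) <= 2 * D ^+ 2 / (1 + v) ^+ 2.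
  move=> v0; rewrite ler_pdivlMr ?exprn_gt0//; last lra.
  have B := expR_poly_bound cos2 (ltW v0); rewrite -/D in B.
  have e0 := expR_ge0 (- (cos a / 2 * v)).
  have eE : expR (- (cos a * v)) = expR (- (cos a / 2 * v)) * expR (- (cos a / 2 * v)).
    by rewrite -expRD; congr expR; field.
  set e := expR (- (cos a / 2 * v)) in B e0 eE.
  have Q1 : `|F k v + v * F' k v| <= 2 * (1 + v) * (e * e).
    apply: le_trans (ler_normD _ _) _; rewrite (normrM v) (ger0_norm (ltW v0)) -eE.
    have h1 := bF k v; have h2 := ler_wpM2l (ltW v0) (bF' k v).
    have h3 := expR_ge0 (- (cos a * v)); lra.
  have v1 : 1 <= 1 + v by lra.
  have X1 : 0 <= e * (1 + v) ^+ 3 by rewrite mulr_ge0// exprn_ge0//; lra.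
  have X2 : (e * (1 + v) ^+ 3) * (e * (1 + v) ^+ 3) <= D ^+ 2 by rewrite expr2 ler_pM.
  have X3 : 2 * (1 + v) * (e * e) * (1 + v) * (1 + v) ^+ 2 <= 2 * ((e * (1 + v) ^+ 3) * (e * (1 + v) ^+ 3)).
    have -> : 2 * (1 + v) * (e * e) * (1 + v) * (1 + v) ^+ 2 = 2 * (e * e) * (1 + v) ^+ 4 by ring.
    have -> : 2 * ((e * (1 + v) ^+ 3) * (e * (1 + v) ^+ 3)) = 2 * (e * e) * (1 + v) ^+ 6 by ring.
    by rewrite ler_wpM2l ?mulr_ge0// ler_weXn2l.
  apply: (@le_trans _ _ (2 * (1 + v) * (e * e) * (1 + v) * (1 + v) ^+ 2)).
    by rewrite ler_wpM2r ?exprn_ge0 ?ler_wpM2r//; lra.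
  by apply: le_trans X3 _; rewrite ler_wpM2l.
have L k : (\int[P]_w (t * V w * F k (t * V w))) / g t @[t --> 0^'+] -->
    \int[mu]_(v in pos) ((F k v + v * F' k v) * (c * v `^ (- b))).
  apply: (@abelian_limit V (fun v => v * F k v) (fun v => F k v + v * F' k v) g b b' c C (2 * D ^+ 2) t0) => //.
  - by move=> v; have dFv := dF k v; apply: has_derivW; [derive|rewrite /=; ring].
  - move=> v; apply: cvgD; first exact: (has_deriv_continuous (dF k v)).
    by apply: cvgM; [exact: cvg_id|exact: cF'].
  - by rewrite mul0r.
  - by move=> v v0; exact: bQ.
(* Integration by parts turns the term with F' into - (1 - b) times the term with F, which leaves
   the factor b. *)
have I k : \int[mu]_(v in pos) ((F k v + v * F' k v) * (c * v `^ (- b))) =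
    c * (b * \int[mu]_(v in pos) (v `^ (- b) * F k v)).
  have D1 := expR_decay (c := cos a) (k := 2).
  have c01 : 0 < cos a <= 1 by rewrite ca cos_le1.
  have mF : measurable_fun pos (F k).
    by apply: (@measurable_fun_Rpos R) => v _; exact: has_deriv_continuous (dF k v).
  have mF' : measurable_fun pos (fun v => v * F' k v).
    by apply: measurable_funM => //; exact: (@measurable_fun_Rpos R).
  have iF : mu.-integrable pos (EFin \o (fun v => v `^ (- b) * F k v)).
    apply: (integrable_sing (C := 2 * (27 / cos a ^+ 3)) b01 mF) => v v0.
    have [] // := D1 v (F k v) c01 _ (ltW v0) _.
    by apply: le_trans (bF k v) _; have := expR_ge0 (- (cos a * v)); lra.
  have iF' : mu.-integrable pos (EFin \o (fun v => v `^ (- b) * (v * F' k v))).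
    apply: (integrable_sing (C := 2 * (27 / cos a ^+ 3)) b01 mF') => v v0.
    by have [] // := D1 v (F' k v) c01 _ (ltW v0) (bF' k v).
  have BP : \int[mu]_(v in pos) (v `^ (- b) * (v * F' k v)) =
      - (1 - b) * \int[mu]_(v in pos) (v `^ (- b) * F k v).
    apply: (@sing_by_parts _ _ (F k) (F' k) (2 * (27 / cos a ^+ 3)) b01) => // v v0.
    - have [] // := D1 v (F k v) c01 _ (ltW v0) _.
      by apply: le_trans (bF k v) _; have := expR_ge0 (- (cos a * v)); lra.
    - by have [] // := D1 v (F' k v) c01 _ (ltW v0) (bF' k v).
  transitivity (\int[mu]_(v in pos) (c * (v `^ (- b) * F k v + v `^ (- b) * (v * F' k v)))).
    by apply: eq_Rintegral => v _; ring.
  rewrite RintegralZl//; last exact: RintegrableD.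
  by rewrite RintegralD// BP; congr (c * _); ring.
split.
  by have := L true; rewrite I -/(Icos b a) Ec; congr (_ @ _ --> _); ring.
by have := L false; rewrite I -/(Isin b a) Es; congr (_ @ _ --> _); ring.
Qed.

End Abelian.

(** * Potter bound for a monotone tail *)

Section Potter.
Context {R : realType}.

Lemma dyadic_bracket (u : R) : 0 < u <= 1 -> exists k : nat, 2^-1 ^+ k.+1 < u <= 2^-1 ^+ k.
Proof.
move=> /andP[u0 u1].
have ex : exists k : nat, 2^-1 ^+ k.+1 < u.
  have : \forall k \near \oo, 2^-1 ^+ k < u.
    apply: (cvgr_lt 0) => //; apply: cvg_expr; rewrite ger0_norm//; lra.
  move=> [N _ H]; exists N; apply: H => /=; exact: leqnSn.
exists (ex_minn ex); case: ex_minnP => -[|k] ku kmin; first by rewrite ku expr0.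
rewrite ku /= leNgt; apply/negP => uk; have := kmin k uk; rewrite ltnn//.
Qed.

(** Since b < dlt, halving the argument eventually multiplies G by at most 2^dlt. Iteration gives
    the bound along dyadic factors, and monotonicity fills the gaps between them at the price of one
    more factor 2^dlt. *)
Lemma potter (G : R -> R) (b dlt : R) :
  {homo G : x y /~ x <= y} -> (forall y, 0 < G y <= 1) -> 0 < dlt -> b < dlt ->
  G (2^-1 * y) / G y @[y --> +oo] --> 2 `^ b ->
  exists C y0 : R, [/\ 0 < C, 0 < y0 &
    forall y u, y0 <= y -> 0 < u <= 1 -> G (u * y) <= C * u `^ (- dlt) * G y].
Proof.
move=> Gni G01 d0 bd lim.
have G0 y : 0 < G y by case/andP: (G01 y).
have r0 : 0 < 2 `^ dlt :> R by rewrite powR_gt0.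
have near1 : \forall y \near +oo, G (2^-1 * y) / G y < 2 `^ dlt.
  apply: (cvgr_lt _ lim); rewrite /powR gt_eqF// ltr_expR ltr_pM2r// ln_gt0//; lra.
have [y0 y00 half] : exists2 y0, 0 < y0 & forall y, y0 <= y -> G (2^-1 * y) <= 2 `^ dlt * G y.
  have [M [_ HM]] := near1; exists (Num.max 1 (M + 1)).
    by rewrite lt_max ltr01.
  move=> y; rewrite ge_max => /andP[y1 yM].
  by rewrite -ler_pdivrMr// ltW// HM//; lra.
have iter k : forall y, y0 <= 2^-1 ^+ k * y -> G (2^-1 ^+ k.+1 * y) <= (2 `^ dlt) ^+ k.+1 * G y.
  elim: k => [|k IH] y; first by rewrite expr0 mul1r !expr1; exact: half.
  move=> yk; have y0y : y0 <= y.
    have cy : 0 < 2^-1 ^+ k.+1 * y by exact: lt_le_trans yk.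
    rewrite pmulr_rgt0 ?exprn_gt0// in cy.
    by apply: (le_trans yk); rewrite ler_piMl ?(ltW cy)// exprn_ile1//; lra.
  have := IH (2^-1 * y); rewrite mulrA -exprSr => /(_ yk).
  rewrite mulrA -exprSr => H; apply: le_trans H _.
  by rewrite [in leRHS]exprSr -mulrA ler_wpM2l ?exprn_ge0 ?half// ltW.
have Gge0 y : 0 <= G y by exact: ltW.
have rge0 : 0 <= 2 `^ dlt :> R by exact: ltW.
have big y u : y0 <= y -> 0 < u <= 1 -> y0 <= u * y -> G (u * y) <= 2 `^ dlt * u `^ (- dlt) * G y.
  move=> yy u01 uy; have [k /andP[k1 k2]] := dyadic_bracket u01.
  have /andP[u0 u1] := u01; have yp : 0 < y by exact: lt_le_trans yy.
  apply: (@le_trans _ _ (G (2^-1 ^+ k.+1 * y))).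
    by apply: Gni; rewrite ler_pM2r// ltW.
  apply: le_trans (iter k y _) _; first by apply: (le_trans uy); rewrite ler_pM2r.
  rewrite ler_wpM2r// exprS ler_wpM2l//.
  rewrite powRN -[leRHS]mul1r ler_pdivlMr ?powR_gt0//.
  have -> : (2 `^ dlt) ^+ k = (2 ^+ k) `^ dlt :> R.
    by rewrite -powR_mulrn// -powRrM mulrC powRrM powR_mulrn.
  have u0' := ltW u0; have k0 : 0 <= 2 ^+ k :> R by rewrite exprn_ge0.
  rewrite -powRM//; apply: (@le_trans _ _ (1 `^ dlt)); last by rewrite powR1.
  rewrite ge0_ler_powR ?nnegrE ?mulr_ge0//; first exact: ltW.
  by rewrite mulrC -ler_pdivlMr ?exprn_gt0// mul1r -exprVn.
(* The second entry serves the case u y < y0, outside the range of the iteration: there G (u y) <=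
   1, and the bound at the factor y0 / y > u shows that 1 is at most the right-hand side. *)
pose C := Num.max (2 `^ dlt) (2 `^ dlt / G y0).
exists C, y0; split => //; first by rewrite lt_max r0.
move=> y u yy u01; have /andP[u0 u1] := u01; have yp : 0 < y by exact: lt_le_trans yy.
have [uy|uy] := leP y0 (u * y).
  apply: le_trans (big _ _ yy u01 uy) _; rewrite ler_wpM2r// ler_wpM2r ?powR_ge0//.
  by rewrite le_max lexx.
have v0 : 0 < y0 / y by rewrite divr_gt0.
have v01 : 0 < y0 / y <= 1 by rewrite v0 ler_pdivrMr// mul1r.
have := big _ _ yy v01; rewrite divfK ?gt_eqF// => /(_ (lexx _)) H.
apply: (@le_trans _ _ 1); first by case/andP: (G01 (u * y)).
apply: (@le_trans _ _ (2 `^ dlt / G y0 * (y0 / y) `^ (- dlt) * G y)).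
  have -> : 2 `^ dlt / G y0 * (y0 / y) `^ (- dlt) * G y = (2 `^ dlt * (y0 / y) `^ (- dlt) * G y) / G y0.
    by ring.
  by rewrite ler_pdivlMr// mul1r.
rewrite ler_wpM2r//.
apply: ler_pM; rewrite ?powR_ge0 ?divr_ge0 ?le_max ?lexx ?orbT//.
rewrite !powRN lef_pV2 ?posrE ?powR_gt0//.
have v0' := ltW v0; have u0' := ltW u0.
rewrite ge0_ler_powR ?nnegrE//; first exact: ltW.
by rewrite ler_pdivlMr// ltW.
Qed.

End Potter.

(** * Independence: product laws, expectations, partial sums *)

Section Independence.
Context d (T : measurableType d) (R : realType) (P : probability T R).
Context d1 (E1 : measurableType d1) d2 (E2 : measurableType d2).

Lemma finite_measure_prod_unique (m1 m2 : {measure set (E1 * E2) -> \bar R}) :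
  (forall A B, measurable A -> measurable B -> m1 (A `*` B) = m2 (A `*` B)) ->
  (m1 setT < +oo)%E -> forall X, measurable X -> m1 X = m2 X.
Proof.
move=> m12 m1oo X mX.
pose C : set (set (E1 * E2)) :=
  [set C | exists A, measurable A /\ exists B, measurable B /\ C = A `*` B].
apply: (measure_unique C (fun=> setT)) => //.
- rewrite measurable_prod_measurableType; congr (<<s _ >>).
  rewrite predeqE; split => [[A mA [B mB <-]]|[A [mA [B [mB ->]]]]].
    by exists A; split => //; exists B.
  by exists A => //; exists B.
- move=> _ _ [A1 [mA1 [A2 [mA2 ->]]]] [B1 [mB1 [B2 [mB2 ->]]]].
  rewrite -setXI; exists (A1 `&` B1); split; first exact: measurableI.
  by exists (A2 `&` B2); split => //; exact: measurableI.
- by move=> _; exists setT; split => //; exists setT; rewrite setXTT.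
- by rewrite predeqE => x; split => // _; exists 0%N.
- by move=> _ [A [mA [B [mB ->]]]]; exact: m12.
Qed.

Lemma pushforward_prod_unique (m1 m2 : {measure set T -> \bar R}) (phi : T -> E1 * E2) :
  measurable_fun setT phi ->
  (forall A B, measurable A -> measurable B ->
    m1 (phi @^-1` (A `*` B)) = m2 (phi @^-1` (A `*` B))) ->
  (m1 setT < +oo)%E ->
  forall X, measurable X -> m1 (phi @^-1` X) = m2 (phi @^-1` X).
Proof.
move=> mphi m12 m1oo X mX.
by apply: (@finite_measure_prod_unique (pushforward m1 phi) (pushforward m2 phi)).
Qed.

Variables (U : {mfun T >-> E1}) (V : {mfun T >-> E2}).
Hypothesis UV : independent_rv P U V.

Definition mfun_pair w := (U w, V w).

Lemma measurable_mfun_pair : measurable_fun setT mfun_pair.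
Proof. by apply: measurable_fun_pair; exact: measurable_funPT. Qed.

HB.instance Definition _ :=
  isMeasurableFun.Build _ _ _ _ mfun_pair measurable_mfun_pair.

(** The joint law is the product of the marginal laws, since both agree on rectangles; Fubini then
    applies because f is bounded. *)
Lemma independent_expectation (f : E1 * E2 -> R) C : measurable_fun setT f ->
  (forall z, `|f z| <= C) ->
  \int[P]_w f (U w, V w) = \int[P]_w \int[P]_w' f (U w, V w').
Proof.
move=> mf fC.
pose mm := (distribution P U \x distribution P V)%E.
have mfe : measurable_fun setT (EFin \o f) by exact/measurable_EFinP.
have E X : measurable X -> distribution P mfun_pair X = mm X.
  by move=> mX; apply/esym; apply: product_measure_unique => // A B mA mB; rewrite -UV.
have mmT : (mm setT < +oo)%E.
  by rewrite -E// -ge0_fin_numE// fin_num_measure.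
have immf : mm.-integrable setT (EFin \o f).
  apply: measurable_bounded_integrable => //.
  by exists C; split; [exact: num_real|move=> M CM x _ /=; rewrite (le_trans (fC x))// ltW].
have mf2 x : measurable_fun setT (fun w' => f (x, V w')).
  apply: (measurableT_comp mf).
  by apply: measurable_fun_pair; [exact: measurable_cst|exact: measurable_funPT].
pose phi x := \int[P]_w' f (x, V w').
have phiE x : (\int[distribution P V]_y (f (x, y))%:E = (phi x)%:E)%E.
  rewrite integral_distribution.
  - by rewrite /phi /Rintegral fineK//; apply: integrable_fin_num => //; exact: bounded_integrable.
  - by apply: (measurableT_comp mfe); exact: pair1_measurable.
  - exact: (@bounded_integrable _ _ _ P _ (C)).
have mphi : measurable_fun setT phi.
  apply/measurable_EFinP; rewrite (_ : EFin \o phi = fun x => (\int[distribution P V]_y (f (x, y))%:E)%E).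
    exact: (measurable_fubini_F immf).
  by apply/funext => x; rewrite phiE.
have phiC x : `|phi x| <= C.
  rewrite /phi; apply: le_trans (ler_norm_Rintegral (g := fun=> C) measurableT (mf2 x) _ _) _ => //.
    by apply: (@bounded_integrable _ _ _ P _ (`|C|)) => //.
  by rewrite Rintegral_cstT.
rewrite /Rintegral; congr fine.
transitivity (\int[distribution P mfun_pair]_z (f z)%:E)%E.
  rewrite integral_distribution//.
  by apply: (@bounded_integrable _ _ _ P _ (C)) => //; apply: (measurableT_comp mf); exact: measurable_funPT.
rewrite (eq_measure_integral mm); last by move=> A mA _; exact: E.
rewrite -(integral12_prod_meas1 immf).
transitivity (\int[distribution P U]_x (EFin \o phi) x)%E.
  by apply: eq_integral => x _; exact: phiE.
rewrite (integral_distribution (f := EFin \o phi)) //; first exact/measurable_EFinP.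
apply: (@bounded_integrable _ _ _ P _ (C)) => //.
by apply: (measurableT_comp mphi); exact: measurable_funPT.
Qed.

Lemma independent_expectation_mul (g : E1 -> R) (h : E2 -> R) C D :
  measurable_fun setT g -> measurable_fun setT h ->
  (forall x, `|g x| <= C) -> (forall y, `|h y| <= D) ->
  \int[P]_w (g (U w) * h (V w)) = (\int[P]_w g (U w)) * (\int[P]_w h (V w)).
Proof.
move=> mg mh gC hD.
have mgU : measurable_fun setT (g \o U) by apply: measurableT_comp => //; exact: measurable_funPT.
have mhV : measurable_fun setT (h \o V) by apply: measurableT_comp => //; exact: measurable_funPT.
have ig : P.-integrable setT (EFin \o (g \o U)) by apply: (@bounded_integrable _ _ _ P _ C) => // x; exact: gC.
have ih : P.-integrable setT (EFin \o (h \o V)) by apply: (@bounded_integrable _ _ _ P _ D) => // x; exact: hD.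
rewrite [LHS](@independent_expectation (fun z => g z.1 * h z.2) (C * D)).
- transitivity (\int[P]_w (g (U w) * \int[P]_w' h (V w'))); last exact: RintegralZr.
  by apply: eq_Rintegral => w _; rewrite -(RintegralZl (f := h \o V)).
- by apply: measurable_funM; apply: measurableT_comp.
- by move=> z; rewrite normrM ler_pM.
Qed.

End Independence.

Section IndependentSums.
Context d (T : measurableType d) (R : realType) (P : probability T R).
Context d1 (E : measurableType d1) (Z : nat -> {mfun T >-> E}).
Hypothesis indZ : mutually_independent P (fun i w => Z i w).
Variables (p q : {mfun E >-> R}).

Definition partial_sums (s : seq nat) (w : T) : R * R :=
  (\sum_(j <- s) p (Z j w), \sum_(j <- s) q (Z j w)).

Lemma measurable_partial_sums s : measurable_fun setT (partial_sums s).
Proof.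
apply: measurable_fun_pair; apply: measurable_sum => j.
  by apply: measurableT_comp; exact: measurable_funPT.
by apply: measurableT_comp; exact: measurable_funPT.
Qed.

HB.instance Definition _ s :=
  isMeasurableFun.Build _ _ _ _ (partial_sums s) (measurable_partial_sums s).

Let cyl (J : {fset nat}) (A : nat -> set E) := \bigcap_(i in [set` J]) Z i @^-1` A i.

Let measurable_cyl J A : (forall i, i \in J -> measurable (A i)) -> measurable (cyl J A).
Proof.
move=> mA; apply: fin_bigcap_measurable => // i iJ.
by rewrite -[X in measurable X]setTI; apply: measurable_funPT => //; exact: mA.
Qed.

(** The cylinder over J is general so that the induction can move a new index k into it. For C =
    [cyl J A], the restriction of P to C and the multiple P(C) P are compared on sets determined by
    [Z k] and the remaining sums. On rectangles they agree by two uses of the induction hypothesis,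
    with the index sets {k} and {k} united with J. *)
Lemma independent_partial_sums s (J : {fset nat}) (A : nat -> set E) (B : set (R * R)) :
  uniq s -> (forall i, i \in J -> i \notin s) ->
  (forall i, i \in J -> measurable (A i)) -> measurable B ->
  P (partial_sums s @^-1` B `&` cyl J A) =
  (P (partial_sums s @^-1` B) * P (cyl J A))%E.
Proof.
elim: s J A B => [|k s IH] J A B; last move=> /= /andP[ks us] Js mA mB.
  move=> _ _ mA mB; have [B0|nB0] := pselect (B (0, 0)).
    rewrite (_ : _ @^-1` B = setT) ?setTI ?probability_setT ?mul1e//.
    by apply/seteqP; split=> // w _; rewrite /= /partial_sums !big_nil.
  rewrite (_ : _ @^-1` B = set0) ?set0I ?measure0 ?mul0e//.
  by apply/seteqP; split=> // w; rewrite /= /partial_sums !big_nil.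
pose C := cyl J A; have mC : measurable C by exact: measurable_cyl.
pose phi w := (Z k w, partial_sums s w).
have mphi : measurable_fun setT phi by apply: measurable_fun_pair; exact: measurable_funPT.
have JC : P (partial_sums (k :: s) @^-1` B `&` C) = (P C * P (partial_sums (k :: s) @^-1` B))%E.
  pose D : set (E * (R * R)) := (fun z => (p z.1 + z.2.1, q z.1 + z.2.2)) @^-1` B.
  have mD : measurable D.
    have H : measurable_fun setT (fun z : E * (R * R) => (p z.1 + z.2.1, q z.1 + z.2.2)).
      apply: measurable_fun_pair; apply: measurable_funD.
      - by apply: (measurableT_comp (measurable_funPT p)); exact: measurable_fst.
      - by apply: (measurableT_comp measurable_fst); exact: measurable_snd.
      - by apply: (measurableT_comp (measurable_funPT q)); exact: measurable_fst.
      - by apply: (measurableT_comp measurable_snd); exact: measurable_snd.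
    by rewrite -[X in measurable X]setTI; exact: H.
  have -> : partial_sums (k :: s) @^-1` B = phi @^-1` D.
    by apply/seteqP; split=> w; rewrite /= /partial_sums !big_cons.
  pose c := NngNum (fine_ge0 (measure_ge0 P C)).
  have cE X : mscale c P X = (P C * P X)%E by rewrite /mscale/= fineK// fin_num_measure.
  rewrite -cE; apply: (@pushforward_prod_unique _ _ _ _ _ _ _ (mrestr P mC) (mscale c P) phi mphi _ _ D mD) => //.
    move=> A' B' mA' mB'; apply/esym; apply: (etrans (cE _)); apply/esym.
    have E1 : phi @^-1` (A' `*` B') = partial_sums s @^-1` B' `&` Z k @^-1` A'.
      by apply/seteqP; split=> w /= [].
    have := IH [fset k]%fset (fun=> A') B' us _ _ mB'.
    rewrite (_ : cyl [fset k]%fset (fun=> A') = Z k @^-1` A'); last first.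
      apply/seteqP; split=> w; first by apply; rewrite /= inE.
      by move=> wA i; rewrite /= inE => /eqP ->.
    rewrite E1 => ->; last 2 first.
    - by move=> i; rewrite inE => /eqP ->.
    - by [].
    pose A2 i := if i == k then A' else A i.
    have nkJ : k \notin J by apply/negP => /Js; rewrite inE eqxx.
    have A2J i : i \in J -> A2 i = A i.
      by move=> iJ; rewrite /A2; case: eqP => // ik; move: nkJ; rewrite -ik iJ.
    have cyl2 : cyl (k |` J)%fset A2 = Z k @^-1` A' `&` C.
      apply/seteqP; split=> w.
        move=> H; split; first by have := H k; rewrite /= /A2 eqxx; apply; rewrite !inE eqxx.
        by move=> i /= iJ; have := H i; rewrite /= A2J//; apply; rewrite !inE iJ orbT.
      move=> [wk wC] i /=; rewrite !inE => /orP[/eqP ->|iJ]; first by rewrite /A2 eqxx.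
      by rewrite /= A2J//; exact: wC.
    have mA2 i : i \in (k |` J)%fset -> measurable (A2 i).
      by rewrite !inE /A2; case: eqP => //= _; exact: mA.
    transitivity (P (partial_sums s @^-1` B' `&` (Z k @^-1` A' `&` C))); first by rewrite setIA.
    rewrite -cyl2 IH//; last first.
      move=> i; rewrite !inE => /orP[/eqP ->//|/Js]; rewrite inE negb_or => /andP[]//.
    rewrite muleCA; congr (_ * _)%E.
    rewrite /cyl indZ// big_fsetU1//= indZ//.
    rewrite /A2 eqxx muleC; congr (_ * _)%E.
    apply: eq_big_seq => i iJ; rewrite -/(A2 i) A2J//.
  have : (P (setT `&` C) < +oo)%E by rewrite setTI -ge0_fin_numE// fin_num_measure.
  by [].
by rewrite JC muleC.
Qed.

Lemma independent_rest k s : uniq s -> k \notin s ->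
  independent_rv P (Z k) (partial_sums s).
Proof.
move=> us ks A B mA mB; have := @independent_partial_sums s [fset k]%fset (fun=> A) B us.
rewrite (_ : cyl [fset k]%fset (fun=> A) = Z k @^-1` A); last first.
  apply/seteqP; split=> w; first by apply; rewrite /= inE.
  by move=> wA i; rewrite /= inE => /eqP ->.
rewrite setIC muleC; apply=> // i; by rewrite inE => /eqP ->.
Qed.

End IndependentSums.

(** * Tail of a product with a regularly varying factor (Breiman) *)

Section Breiman.
Context d (T : measurableType d) (R : realType) (P : probability T R).

Lemma Rintegral_cvg_at_right d' (T' : measurableType d') (mu : {measure set T' -> \bar R})
    (D : set T') (f : R -> T' -> R) f0 g t0 : measurable D -> 0 < t0 ->
  (forall t, 0 < t < t0 -> measurable_fun D (f t)) ->
  mu.-integrable D (EFin \o g) ->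
  (forall t x, 0 < t < t0 -> D x -> `|f t x| <= g x) ->
  (forall x, D x -> f t x @[t --> 0^'+] --> f0 x) ->
  \int[mu]_(x in D) f t x @[t --> 0^'+] --> \int[mu]_(x in D) f0 x.
Proof.
move=> mD t00 mf ig fg ff; apply/cvg_at_rightP => u [u0 ucv].
have [N _ uN] : \forall n \near \oo, u n < t0 by exact: (cvgr_lt _ ucv).
have uI n : 0 < u (n + N)%N < t0 by rewrite u0 uN//= leq_addl.
rewrite -(cvg_shiftn N); apply: (Rintegral_cvg mD _ ig _ _).2 => [n|n x Dx|x Dx].
- exact: mf.
- exact: fg.
- rewrite (cvg_shiftn N (fun n => f (u n) x)).
  by have /cvg_at_rightP := ff x Dx; apply.
Qed.

Lemma integrable_powR (b e : R) (f : T -> R) : 0 < b < e ->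
  measurable_fun setT f -> (forall w, 0 <= f w) ->
  P.-integrable setT (EFin \o (fun w => f w `^ e)) ->
  P.-integrable setT (EFin \o (fun w => f w `^ b)).
Proof.
move=> /andP[b0 be] mf f0 fi.
apply: (@le_Rintegrable _ _ _ P setT _ (fun w => 1 + f w `^ e)) => //.
- exact: (measurableT_comp (measurable_powR _)).
- move=> w _; rewrite ger0_norm ?powR_ge0//.
  have [p1|p1] := leP (f w) 1.
    apply: (@le_trans _ _ 1); last by rewrite lerDl powR_ge0.
    apply: (@le_trans _ _ (1 `^ b)); last by rewrite powR1.
    by rewrite ge0_ler_powR ?nnegrE// ltW.
  apply: (@le_trans _ _ (f w `^ e)); last by rewrite lerDr.
  by rewrite ler_powR ?ltW.
- apply: RintegrableD => //.
  by apply: (@bounded_integrable _ _ _ P _ 1) => // x; rewrite normr1.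
Qed.

Variables (X Y : {mfun T >-> R}) (p : {mfun R >-> R}) (b dlt : R).
Hypothesis XY : independent_rv P X Y.
Hypothesis p0 : forall x, 0 <= p x.
Hypothesis bI : 0 < b < dlt.
Hypothesis d1 : dlt < 1.
Hypothesis pint : P.-integrable setT (EFin \o (fun w => p (X w) `^ dlt)).

Let G y := fine (P [set w | y < Y w]).

Hypothesis Gpos : forall y, 0 < G y.
Hypothesis Grv : forall t, 0 < t -> G (t * y) / G y @[y --> +oo] --> t `^ (- b).

(** Nothing is assumed here on the sign of [Y]. For p >= 0 the truncation makes the product
    nonnegative everywhere and changes no tail beyond a positive level. *)
Definition breiman_product w := p (X w) * Num.max (Y w) 0.

Lemma breiman_product_ge0 w : 0 <= breiman_product w.
Proof. by rewrite mulr_ge0// le_max lexx orbT. Qed.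

Lemma measurable_breiman_product : measurable_fun setT breiman_product.
Proof.
apply: measurable_funM.
  by apply: measurableT_comp; exact: measurable_funPT.
by apply: measurable_maxr => //; exact: measurable_funPT.
Qed.

(** The conditional tail of the product given X = x. The case distinction matters: with y / 0 = 0,
    the first branch would give G 0 where the product vanishes. *)
Let K y x := if 0 < p x then G (y / p x) else 0.

Let Gni : {homo G : x y /~ x <= y}.
Proof.
move=> x y xy; rewrite /G fine_le ?fin_num_measure//;
  try by apply: measurable_tail_set; exact: measurable_funPT.
apply: le_measure; rewrite ?inE; try by apply: measurable_tail_set; exact: measurable_funPT.
by move=> w /=; exact: le_lt_trans.
Qed.

Let Gle1 y : G y <= 1.
Proof. by apply: fine_probability_le1; apply: measurable_tail_set; exact: measurable_funPT. Qed.

Let measurable_K y : measurable_fun setT (K y).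
Proof.
apply: measurable_fun_ifT.
- by apply: measurable_fun_ltr; [exact: measurable_cst|exact: measurable_funPT].
- apply: (measurableT_comp (f := G)).
    by apply: nonincreasing_measurable => // x z xz; exact: Gni.
  apply: measurable_funM => //.
  by apply: (measurableT_comp measurable_inv); exact: measurable_funPT.
- exact: measurable_cst.
Qed.

Lemma breiman_tail y : 0 < y ->
  fine (P [set w | y < breiman_product w]) = \int[P]_w K y (X w).
Proof.
move=> y0; pose A : set (R * R) := [set z | y < p z.1 * Num.max z.2 0].
have mA : measurable A.
  have mm : measurable_fun setT (fun z : R * R => p z.1 * Num.max z.2 0).
    apply: measurable_funM.
      by apply: (measurableT_comp (measurable_funPT p)); exact: measurable_fst.
    by apply: measurable_maxr => //; exact: measurable_snd.
  exact: (measurable_tail_set y mm).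
have := @independent_expectation _ _ _ P _ _ _ _ X Y XY (\1_A) 1 (measurable_indic mA).
rewrite (_ : (fun w => \1_A (X w, Y w)) = \1_[set w | y < breiman_product w] :> (_ -> R)); last first.
  by apply/funext => w; rewrite !indicE; congr (nat_of_bool _)%:R; apply/idP/idP => /set_mem H; exact/mem_set.
rewrite Rintegral_indic; last exact: measurable_tail_set measurable_breiman_product.
move=> ->; last by move=> z; rewrite indicE; case: (_ \in _); rewrite ?normr1 ?normr0.
apply: eq_Rintegral => w _; rewrite /K.
case: ifPn => [px|].
  rewrite (_ : (fun w' => \1_A (X w, Y w')) = \1_[set w' | y / p (X w) < Y w'] :> (_ -> R)); last first.
    apply/funext => w'; rewrite !indicE; congr (nat_of_bool _)%:R; apply/idP/idP => /set_mem/= H; apply/mem_set => /=.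
      move: H; rewrite /A/= mulrC -ltr_pdivrMr// lt_max => /orP[//|].
      by rewrite ltNge divr_ge0// ltW.
    by rewrite /A/= mulrC -ltr_pdivrMr// lt_max H.
  by rewrite Rintegral_indic//; apply: measurable_tail_set; exact: measurable_funPT.
rewrite -leNgt => px; have {}px : p (X w) = 0 by apply/eqP; rewrite eq_le px p0.
rewrite -[RHS](@Rintegral_cstT _ _ _ P 0); apply: eq_Rintegral => w' _.
rewrite indicE memNset// /A /= px mul0r; apply/negP; rewrite -leNgt; exact: ltW.
Qed.

(** Given X, the tail ratio is G (v / (t p)) / G (1 / t), which tends to p^b v^(-b) by regular
    variation. The Potter bound with exponent dlt supplies a majorant that is integrable because
    p(X) has a moment of order dlt; its integral yields the uniform bound wanted by
    [abelian_limit]. *)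
Lemma breiman : 
  (forall v, 0 < v -> fine (P [set w | v / t < breiman_product w]) / G t^-1 @[t --> 0^'+] -->
     \int[P]_w (p (X w) `^ b) * v `^ (- b)) /\
  (exists C t0, 0 < t0 /\ forall t v, 0 < t < t0 -> 0 < v ->
     0 <= fine (P [set w | v / t < breiman_product w]) / G t^-1 <= C * (v `^ (- dlt) * (1 + v))).
Proof.
have /andP[b0 bd] := bI.
have d0 : 0 < dlt by lra.
have half : G (2^-1 * y) / G y @[y --> +oo] --> 2 `^ b.
  have : 0 < 2^-1 :> R by rewrite invr_gt0.
  move/Grv; congr (_ @ _ --> _).
  by rewrite -powR_inv1// -powRrM mulN1r opprK.
have [C [y0 [C0 y00 pot]]] := potter Gni (fun y => introT andP (conj (Gpos y) (Gle1 y))) d0 bd half.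
(* If v / p > 1, monotonicity of G bounds the ratio by 1; otherwise v / p is an admissible factor in
   the Potter bound at the point 1 / t >= y0. *)
have bound v t w : 0 < v -> 0 < t < y0^-1 ->
    0 <= K (v / t) (X w) / G t^-1 <= 1 + C * v `^ (- dlt) * p (X w) `^ dlt.
  move=> v0 /andP[t0 ty].
  have R0 : 0 <= C * v `^ (- dlt) * p (X w) `^ dlt by rewrite mulr_ge0 ?powR_ge0// mulr_ge0 ?powR_ge0// ltW.
  have Gi : 0 < G t^-1 by exact: Gpos.
  rewrite divr_ge0 ?(ltW Gi)//=; last by rewrite /K; case: ifP => // _; exact/ltW/Gpos.
  rewrite /K; case: ifPn => [px|_]; last by rewrite mul0r addr_ge0.
  rewrite ler_pdivrMr//.
  have -> : v / t / p (X w) = (v / p (X w)) * t^-1 by rewrite mulrAC.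
  have [u1|u1] := leP (v / p (X w)) 1; last first.
    apply: (@le_trans _ _ (G t^-1)).
      by apply: Gni; rewrite ler_peMl ?invr_ge0 ?ltW// ltW.
    by rewrite ler_peMl ?(ltW Gi)// lerDl.
  have u01 : 0 < v / p (X w) <= 1 by rewrite divr_gt0.
  have yt : y0 <= t^-1 by rewrite -[y0]invrK lef_pV2 ?posrE ?invr_gt0// ltW.
  apply: le_trans (pot _ _ yt u01) _.
  rewrite ler_wpM2r ?(ltW Gi)//.
  have -> : (v / p (X w)) `^ (- dlt) = v `^ (- dlt) * p (X w) `^ dlt.
    rewrite powRM ?invr_ge0 ?(ltW v0) ?(ltW px)//; congr (_ * _).
    by rewrite -powR_inv1 ?(ltW px)// -powRrM mulN1r opprK.
  by rewrite mulrA lerDr.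
have mKX y : measurable_fun setT (fun w => K y (X w)).
  by apply: (measurableT_comp (measurable_K y)); exact: measurable_funPT.
have ib v : P.-integrable setT (EFin \o (fun w => 1 + C * v `^ (- dlt) * p (X w) `^ dlt)).
  apply: RintegrableD => //; last exact: RintegrableZ.
  by apply: (@bounded_integrable _ _ _ P _ 1) => // x; rewrite normr1.
have tailE v t : 0 < v -> 0 < t ->
    fine (P [set w | v / t < breiman_product w]) / G t^-1 = \int[P]_w (K (v / t) (X w) / G t^-1).
  move=> v0 t0; rewrite breiman_tail ?divr_gt0// RintegralZr//.
  apply: (@bounded_integrable _ _ _ P _ 1) => // w; rewrite /K.
  by case: ifP => _; rewrite ?normr0// ger0_norm ?Gle1// ltW.
have iy0 : 0 < y0^-1 by rewrite invr_gt0.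
split.
  move=> v v0.
  have -> : \int[P]_w (p (X w) `^ b) * v `^ (- b) = \int[P]_w (p (X w) `^ b * v `^ (- b)).
    rewrite RintegralZr//; apply: (integrable_powR bI _ _ pint) => //.
    by apply: measurableT_comp; exact: measurable_funPT.
  have : \int[P]_w (K (v / t) (X w) / G t^-1) @[t --> 0^'+] --> \int[P]_w (p (X w) `^ b * v `^ (- b)).
    apply: (@Rintegral_cvg_at_right _ _ P setT _ _ (fun w => 1 + C * v `^ (- dlt) * p (X w) `^ dlt) y0^-1) => //.
    - by move=> t _; apply: measurable_funM.
    - by move=> t w tI _; have /andP[h1 h2] := bound v t w v0 tI; rewrite ger0_norm.
    - move=> w _; rewrite /K; have [px|px] := ltP 0 (p (X w)).
        have vp : 0 < v / p (X w) by rewrite divr_gt0.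
        have := Grv vp.
        have -> : (v / p (X w)) `^ (- b) = p (X w) `^ b * v `^ (- b).
          rewrite powRM ?invr_ge0 ?(ltW v0) ?(ltW px)// mulrC; congr (_ * _).
          by rewrite -powR_inv1 ?(ltW px)// -powRrM mulN1r opprK.
        move=> H.
        have ty : t^-1 @[t --> 0^'+] --> (+oo : set_system R).
          apply/(@gtr0_cvgV0 _ _ _ _ (fun t : R => t^-1)).
            by near=> t; rewrite invr_gt0.
          apply: (@cvg_trans _ (t @[t --> (0 : R)^'+])).
            by apply: near_eq_cvg; apply: nearW => t /=; rewrite invrK.
          by apply: cvg_at_right_filter; exact: cvg_id.
        have := cvg_comp _ _ ty H.
        apply: cvg_trans; apply: near_eq_cvg; apply: nearW => t /=.
        by rewrite mulrAC.
      have -> : p (X w) = 0 by apply/eqP; rewrite eq_le px p0.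
      rewrite powR0 ?gt_eqF// mul0r.
      apply: cvg_near_cst; apply: nearW => t; exact: mul0r.
  apply: cvg_trans; apply: near_eq_cvg; near=> t.
  by rewrite tailE.
exists (1 + C * \int[P]_w (p (X w) `^ dlt)), y0^-1; split => // t v tI v0.
have /andP[t0 ty] := tI.
have int0 : 0 <= \int[P]_w (p (X w) `^ dlt) by apply: Rintegral_ge0 => w _; exact: powR_ge0.
rewrite tailE//; apply/andP; split.
  by apply: Rintegral_ge0 => w _; have /andP[] := bound v t w v0 tI.
apply: (@le_trans _ _ (\int[P]_w (1 + C * v `^ (- dlt) * p (X w) `^ dlt))).
  apply: le_trans (ler_norm _) _; apply: ler_norm_Rintegral => //.
    by apply: measurable_funM.
  by move=> w _; have /andP[h1 h2] := bound v t w v0 tI; rewrite ger0_norm.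
rewrite RintegralD//; last 2 first.
- by apply: (@bounded_integrable _ _ _ P _ 1) => // x; rewrite normr1.
- exact: RintegrableZ.
rewrite Rintegral_cstT RintegralZl// mulrDl lerD//.
  by rewrite mul1r one_le_powR_mul// d0 d1.
set I := \int[P]_w _ in int0 *.
have -> : C * I * (v `^ (- dlt) * (1 + v)) = C * v `^ (- dlt) * I * (1 + v) by ring.
rewrite ler_peMr ?lerDl ?(ltW v0)//.
by rewrite mulr_ge0// mulr_ge0 ?powR_ge0// ltW.
Unshelve. all: by end_near. Qed.
End Breiman.

(** * The mean of (Omega - kappa Theta) / Theta as a value at t = 0 *)

Section SelfNormalized.
Context {R : realType}.
Variables c s k1 k2 : R.
Hypothesis c01 : 0 < c <= 1.
Hypothesis s1 : `|s| <= 1.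

(* With [Omega = c S + i s M], [Theta = c M + i s S] and [kappa = k1 + i k2],
   [Omega - kappa Theta = L1 + i L2] and [(Omega - kappa Theta) / Theta = m1 + i m2];
   [residual t] and [primitive t] are the real parts of
   [(Omega - kappa Theta) e^(-t Theta)] and [(Omega - kappa Theta) / Theta e^(-t Theta)]. *)
Definition L1 S M : R := c * S - k1 * (c * M) + k2 * (s * S).
Definition L2 S M : R := s * M - k1 * (s * S) - k2 * (c * M).
Definition sqnorm S M : R := (c * M) ^+ 2 + (s * S) ^+ 2.
Definition m1 S M : R := (L1 S M * (c * M) + L2 S M * (s * S)) / sqnorm S M.
Definition m2 S M : R := (L2 S M * (c * M) - L1 S M * (s * S)) / sqnorm S M.
Definition residual t S M : R :=
  expR (- (t * (c * M))) * (L1 S M * cos (t * (s * S)) + L2 S M * sin (t * (s * S))).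
Definition primitive t S M : R :=
  expR (- (t * (c * M))) * (m1 S M * cos (t * (s * S)) + m2 S M * sin (t * (s * S))).

Let K := 1 + `|k1| + `|k2|.

Let K0 : 0 < K. Proof. by have := normr_ge0 k1; have := normr_ge0 k2; rewrite /K; lra. Qed.

Let c0 : 0 < c. Proof. by case/andP: c01. Qed.

Let bound2 (x y : R) (u : R) : `|x| <= 1 -> `|y| <= u -> `|x * y| <= u.
Proof. by move=> x1 yu; rewrite normrM; apply: le_trans yu; rewrite ler_piMl. Qed.

Lemma L12_bound S M : `|S| <= M -> `|L1 S M| <= K * M /\ `|L2 S M| <= K * M.
Proof.
move=> SM; have M0 : 0 <= M by exact: le_trans (normr_ge0 _) SM.
have c1 : `|c| <= 1 by rewrite (ger0_norm (ltW c0)); case/andP: c01.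
have MM : `|M| <= M by rewrite ger0_norm.
have kb (k x y : R) : `|x| <= 1 -> `|y| <= M -> `|k * (x * y)| <= `|k| * M.
  by move=> x1 yM; rewrite normrM ler_wpM2l// bound2.
split.
  apply: le_trans (ler_normD _ _) _; apply: le_trans (lerD (ler_normB _ _) (lexx _)) _.
  by have := bound2 c1 SM; have := kb k1 _ _ c1 MM; have := kb k2 _ _ s1 SM; rewrite /K; lra.
apply: le_trans (ler_normB _ _) _; apply: le_trans (lerD (ler_normB _ _) (lexx _)) _.
by have := bound2 s1 MM; have := kb k1 _ _ s1 SM; have := kb k2 _ _ c1 MM; rewrite /K; lra.
Qed.

Lemma sqnorm_ge S M : (c * M) ^+ 2 <= sqnorm S M.
Proof. by rewrite lerDl sqr_ge0. Qed.

(** In complex form, (m1 + i m2) Theta = L1 + i L2. If M = 0 then S = 0 and both sides vanish,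
    whatever default value the quotient takes. *)
Lemma m12_L12 S M : `|S| <= M ->
  m1 S M * (c * M) - m2 S M * (s * S) = L1 S M /\
  m2 S M * (c * M) + m1 S M * (s * S) = L2 S M.
Proof.
move=> SM; have [M0|M0] := eqVneq M 0.
  have S0 : S = 0 by apply/eqP; rewrite -normr_le0 -M0.
  by rewrite /L1 /L2 M0 S0 !mulr0 !subr0 !addr0.
have N0 : sqnorm S M != 0.
  rewrite gt_eqF//; apply: lt_le_trans (sqnorm_ge S M).
  by rewrite exprn_even_gt0//= mulf_neq0// gt_eqF.
split.
  rewrite -[RHS](mulfK N0) /m1 /m2; set V := (sqnorm S M)^-1; rewrite /sqnorm; ring.
rewrite -[RHS](mulfK N0) /m1 /m2; set V := (sqnorm S M)^-1; rewrite /sqnorm; ring.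
Qed.

Lemma m12_bound S M : `|S| <= M ->
  `|m1 S M| <= 2 * K / c ^+ 2 /\ `|m2 S M| <= 2 * K / c ^+ 2.
Proof.
move=> SM; have M0 : 0 <= M by exact: le_trans (normr_ge0 _) SM.
have C0 : 0 <= 2 * K / c ^+ 2 by rewrite divr_ge0 ?sqr_ge0// mulr_ge0// ltW.
have [Mz|Mn] := eqVneq M 0.
  have S0 : S = 0 by apply/eqP; rewrite -normr_le0 -Mz.
  by rewrite /m1 /m2 Mz S0 !mulr0 subr0 addr0 mul0r normr0.
have Mp : 0 < M by rewrite lt_neqAle eq_sym Mn.
have N0 : 0 < sqnorm S M by apply: lt_le_trans (sqnorm_ge S M); rewrite exprn_gt0// mulr_gt0.
have [h1 h2] := L12_bound SM.
have c1 : `|c| <= 1 by rewrite (ger0_norm (ltW c0)); case/andP: c01.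
have MM : `|M| <= M by rewrite ger0_norm.
have cM := bound2 c1 MM; have sS := bound2 s1 SM.
have num : 2 * K * M ^+ 2 <= 2 * K / c ^+ 2 * sqnorm S M.
  have -> : 2 * K * M ^+ 2 = 2 * K / c ^+ 2 * (c * M) ^+ 2 by field; rewrite gt_eqF.
  by rewrite ler_wpM2l// sqnorm_ge.
have pr (x y x' y' : R) : `|x| <= K * M -> `|y| <= M -> `|x'| <= K * M -> `|y'| <= M ->
    `|x * y| + `|x' * y'| <= 2 * K * M ^+ 2.
  move=> a1 a2 a3 a4; have -> : 2 * K * M ^+ 2 = K * M * M + K * M * M by ring.
  by rewrite !normrM lerD// ler_pM.
split; rewrite normrM normfV (gtr0_norm N0) ler_pdivrMr//; apply: le_trans num.
  by apply: le_trans (ler_normD _ _) _; exact: pr.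
by apply: le_trans (ler_normB _ _) _; exact: pr.
Qed.

Lemma trig_comb_bound (x y u z : R) : `|x| <= z -> `|y| <= z ->
  `|x * cos u + y * sin u| <= 2 * z.
Proof.
move=> xz yz; apply: le_trans (ler_normD _ _) _; rewrite !normrM.
have cs : `|cos u| <= 1 by rewrite ler_norml cos_geN1 cos_le1.
have sn : `|sin u| <= 1 by rewrite ler_norml sin_geN1 sin_le1.
have h1 : `|x| * `|cos u| <= z by apply: le_trans xz; rewrite ler_piMr.
have h2 : `|y| * `|sin u| <= z by apply: le_trans yz; rewrite ler_piMr.
lra.
Qed.

Lemma primitive_bound t S M : `|S| <= M ->
  `|primitive t S M| <= 4 * K / c ^+ 2 * expR (- (t * (c * M))).
Proof.
move=> SM; have [h1 h2] := m12_bound SM.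
rewrite normrM ger0_norm ?expR_ge0// mulrC ler_wpM2r ?expR_ge0//.
have -> : 4 * K / c ^+ 2 = 2 * (2 * K / c ^+ 2) by ring.
exact: trig_comb_bound.
Qed.

Lemma residual_bound t S M : `|S| <= M ->
  `|residual t S M| <= 2 * K * (M * expR (- (t * (c * M)))).
Proof.
move=> SM; have [h1 h2] := L12_bound SM.
rewrite normrM ger0_norm ?expR_ge0// [leLHS]mulrC [leRHS]mulrA ler_wpM2r ?expR_ge0//.
by rewrite -[leRHS]mulrA; exact: trig_comb_bound.
Qed.

Lemma is_derive_primitive (t S M : R) : `|S| <= M ->
  is_derive t 1 (fun t => primitive t S M) (- residual t S M).
Proof.
move=> SM; have [h1 h2] := m12_L12 SM.
by apply: has_derivW; [derive|rewrite /= /residual -h1 -h2; ring].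
Qed.

Lemma mul_expRN_le (x : R) : x * expR (- x) <= 1.
Proof.
rewrite expRN ler_pdivrMr ?expR_gt0// mul1r.
by have := expR_ge1Dx x; lra.
Qed.

Context d (T : measurableType d) (P : probability T R) (S M : T -> R).
Hypothesis mS : measurable_fun setT S.
Hypothesis mM : measurable_fun setT M.
Hypothesis SM : forall w, `|S w| <= M w.

Let M0 w : 0 <= M w. Proof. exact: le_trans (normr_ge0 _) (SM w). Qed.

Let measurable_lin (a : R) (f : T -> R) : measurable_fun setT f ->
  measurable_fun setT (fun w => a * f w).
Proof. by move=> mf; exact: measurable_funM. Qed.

Lemma measurable_damp t : measurable_fun setT (fun w => expR (- (t * (c * M w)))).
Proof.
apply: (measurableT_comp (@measurable_expR R)).
by apply: measurableT_comp => //; do 2 apply: measurable_lin.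
Qed.

Let measurable_trig (f g : R -> R -> R) t :
  measurable_fun setT (fun w => f (S w) (M w)) -> measurable_fun setT (fun w => g (S w) (M w)) ->
  measurable_fun setT (fun w => expR (- (t * (c * M w))) *
    (f (S w) (M w) * cos (t * (s * S w)) + g (S w) (M w) * sin (t * (s * S w)))).
Proof.
move=> mf mg; apply: measurable_funM; first exact: measurable_damp.
have mts : measurable_fun setT (fun w => t * (s * S w)) by do 2 apply: measurable_lin.
apply: measurable_funD; apply: measurable_funM => //.
  by apply: (measurableT_comp _ mts); apply: continuous_measurable_fun; exact: continuous_cos.
by apply: (measurableT_comp _ mts); apply: continuous_measurable_fun; exact: continuous_sin.
Qed.

Lemma measurable_L1 : measurable_fun setT (fun w => L1 (S w) (M w)).
Proof.
apply: measurable_funD; last by do 2 apply: measurable_lin.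
by apply: measurable_funB; repeat apply: measurable_lin.
Qed.

Lemma measurable_L2 : measurable_fun setT (fun w => L2 (S w) (M w)).
Proof. by apply: measurable_funB; first apply: measurable_funB; repeat apply: measurable_lin. Qed.

Let measurable_sqnormV : measurable_fun setT (fun w => (sqnorm (S w) (M w))^-1).
Proof.
apply: (measurableT_comp measurable_inv).
by apply: measurable_funD; apply: measurable_funX; apply: measurable_lin.
Qed.

Lemma measurable_m1 : measurable_fun setT (fun w => m1 (S w) (M w)).
Proof.
apply: measurable_funM => //; apply: measurable_funD; apply: measurable_funM;
  by [exact: measurable_L1|exact: measurable_L2|apply: measurable_lin].
Qed.

Lemma measurable_m2 : measurable_fun setT (fun w => m2 (S w) (M w)).
Proof.
apply: measurable_funM => //; apply: measurable_funB; apply: measurable_funM;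
  by [exact: measurable_L1|exact: measurable_L2|apply: measurable_lin].
Qed.

Lemma measurable_primitive t : measurable_fun setT (fun w => primitive t (S w) (M w)).
Proof. by apply: (@measurable_trig m1 m2); [exact: measurable_m1|exact: measurable_m2]. Qed.

Lemma measurable_residual t : measurable_fun setT (fun w => residual t (S w) (M w)).
Proof. by apply: (@measurable_trig L1 L2); [exact: measurable_L1|exact: measurable_L2]. Qed.

Lemma damp_le1 t w : 0 <= t -> expR (- (t * (c * M w))) <= 1.
Proof. by move=> t0; rewrite -[leRHS]expR0 ler_expR oppr_le0 mulr_ge0// mulr_ge0// ltW. Qed.

(** This is x e^(-x) <= 1 at x = t c M. No moment of M is assumed, so integrability for t > 0 has to
    come from the damping. *)
Lemma damped_mass_bound t w : 0 < t -> M w * expR (- (t * (c * M w))) <= (t * c)^-1.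
Proof.
move=> t0; have tc : 0 < t * c by rewrite mulr_gt0.
rewrite -[leRHS]mulr1 mulrC ler_pdivlMl// mulrC -mulrA.
have := mul_expRN_le (t * (c * M w)); congr (_ <= _); ring.
Qed.

Definition mean_primitive t := \int[P]_w primitive t (S w) (M w).
Definition mean_damp t := \int[P]_w expR (- (t * (c * M w))).
Definition mean_mass t := \int[P]_w (M w * expR (- (t * (c * M w)))).

Lemma integrable_damp t : 0 <= t -> P.-integrable setT (EFin \o (fun w => expR (- (t * (c * M w))))).
Proof.
move=> t0; apply: (@bounded_integrable _ _ _ P _ 1); first exact: measurable_damp.
by move=> w; rewrite ger0_norm ?expR_ge0// damp_le1.
Qed.

Lemma integrable_primitive t : 0 <= t -> P.-integrable setT (EFin \o (fun w => primitive t (S w) (M w))).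
Proof.
move=> t0; apply: (@bounded_integrable _ _ _ P _ (4 * K / c ^+ 2)); first exact: measurable_primitive.
move=> w; apply: le_trans (primitive_bound t (SM w)) _.
rewrite ler_piMr ?damp_le1// divr_ge0 ?sqr_ge0// mulr_ge0// ltW//.
Qed.

Let nbhs_pos (t x : R) : `|x - t| < t / 2 -> t / 2 < x.
Proof. by rewrite ltr_norml => /andP[? ?]; lra. Qed.

Lemma is_derive_mean_primitive (t : R) : 0 < t ->
  is_derive t 1 mean_primitive (\int[P]_w (- residual t (S w) (M w))).
Proof.
move=> t0; have t2 : 0 < t / 2 by rewrite divr_gt0.
apply: (@is_derive_Rintegral _ _ _ P (fun t w => primitive t (S w) (M w))
  (fun t w => - residual t (S w) (M w)) setT (fun=> 2 * K * (t / 2 * c)^-1) t (t / 2) _ t2) => //.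
- by move=> x /nbhs_pos xt; apply: integrable_primitive; rewrite ltW// (lt_trans t2).
- by move=> x w _ _; exact: is_derive_primitive.
- by apply: (@bounded_integrable _ _ _ P _ `|2 * K * (t / 2 * c)^-1|).
- move=> x w /nbhs_pos xt _; rewrite normrN; apply: le_trans (residual_bound x (SM w)) _.
  have x0 : 0 < x by exact: lt_trans xt.
  rewrite ler_wpM2l ?mulr_ge0 ?(ltW K0)//; apply: le_trans (damped_mass_bound w x0) _.
  by rewrite lef_pV2 ?posrE ?mulr_gt0//; apply: ler_wpM2r; exact: ltW.
Qed.

Lemma is_derive_mean_damp (t : R) : 0 < t -> is_derive t 1 mean_damp (- c * mean_mass t).
Proof.
move=> t0; have t2 : 0 < t / 2 by rewrite divr_gt0.
have mMe x : measurable_fun setT (fun w => M w * expR (- (x * (c * M w)))).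
  by apply: measurable_funM => //; exact: measurable_damp.
rewrite -RintegralZl//; last first.
  apply: (@bounded_integrable _ _ _ P _ (t * c)^-1) => // w.
  by rewrite ger0_norm ?damped_mass_bound// mulr_ge0// expR_ge0.
have D x w : `|x - t| < t / 2 -> setT w ->
    is_derive x 1 (fun y => expR (- (y * (c * M w)))) (- c * (M w * expR (- (x * (c * M w))))).
  by move=> _ _; apply: has_derivW; [derive|rewrite /=; ring].
apply: (@is_derive_Rintegral _ _ _ P (fun t w => expR (- (t * (c * M w)))) _ setT
  (fun=> (t / 2 * c)^-1) t (t / 2) _ t2 _ D) => //.
- by move=> x /nbhs_pos xt; apply: integrable_damp; rewrite ltW// (lt_trans t2).
- by apply: (@bounded_integrable _ _ _ P _ `|(t / 2 * c)^-1|).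
- move=> x w /nbhs_pos xt _; have x0 : 0 < x by exact: lt_trans xt.
  rewrite mulNr normrN ger0_norm; last by rewrite mulr_ge0 ?(ltW c0)// mulr_ge0// expR_ge0.
  apply: (@le_trans _ _ (M w * expR (- (x * (c * M w))))).
    by rewrite ler_piMl ?mulr_ge0 ?expR_ge0//; case/andP: c01.
  apply: le_trans (damped_mass_bound w x0) _.
  by rewrite lef_pV2 ?posrE ?mulr_gt0//; apply: ler_wpM2r; exact: ltW.
Qed.

Lemma mean_primitive_at0 : mean_primitive t @[t --> 0^'+] --> mean_primitive 0.
Proof.
apply: (@Rintegral_cvg_at_right _ _ _ P setT _ _ (fun=> 4 * K / c ^+ 2) 1) => //.
- by move=> t _; exact: measurable_primitive.
- by apply: (@bounded_integrable _ _ _ P _ `|4 * K / c ^+ 2|).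
- move=> t w /andP[t0 _] _; apply: le_trans (primitive_bound t (SM w)) _.
  by rewrite ler_piMr ?damp_le1 ?(ltW t0)// divr_ge0 ?sqr_ge0// mulr_ge0// ltW.
- move=> w _; apply: cvg_at_right_filter.
  exact: has_deriv_continuous (is_derive_primitive 0 (SM w)).
Qed.

(* [mean_primitive] and [mean_damp] are compared through their derivatives, which
   avoids integrating in [t]. *)
Lemma mean_primitive_oscillation e dlt : 0 < dlt ->
  (forall t, 0 < t <= dlt -> `|\int[P]_w residual t (S w) (M w)| <= e * mean_mass t) ->
  0 <= e ->
  `|mean_primitive 0 - mean_primitive dlt| <= e / c.
Proof.
move=> dlt0 He e0.
have mm0 t : 0 <= mean_mass t by apply: Rintegral_ge0 => w _; rewrite mulr_ge0// expR_ge0.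
have EN t : 0 < t -> \int[P]_w (- residual t (S w) (M w)) = - \int[P]_w residual t (S w) (M w).
  move=> t0; under eq_Rintegral do rewrite -mulN1r.
  rewrite RintegralZl ?mulN1r//.
  apply: (@bounded_integrable _ _ _ P _ (2 * K * (t * c)^-1)); first exact: measurable_residual.
  move=> w; apply: le_trans (residual_bound t (SM w)) _.
  by rewrite ler_wpM2l ?mulr_ge0 ?(ltW K0)// damped_mass_bound.
have damp01 t : 0 <= t -> 0 <= mean_damp t <= 1.
  move=> t0; rewrite /mean_damp; apply/andP; split.
    by apply: Rintegral_ge0 => w _; exact: expR_ge0.
  rewrite -[leRHS](@Rintegral_cstT _ _ _ P 1); apply: le_Rintegral => //.
  - exact: integrable_damp.
  - by apply: (@bounded_integrable _ _ _ P _ 1) => // w; rewrite normr1.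
  - by move=> w _; exact: damp_le1.
(* The derivative of e / c times [mean_damp] is - e times [mean_mass], which outweighs the residual,
   so F below is nonincreasing. As [mean_damp] stays in [0, 1], its term changes by at most e / c.
   The values g = 1 and g = -1 give the two sides of the absolute value. *)
have step (g : R) (t : R) : `|g| <= 1 -> 0 < t < dlt ->
    g * (mean_primitive dlt - mean_primitive t) <= e / c.
  move=> g1 /andP[t0 td].
  pose F x := g * mean_primitive x + e / c * mean_damp x.
  have dF (x : R) : 0 < x -> is_derive x 1 F
      (g * - (\int[P]_w residual x (S w) (M w)) - e * mean_mass x).
    move=> x0; have h1 := is_derive_mean_primitive x0; have h2 := is_derive_mean_damp x0.
    rewrite EN// in h1; apply: has_derivW; first by derive.
    by rewrite /=; field; rewrite gt_eqF.
  have [||x /andP[tx xd] E] := @continuous_MVT _ F (fun x => g * - (\int[P]_w residual x (S w) (M w)) - e * mean_mass x) _ _ td.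
  - by move=> x /andP[tx _]; apply: dF; exact: lt_trans tx.
  - apply: continuous_in_subspaceT => x /set_mem/=; rewrite in_itv/= => /andP[tx _].
    by apply: has_deriv_continuous; apply: dF; exact: lt_le_trans tx.
  have x0 : 0 < x by exact: lt_trans tx.
  have xI : 0 < x <= dlt by rewrite x0 ltW.
  have D0 : g * - (\int[P]_w residual x (S w) (M w)) - e * mean_mass x <= 0.
    rewrite subr_le0; apply: le_trans (ler_norm _) _; rewrite normrM normrN.
    by apply: le_trans (He _ xI); rewrite ler_piMl.
  have FF : F dlt <= F t.
    by rewrite -subr_le0 E; apply: mulr_le0_ge0 => //; lra.
  have ec : 0 <= e / c by rewrite divr_ge0// ltW.
  have /andP[d1 d2] := damp01 t (ltW t0); have /andP[d3 d4] := damp01 dlt (ltW dlt0).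
  have : e / c * mean_damp t <= e / c by rewrite ler_piMr.
  have : 0 <= e / c * mean_damp dlt by rewrite mulr_ge0.
  by move: FF; rewrite /F; lra.
(* M need not be integrable, so the mean value argument stays at t > 0 and the point 0 is reached as
   a right limit. *)
have lim : mean_primitive dlt - mean_primitive t @[t --> 0^'+] --> mean_primitive dlt - mean_primitive 0.
  by apply: cvgB; [exact: cvg_cst|exact: mean_primitive_at0].
have nI : \forall t \near 0^'+, 0 < t < dlt.
  near=> t; apply/andP; split; near: t; [exact: nbhs_right_gt|exact: nbhs_right_lt].
rewrite distrC ler_norml lerNl; apply/andP; split.
  apply: (cvgr_to_le (cvgN lim)); near=> t; rewrite /= -mulN1r.
  by apply: step; [rewrite normrN1|near: t].
apply: (cvgr_to_le lim); near=> t; rewrite -[leLHS]mul1r.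
by apply: step; [rewrite normr1|near: t].
Unshelve. all: by end_near. Qed.

End SelfNormalized.

(** * Residuals of i.i.d. sums reduced to one summand *)

Section Rintegral_sum.
Context d (T : measurableType d) (R : realType) (P : probability T R).

Lemma Rintegral_sum (I : eqType) (s : seq I) (f : I -> T -> R) :
  (forall i, i \in s -> P.-integrable setT (EFin \o f i)) ->
  P.-integrable setT (EFin \o (fun w => \sum_(i <- s) f i w)) /\
  \int[P]_w (\sum_(i <- s) f i w) = \sum_(i <- s) \int[P]_w f i w.
Proof.
elim: s => [|i s IH] fi.
  have -> : (fun w => \sum_(i <- [::]) f i w) = fun=> 0 by apply/funext => w; rewrite big_nil.
  rewrite big_nil Rintegral_cstT; split => //.
  by apply: (@bounded_integrable _ _ _ P _ 0) => // w; rewrite normr0.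
have [|i1 i2] := IH; first by move=> j js; apply: fi; rewrite inE js orbT.
have ii : P.-integrable setT (EFin \o f i) by apply: fi; rewrite inE eqxx.
have E : (fun w => \sum_(i <- i :: s) f i w) = (fun w => f i w + \sum_(i <- s) f i w).
  by apply/funext => w; rewrite big_cons.
rewrite E; split; first exact: RintegrableD.
by rewrite big_cons RintegralD// i2.
Qed.

Lemma same_law_expectation d1 (E : measurableType d1) (U V : {mfun T >-> E}) (g : E -> R) C :
  same_law P U V -> measurable_fun setT g -> (forall x, `|g x| <= C) ->
  \int[P]_w g (U w) = \int[P]_w g (V w).
Proof.
move=> UV mg gC.
have ig (W : {mfun T >-> E}) : P.-integrable setT (EFin \o (fun w => g (W w))).
  apply: (@bounded_integrable _ _ _ P _ C); last by move=> w; exact: gC.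
  by apply: (measurableT_comp mg); exact: measurable_funPT.
have mge : measurable_fun setT (EFin \o g) by exact/measurable_EFinP.
rewrite /Rintegral; congr fine.
rewrite -(@integral_distribution _ _ _ _ _ P U (EFin \o g) mge (ig U)).
rewrite -(@integral_distribution _ _ _ _ _ P V (EFin \o g) mge (ig V)).
by apply: eq_measure_integral => A mA _; exact: UV.
Qed.

End Rintegral_sum.

Section SelfNormalizedIID.
Context d (T : measurableType d) (R : realType) (P : probability T R).
Context d1 (E : measurableType d1) (Z : nat -> {mfun T >-> E}) (Z0 : {mfun T >-> E}).
Hypothesis indZ : mutually_independent P (fun i w => Z i w).
Hypothesis lawZ : forall i, same_law P (Z i) Z0.
Variables (p q : {mfun E >-> R}).
Hypothesis pq : forall x, `|p x| <= q x.
Variables c s k1 k2 : R.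
Hypothesis c01 : 0 < c <= 1.
Hypothesis s1 : `|s| <= 1.

Let c0 : 0 < c. Proof. by case/andP: c01. Qed.

Let S_ r w := \sum_(j <- r) p (Z j w).
Let M_ r w := \sum_(j <- r) q (Z j w).

Let mS r : measurable_fun setT (S_ r).
Proof. by apply: measurable_sum => j; apply: measurableT_comp; exact: measurable_funPT. Qed.

Let mM r : measurable_fun setT (M_ r).
Proof. by apply: measurable_sum => j; apply: measurableT_comp; exact: measurable_funPT. Qed.

Let SM r w : `|S_ r w| <= M_ r w.
Proof. by apply: le_trans (ler_norm_sum _ _ _) _; apply: ler_sum. Qed.

Let q0 x : 0 <= q x. Proof. exact: le_trans (normr_ge0 _) (pq x). Qed.

Let M0 r w : 0 <= M_ r w. Proof. exact: sumr_ge0. Qed.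

Let mqZ (W : {mfun T >-> E}) : measurable_fun setT (fun w => q (W w)).
Proof. by apply: measurableT_comp; exact: measurable_funPT. Qed.

Let mpZ (W : {mfun T >-> E}) : measurable_fun setT (fun w => p (W w)).
Proof. by apply: measurableT_comp; exact: measurable_funPT. Qed.

(* Multiplication of [e^(-t Theta)] by [-i] turns one real part into the other. *)
Definition residual2 t S M : R :=
  expR (- (t * (c * M))) * (L2 c s k1 k2 S M * cos (t * (s * S)) - L1 c s k1 k2 S M * sin (t * (s * S))).

Let res1 t x := residual c s k1 k2 t (p x) (q x).
Let res2 t x := residual2 t (p x) (q x).
Let damp t M := expR (- (t * (c * M))).

Let K := 1 + `|k1| + `|k2|.

Let K0 : 0 < K. Proof. by have := normr_ge0 k1; have := normr_ge0 k2; rewrite /K; lra. Qed.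

Let mcont (f : R -> R) dd (X : measurableType dd) (g : X -> R) : continuous f -> measurable_fun setT g ->
  measurable_fun setT (fun x => f (g x)).
Proof. by move=> cf mg; apply: (measurableT_comp _ mg); exact: continuous_measurable_fun. Qed.

Let mlin dd (X : measurableType dd) (a : R) (f : X -> R) : measurable_fun setT f ->
  measurable_fun setT (fun w => a * f w).
Proof. by move=> mf; exact: measurable_funM. Qed.

Let mdamp dd (X : measurableType dd) t (f : X -> R) : measurable_fun setT f ->
  measurable_fun setT (fun w => damp t (f w)).
Proof.
move=> mf; apply: (measurableT_comp (@measurable_expR R)); apply: measurableT_comp => //.
by do 2 apply: mlin.
Qed.

Let mL1 : measurable_fun setT (fun x => L1 c s k1 k2 (p x) (q x)).
Proof.
have mp := measurable_funPT p; have mq := measurable_funPT q.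
apply: measurable_funD; last by do 2 apply: mlin.
by apply: measurable_funB; repeat apply: mlin.
Qed.

Let mL2 : measurable_fun setT (fun x => L2 c s k1 k2 (p x) (q x)).
Proof.
have mp := measurable_funPT p; have mq := measurable_funPT q.
by apply: measurable_funB; first apply: measurable_funB; repeat apply: mlin.
Qed.

Let mcos dd (X : measurableType dd) t (f : X -> R) : measurable_fun setT f ->
  measurable_fun setT (fun x => cos (t * (s * f x))).
Proof. by move=> mf; apply: mcont; [exact: continuous_cos|do 2 apply: mlin]. Qed.

Let msin dd (X : measurableType dd) t (f : X -> R) : measurable_fun setT f ->
  measurable_fun setT (fun x => sin (t * (s * f x))).
Proof. by move=> mf; apply: mcont; [exact: continuous_sin|do 2 apply: mlin]. Qed.

Let mres1 t : measurable_fun setT (res1 t).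
Proof.
have mp := measurable_funPT p; have mq := measurable_funPT q.
apply: measurable_funM; first exact: mdamp.
by apply: measurable_funD; apply: measurable_funM => //; [exact: mcos|exact: msin].
Qed.

Let mres2 t : measurable_fun setT (res2 t).
Proof.
have mp := measurable_funPT p; have mq := measurable_funPT q.
apply: measurable_funM; first exact: mdamp.
by apply: measurable_funB; apply: measurable_funM => //; [exact: mcos|exact: msin].
Qed.

Let damped_q t x : 0 < t -> 0 <= q x * damp t (q x) <= (t * c)^-1.
Proof.
move=> t0; rewrite mulr_ge0 ?expR_ge0//=.
have tc : 0 < t * c by rewrite mulr_gt0.
rewrite -[leRHS]mulr1 mulrC ler_pdivlMl// mulrC -mulrA.
have := mul_expRN_le (t * (c * q x)); congr (_ <= _); rewrite /damp; ring.
Qed.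

Let res_bound t x : 0 < t -> `|res1 t x| <= 2 * K * (t * c)^-1 /\ `|res2 t x| <= 2 * K * (t * c)^-1.
Proof.
move=> t0; have /andP[_ B] := damped_q x t0.
have [h1 h2] := L12_bound k1 k2 c01 s1 (pq x).
have tr y : `|y| <= 2 * (K * q x) -> `|damp t (q x) * y| <= 2 * K * (t * c)^-1.
  move=> yb; rewrite normrM ger0_norm ?expR_ge0//.
  apply: (@le_trans _ _ (2 * K * (q x * damp t (q x)))); last by rewrite ler_wpM2l// mulr_ge0// ltW.
  by rewrite mulrC [leRHS]mulrA ler_wpM2r ?expR_ge0// -[leRHS]mulrA.
split; apply: tr; first exact: trig_comb_bound.
by rewrite -mulNr; apply: trig_comb_bound => //; rewrite normrN.
Qed.

Let h t := \int[P]_w (q (Z0 w) * damp t (q (Z0 w))).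
Let a1 t := \int[P]_w res1 t (Z0 w).
Let a2 t := \int[P]_w res2 t (Z0 w).

Let damp1 t r w : 0 <= t -> 0 <= damp t (M_ r w) <= 1.
Proof.
move=> t0; rewrite expR_ge0/= -[leRHS]expR0 ler_expR oppr_le0 mulr_ge0// mulr_ge0//.
exact: ltW.
Qed.

Let damp_le1x (t x : R) : 0 <= t -> 0 <= x -> `|damp t x| <= 1.
Proof.
move=> t0 x0; rewrite ger0_norm ?expR_ge0// -[leRHS]expR0 ler_expR oppr_le0 mulr_ge0// mulr_ge0//.
exact: ltW.
Qed.

(* The cut-off [Num.max _ 0] makes the factor bounded on the whole plane. *)
Let split_expectation (t : R) k r (g : E -> R) (f : R -> R) C :
  0 <= t -> uniq r -> k \notin r -> measurable_fun setT g -> (forall x, `|g x| <= C) ->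
  (forall x, `|f x| <= 1) -> continuous f ->
  \int[P]_w (g (Z k w) * (damp t (M_ r w) * f (t * (s * S_ r w)))) =
  \int[P]_w g (Z0 w) * \int[P]_w (damp t (M_ r w) * f (t * (s * S_ r w))).
Proof.
move=> t0 ur kr mg gC f1 cf.
pose hh (z : R * R) := damp t (Num.max z.2 0) * f (t * (s * z.1)).
have mhh : measurable_fun setT hh.
  apply: measurable_funM.
    by apply: mdamp; apply: measurable_maxr => //; exact: measurable_snd.
  by apply: mcont => //; do 2 apply: mlin; exact: measurable_fst.
have hh1 z : `|hh z| <= 1.
  by rewrite normrM mulr_ile1 ?damp_le1x// le_max lexx orbT.
have hhE w : damp t (M_ r w) * f (t * (s * S_ r w)) = hh (partial_sums Z p q r w).
  by rewrite /hh /= max_l// M0.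
have I := independent_rest indZ p q ur kr.
transitivity (\int[P]_w (g (Z k w) * hh (partial_sums Z p q r w))).
  by apply: eq_Rintegral => w _; rewrite hhE.
rewrite (_ : \int[P]_w (damp t (M_ r w) * f (t * (s * S_ r w))) =
    \int[P]_w hh (partial_sums Z p q r w)); last by apply: eq_Rintegral => w _; rewrite hhE.
rewrite (independent_expectation_mul I mg mhh gC hh1); congr (_ * _).
exact: (same_law_expectation (lawZ k) mg gC).
Qed.

Let cos1 (x : R) : `|cos x| <= 1. Proof. by rewrite ler_norml cos_geN1 cos_le1. Qed.
Let sin1 (x : R) : `|sin x| <= 1. Proof. by rewrite ler_norml sin_geN1 sin_le1. Qed.

Lemma mean_damp_partial_sums t r : 0 <= t -> uniq r ->
  \int[P]_w damp t (M_ r w) = (\int[P]_w damp t (q (Z0 w))) ^+ size r.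
Proof.
move=> t0; elim: r => [|k r IH] /=.
  move=> _; rewrite expr0; under eq_Rintegral do rewrite /M_ big_nil /damp !mulr0 oppr0 expR0.
  by rewrite Rintegral_cstT.
move=> /andP[kr ur]; rewrite exprS -IH//.
have mg : measurable_fun setT (fun x => damp t (q x)) by apply: mdamp; exact: measurable_funPT.
have g1 x : `|damp t (q x)| <= 1 by exact: damp_le1x.
have := @split_expectation t k r (fun x => damp t (q x)) (fun=> 1) 1 t0 ur kr mg g1.
move=> /(_ (fun=> eq_ind_r (fun y => y <= 1) (lexx 1) (normr1 R)) (fun x => cvg_cst (1 : R))).
under [X in _ = _ * X -> _]eq_Rintegral do rewrite mulr1.
move=> <-; apply: eq_Rintegral => w _.
by rewrite mulr1 /damp -expRD /M_ big_cons; congr expR; ring.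
Qed.

Let int_bdd (f : T -> R) C : measurable_fun setT f -> (forall w, `|f w| <= C) ->
  P.-integrable setT (EFin \o f).
Proof. exact: bounded_integrable. Qed.

Let mtail t r (f : R -> R) : continuous f ->
  measurable_fun setT (fun w => damp t (M_ r w) * f (t * (s * S_ r w))).
Proof.
move=> cf; apply: measurable_funM; first exact: mdamp.
by apply: mcont => //; do 2 apply: mlin.
Qed.

Let tail1 t r (f : R -> R) w : 0 <= t -> (forall x, `|f x| <= 1) ->
  `|damp t (M_ r w) * f (t * (s * S_ r w))| <= damp t (M_ r w).
Proof. by move=> t0 f1; rewrite normrM (ger0_norm (expR_ge0 _)) ler_piMr// expR_ge0. Qed.

(** The factor e^(-t Theta) of the sum splits into the factor of summand k and that of the others.
    The first, multiplied by L1 + i L2 of summand k, gives the one-summand means [a1] and [a2]. The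
    second is independent of it and bounded by its damping. Removing k from the mass term gives the
    same damping factor, so the two bounds match. *)
Let term_bound e t k r : 0 < t -> 0 <= e -> uniq r -> k \in r ->
  `|a1 t| <= e * h t -> `|a2 t| <= e * h t ->
  `|\int[P]_w (damp t (M_ r w) * (L1 c s k1 k2 (p (Z k w)) (q (Z k w)) * cos (t * (s * S_ r w)) +
      L2 c s k1 k2 (p (Z k w)) (q (Z k w)) * sin (t * (s * S_ r w))))|
  <= 2 * e * \int[P]_w (q (Z k w) * damp t (M_ r w)).
Proof.
move=> t0 e0 ur kr a1e a2e.
pose r' := rem k r.
have ur' : uniq r' by exact: rem_uniq.
have kr' : k \notin r' by rewrite mem_rem_uniq// inE eqxx.
have SE w : S_ r w = p (Z k w) + S_ r' w by rewrite /S_ (big_rem k).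
have ME w : M_ r w = q (Z k w) + M_ r' w by rewrite /M_ (big_rem k).
have t0' := ltW t0.
have dE w : damp t (M_ r w) = damp t (q (Z k w)) * damp t (M_ r' w).
  by rewrite ME /damp -expRD; congr expR; ring.
have cc := @continuous_cos R; have cn := @continuous_sin R.
have m1w : measurable_fun setT (fun w => res1 t (Z k w)).
  by apply: (measurableT_comp (mres1 t)); exact: measurable_funPT.
have m2w : measurable_fun setT (fun w => res2 t (Z k w)).
  by apply: (measurableT_comp (mres2 t)); exact: measurable_funPT.
have -> : \int[P]_w (damp t (M_ r w) * (L1 c s k1 k2 (p (Z k w)) (q (Z k w)) * cos (t * (s * S_ r w)) +
      L2 c s k1 k2 (p (Z k w)) (q (Z k w)) * sin (t * (s * S_ r w)))) =
    \int[P]_w (res1 t (Z k w) * (damp t (M_ r' w) * cos (t * (s * S_ r' w))) +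
               res2 t (Z k w) * (damp t (M_ r' w) * sin (t * (s * S_ r' w)))).
  apply: eq_Rintegral => w _; rewrite dE SE /res1 /res2 /residual /residual2 -/(damp t (q (Z k w))).
  have -> : t * (s * (p (Z k w) + S_ r' w)) = t * (s * p (Z k w)) + t * (s * S_ r' w) by ring.
  by rewrite cosD sinD; ring.
have ib (g : E -> R) (f : R -> R) : measurable_fun setT (fun w => g (Z k w)) ->
    (forall x, `|g x| <= 2 * K * (t * c)^-1) -> continuous f -> (forall x, `|f x| <= 1) ->
    P.-integrable setT (EFin \o (fun w => g (Z k w) * (damp t (M_ r' w) * f (t * (s * S_ r' w))))).
  move=> mg gC cf f1; apply: (@int_bdd _ (2 * K * (t * c)^-1)).
    by apply: measurable_funM => //; exact: mtail.
  move=> w; rewrite normrM; apply: le_trans (gC (Z k w)); rewrite ler_piMr//.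
  by apply: le_trans (tail1 _ _ t0' f1) _; have /andP[] := damp1 r' w t0'.
rewrite RintegralD//; last 2 first.
- by apply: ib => // x; have [] := res_bound x t0.
- by apply: ib => // x; have [] := res_bound x t0.
rewrite (@split_expectation t k r' (res1 t) cos (2 * K * (t * c)^-1))//; last first.
  by move=> x; have [] := res_bound x t0.
rewrite (@split_expectation t k r' (res2 t) sin (2 * K * (t * c)^-1))//; last first.
  by move=> x; have [] := res_bound x t0.
rewrite -/(a1 t) -/(a2 t).
have id' : P.-integrable setT (EFin \o (fun w => damp t (M_ r' w))).
  apply: (@int_bdd _ 1); first exact: mdamp.
  by move=> w; exact: damp_le1x.
have Bf (f : R -> R) : continuous f -> (forall x, `|f x| <= 1) ->
    `|\int[P]_w (damp t (M_ r' w) * f (t * (s * S_ r' w)))| <= \int[P]_w damp t (M_ r' w).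
  move=> cf f1; apply: ler_norm_Rintegral => //; first exact: mtail.
  by move=> w _; exact: tail1.
have mg : measurable_fun setT (fun x => q x * damp t (q x)).
  by have mq := measurable_funPT q; apply: measurable_funM => //; exact: mdamp.
have gC x : `|q x * damp t (q x)| <= (t * c)^-1.
  by have /andP[g0 g1] := damped_q x t0; rewrite ger0_norm.
have one1 : forall x : R, `|1 : R| <= 1 by move=> _; rewrite normr1.
have -> : \int[P]_w (q (Z k w) * damp t (M_ r w)) = h t * \int[P]_w damp t (M_ r' w).
  have := @split_expectation t k r' (fun x => q x * damp t (q x)) (fun=> 1) _ t0' ur' kr' mg gC one1.
  move=> /(_ (fun x => cvg_cst (1 : R))).
  under [X in _ = _ * X -> _]eq_Rintegral do rewrite mulr1.
  move=> <-; apply: eq_Rintegral => w _.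
  by rewrite mulr1 dE mulrA.
have D0 : 0 <= \int[P]_w damp t (M_ r' w) by apply: Rintegral_ge0 => w _; exact: expR_ge0.
apply: le_trans (ler_normD _ _) _; rewrite !normrM.
have -> : 2 * e * (h t * \int[P]_w damp t (M_ r' w)) =
  (e * h t) * \int[P]_w damp t (M_ r' w) + (e * h t) * \int[P]_w damp t (M_ r' w) by ring.
by apply: lerD; apply: ler_pM => //; apply: Bf.
Qed.

(** [L1] and [L2] are linear, so the residual of the sum is the sum of the terms just bounded. Their
    shares add up to the damped mass of the sum, and the constant 2 e is independent of the number
    of summands. *)
Let residual_sum_bound e t r : 0 < t -> 0 <= e -> uniq r ->
  `|a1 t| <= e * h t -> `|a2 t| <= e * h t ->
  `|\int[P]_w residual c s k1 k2 t (S_ r w) (M_ r w)| <=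
  2 * e * \int[P]_w (M_ r w * damp t (M_ r w)).
Proof.
move=> t0 e0 ur a1e a2e; have t0' := ltW t0.
pose f k w := damp t (M_ r w) * (L1 c s k1 k2 (p (Z k w)) (q (Z k w)) * cos (t * (s * S_ r w)) +
      L2 c s k1 k2 (p (Z k w)) (q (Z k w)) * sin (t * (s * S_ r w))).
pose g k w := q (Z k w) * damp t (M_ r w).
have qM k w : k \in r -> q (Z k w) <= M_ r w.
  by move=> kr; rewrite /M_ (big_rem k)//= lerDl sumr_ge0.
have dM w : 0 <= M_ r w * damp t (M_ r w) <= (t * c)^-1.
  rewrite mulr_ge0 ?expR_ge0//=.
  have tc : 0 < t * c by rewrite mulr_gt0.
  rewrite -[leRHS]mulr1 mulrC ler_pdivlMl// mulrC -mulrA.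
  have := mul_expRN_le (t * (c * M_ r w)); congr (_ <= _); rewrite /damp; ring.
have gb k w : k \in r -> 0 <= g k w <= (t * c)^-1.
  move=> kr; rewrite /g mulr_ge0 ?expR_ge0//=; have /andP[_] := dM w.
  by apply: le_trans; rewrite ler_wpM2r ?expR_ge0// qM.
have ig k : k \in r -> P.-integrable setT (EFin \o g k).
  move=> kr; apply: (@int_bdd _ (t * c)^-1).
    by apply: measurable_funM => //; exact: mdamp.
  by move=> w; have /andP[g0 g1] := gb k w kr; rewrite ger0_norm.
have if_ k : k \in r -> P.-integrable setT (EFin \o f k).
  move=> kr; apply: (@int_bdd _ (2 * K * (t * c)^-1)).
    apply: measurable_funM; first exact: mdamp.
    apply: measurable_funD; apply: measurable_funM.
    - by apply: (measurableT_comp mL1); exact: measurable_funPT.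
    - exact: mcos.
    - by apply: (measurableT_comp mL2); exact: measurable_funPT.
    - exact: msin.
  move=> w; have [b1 b2] := L12_bound k1 k2 c01 s1 (pq (Z k w)).
  have /andP[_ gb1] := gb k w kr.
  rewrite /f normrM (ger0_norm (expR_ge0 _)).
  apply: (@le_trans _ _ (2 * K * g k w)); last by rewrite ler_wpM2l// mulr_ge0// ltW.
  rewrite /g mulrC [leRHS]mulrA ler_wpM2r ?expR_ge0// -[leRHS]mulrA.
  exact: trig_comb_bound.
have [_ Ef] := Rintegral_sum if_; have [_ Eg] := Rintegral_sum ig.
have -> : \int[P]_w residual c s k1 k2 t (S_ r w) (M_ r w) = \sum_(k <- r) \int[P]_w f k w.
  rewrite -Ef; apply: eq_Rintegral => w _; rewrite /f -mulr_sumr; congr (_ * _).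
  rewrite big_split/= -!mulr_suml; congr (_ * _ + _ * _).
    rewrite /L1 /S_ /M_; elim: (r) => [|j r' IH]; first by rewrite !big_nil; ring.
    by rewrite !big_cons -IH; ring.
  rewrite /L2 /S_ /M_; elim: (r) => [|j r' IH]; first by rewrite !big_nil; ring.
  by rewrite !big_cons -IH; ring.
have -> : \int[P]_w (M_ r w * damp t (M_ r w)) = \sum_(k <- r) \int[P]_w g k w.
  by rewrite -Eg; apply: eq_Rintegral => w _; rewrite /g -mulr_suml.
rewrite mulr_sumr; apply: le_trans (ler_norm_sum _ _ _) _.
rewrite big_seq [leRHS]big_seq; apply: ler_sum => k kr.
exact: term_bound.
Qed.

(** At t = 0 the mean primitive is the mean of [m1]. With dlt chosen for the accuracy c e / 4, its
    oscillation on [0, dlt] is at most 2 (c e / 4) / c = e / 2 for every n. At dlt itself it is at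
    most B rho^n, where rho < 1 is the one-summand damping. *)
Lemma self_normalized_limit :
  (forall e, 0 < e -> exists2 dlt, 0 < dlt & forall t, 0 < t <= dlt ->
     `|\int[P]_w residual c s k1 k2 t (p (Z0 w)) (q (Z0 w))| <=
       e * \int[P]_w (q (Z0 w) * expR (- (t * (c * q (Z0 w))))) /\
     `|\int[P]_w residual2 t (p (Z0 w)) (q (Z0 w))| <=
       e * \int[P]_w (q (Z0 w) * expR (- (t * (c * q (Z0 w)))))) ->
  (forall t, 0 < t -> \int[P]_w expR (- (t * (c * q (Z0 w)))) < 1) ->
  \int[P]_w m1 c s k1 k2 (\sum_(j <- iota 0 n) p (Z j w)) (\sum_(j <- iota 0 n) q (Z j w))
    @[n --> \oo] --> 0.
Proof.
move=> Hsmall Hlt1; apply/cvgrPdist_le => e e0.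
have e' : 0 < c * e / 4 by rewrite divr_gt0// mulr_gt0.
have [dlt dlt0 Hd] := Hsmall _ e'.
pose rho := \int[P]_w expR (- (dlt * (c * q (Z0 w)))).
have rho0 : 0 <= rho by apply: Rintegral_ge0 => w _; exact: expR_ge0.
have rho1 : rho < 1 by exact: Hlt1.
pose B := 4 * K / c ^+ 2.
have cvB : B * rho ^+ n @[n --> \oo] --> 0.
  rewrite -[X in _ --> X](mulr0 B); apply: cvgM; first exact: cvg_cst.
  by apply: cvg_expr; rewrite ger0_norm.
have e2 : 0 < e / 2 by rewrite divr_gt0.
near=> n.
have un : uniq (iota 0 n) by exact: iota_uniq.
rewrite sub0r normrN.
have E0 : \int[P]_w m1 c s k1 k2 (S_ (iota 0 n) w) (M_ (iota 0 n) w) =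
    mean_primitive c s k1 k2 P (S_ (iota 0 n)) (M_ (iota 0 n)) 0.
  apply: eq_Rintegral => w _.
  by rewrite /primitive !mul0r oppr0 expR0 cos0 sin0 mul1r mulr1 mulr0 addr0.
rewrite -/(S_ (iota 0 n)) -/(M_ (iota 0 n)).
rewrite [X in `|X|]E0.
have O1 : `|mean_primitive c s k1 k2 P (S_ (iota 0 n)) (M_ (iota 0 n)) 0 -
           mean_primitive c s k1 k2 P (S_ (iota 0 n)) (M_ (iota 0 n)) dlt| <= 2 * (c * e / 4) / c.
  apply: (mean_primitive_oscillation c01 s1 (mS (iota 0 n)) (mM (iota 0 n)) (SM (iota 0 n)) dlt0) => //; last first.
    by rewrite mulr_ge0// ltW.
  move=> t tI; have [h1 h2] := Hd t tI; have /andP[t0 _] := tI.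
  by apply: residual_sum_bound => //; exact: ltW.
have O2 : `|mean_primitive c s k1 k2 P (S_ (iota 0 n)) (M_ (iota 0 n)) dlt| <= B * rho ^+ n.
  have -> : rho ^+ n = \int[P]_w damp dlt (M_ (iota 0 n) w).
    by rewrite mean_damp_partial_sums ?ltW// size_iota.
  have id' : P.-integrable setT (EFin \o (fun w => damp dlt (M_ (iota 0 n) w))).
    by apply: (@int_bdd _ 1); [exact: mdamp|move=> w; apply: damp_le1x => //; exact: ltW].
  rewrite -RintegralZl//; apply: ler_norm_Rintegral => //.
  - exact: measurable_primitive.
  - exact: RintegrableZ.
  - by move=> w _; exact: primitive_bound.
have O3 : B * rho ^+ n <= e / 2 by near: n; exact: (cvgr_le _ cvB).
have O4 : 2 * (c * e / 4) / c = e / 2 by field; rewrite gt_eqF.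
rewrite O4 in O1.
set X := mean_primitive _ _ _ _ _ _ _ 0 in O1 *; set Y := mean_primitive _ _ _ _ _ _ _ dlt in O1 O2 *.
have -> : X = (X - Y) + Y by rewrite subrK.
by apply: le_trans (ler_normD _ _) _; lra.
Unshelve. all: by end_near. Qed.

End SelfNormalizedIID.

(** * One-summand asymptotics, the constant kappa, and the limit of the mean kernel *)

Section ScoreFunctions.
Context {R : realType} (psi : {mfun R >-> R}).

Definition pospart x : R := Num.max (psi x) 0.
Definition negpart x : R := Num.max (- psi x) 0.
Definition score (z : R * R) : R := psi z.1 * Num.max z.2 0.
Definition score_norm (z : R * R) : R := `|score z|.

Let mpos : measurable_fun setT pospart.
Proof. by apply: measurable_maxr => //; exact: measurable_funPT. Qed.

Let mneg : measurable_fun setT negpart.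
Proof. by apply: measurable_maxr => //; apply: measurableT_comp => //; exact: measurable_funPT. Qed.

Let mscore : measurable_fun setT score.
Proof.
apply: measurable_funM.
  by apply: (measurableT_comp (measurable_funPT psi)); exact: measurable_fst.
by apply: measurable_maxr => //; exact: measurable_snd.
Qed.

Let mscore_norm : measurable_fun setT score_norm.
Proof. exact: measurableT_comp. Qed.

HB.instance Definition _ := isMeasurableFun.Build _ _ _ _ pospart mpos.
HB.instance Definition _ := isMeasurableFun.Build _ _ _ _ negpart mneg.
HB.instance Definition _ := isMeasurableFun.Build _ _ _ _ score mscore.
HB.instance Definition _ := isMeasurableFun.Build _ _ _ _ score_norm mscore_norm.

Lemma pospart_ge0 x : 0 <= pospart x. Proof. by rewrite le_max lexx orbT. Qed.
Lemma negpart_ge0 x : 0 <= negpart x. Proof. by rewrite le_max lexx orbT. Qed.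

End ScoreFunctions.

Section LimitK.
Context d (T : measurableType d) (R : realType) (P : probability T R).
Variables (X Y : {mfun T >-> R}) (Xs Ys : nat -> {mfun T >-> R}).
Hypothesis XY : independent_rv P X Y.
Hypothesis iid : iid_copies P (fun w => (X w, Y w)) (fun i w => (Xs i w, Ys i w)).
Variables (b dlt : R).
Hypothesis bI : 0 < b < dlt.
Hypothesis d1 : dlt < 1.
Let G y := fine (P [set w | y < Y w]).
Hypothesis Gpos : forall y, 0 < G y.
Hypothesis Grv : forall t, 0 < t -> G (t * y) / G y @[y --> +oo] --> t `^ (- b).
Variable psi : {mfun R >-> R}.
Hypothesis psi_int : P.-integrable setT (EFin \o (fun w => `|psi (X w)| `^ dlt)).

Let cp := \int[P]_w (pospart psi (X w) `^ b).
Let cm := \int[P]_w (negpart psi (X w) `^ b).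
Hypothesis cpm : 0 < cp + cm.

Let b01 : 0 < b < 1. Proof. by have /andP[b0 bd] := bI; rewrite b0 (lt_trans bd d1). Qed.
Let dlt01 : 0 < dlt < 1. Proof. by have /andP[b0 bd] := bI; rewrite (lt_trans b0 bd). Qed.

Let int_part (f : {mfun R >-> R}) : (forall x, 0 <= f x <= `|psi x|) ->
  P.-integrable setT (EFin \o (fun w => f (X w) `^ dlt)).
Proof.
move=> fI; apply: (@le_Rintegrable _ _ _ P setT _ (fun w => `|psi (X w)| `^ dlt)) => //.
  apply: (measurableT_comp (measurable_powR dlt)); apply: (measurableT_comp (measurable_funPT f)).
  exact: measurable_funPT.
move=> w _; have /andP[f0 f1] := fI (X w).
rewrite ger0_norm ?powR_ge0// ge0_ler_powR ?nnegrE//.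
by case/andP: dlt01 => /ltW.
Qed.

Let pos_le x : 0 <= pospart psi x <= `|psi x|.
Proof. by rewrite pospart_ge0 /pospart ge_max normr_ge0 ler_norm. Qed.

Let neg_le x : 0 <= negpart psi x <= `|psi x|.
Proof. by rewrite negpart_ge0 /negpart ge_max normr_ge0 -normrN ler_norm. Qed.

Let Vp := breiman_product X Y (pospart psi).
Let Vm := breiman_product X Y (negpart psi).
Let g t := G t^-1.

Variable a : R.
Hypothesis aI : 0 <= a < pi / 2.
Let c := cos a.
Let s := sin a.
(** [kap] e^(i [gam]) is the factor b Gamma(1 - b) e^(i (1 - b) a) produced by [sin_cos_abelian]. *)
Let gam := (1 - b) * a.
Let kap := b * Icos b 0.

Let kap0 : 0 < kap.
Proof. by rewrite mulr_gt0// ?Icos0_gt0//; case/andP: b01. Qed.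

Let c0 : 0 < c.
Proof.
have /andP[a0 a1] := aI; have p0 := pi_gt0 R.
by apply: cos_gt0_pihalf; apply/andP; split; lra.
Qed.

Let c01 : 0 < c <= 1. Proof. by rewrite c0 cos_le1. Qed.
Let s1 : `|s| <= 1. Proof. by rewrite ler_norml sin_geN1 sin_le1. Qed.

Let Qc (V : T -> R) t w := t * V w * (expR (- (c * (t * V w))) * cos (s * (t * V w))).
Let Qs (V : T -> R) t w := t * V w * (expR (- (c * (t * V w))) * sin (s * (t * V w))).

Let abel (f : {mfun R >-> R}) : (forall x, 0 <= f x <= `|psi x|) ->
  let V := breiman_product X Y f in let e := \int[P]_w (f (X w) `^ b) in
  (\int[P]_w Qc V t w) / g t @[t --> 0^'+] --> e * kap * cos gam /\
  (\int[P]_w Qs V t w) / g t @[t --> 0^'+] --> e * kap * sin gam.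
Proof.
move=> fI V e; have f0 x : 0 <= f x by have /andP[] := fI x.
have [h1 [C [t0 [t00 h2]]]] := breiman XY f0 bI d1 (int_part fI) Gpos Grv.
exact: (sin_cos_abelian (measurable_breiman_product X Y f) (breiman_product_ge0 X Y f0) b01 dlt01 t00 aI h1 h2).
Qed.

(** With C = cos (b a) and S = sin (b a), k1 + i k2 is kappa = (Pr C + i S) / (C + i Pr S), the
    ratio of the limiting one-summand means of Omega e^(-t Theta) and Theta e^(-t Theta). Positive
    scores contribute cp e^(i b a) to both; negative ones contribute - cm e^(-i b a) to the first
    and cm e^(-i b a) to the second. *)
Let Pr := (cp - cm) / (cp + cm).
Let den := cos (b * a) ^+ 2 + Pr ^+ 2 * sin (b * a) ^+ 2.
Let k1 := Pr / den.
Let k2 := sin (b * a) * cos (b * a) * (1 - Pr ^+ 2) / den.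

Let den0 : 0 < den.
Proof.
have /andP[a0 a1] := aI; have p0 := pi_gt0 R; have /andP[b0 b1] := b01.
apply: ltr_pwDl; last by apply: mulr_ge0; exact: sqr_ge0.
rewrite exprn_gt0//; apply: cos_gt0_pihalf; apply/andP; split; nra.
Qed.

Let Z0 := mfun_pair X Y.
Let z w := score psi (Z0 w).
Let q w := score_norm psi (Z0 w).

Let parts w : (Vp w = z w /\ Vm w = 0 /\ q w = z w) \/ (Vp w = 0 /\ Vm w = - z w /\ q w = - z w).
Proof.
rewrite /Vp /Vm /breiman_product /q /z /score_norm /score /Z0 /mfun_pair /= /pospart /negpart.
have Y0 : 0 <= Num.max (Y w) 0 by rewrite le_max lexx orbT.
have [p0|] := boolP (0 <= psi (X w)); last rewrite -ltNge => p0.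
  left; rewrite (max_l p0) (ger0_norm (mulr_ge0 p0 Y0)) [X in X * _ = 0]max_r ?oppr_le0//.
  by rewrite mul0r.
right; rewrite (max_r (ltW p0)) mul0r (ler0_norm (mulr_le0_ge0 (ltW p0) Y0)).
by rewrite max_l ?mulNr// oppr_ge0 ltW.
Qed.

Let QcE V t w : Qc V t w = t * V w * (expR (- (t * (c * V w))) * cos (t * (s * V w))).
Proof. by rewrite /Qc !(mulrCA _ t). Qed.

Let QsE V t w : Qs V t w = t * V w * (expR (- (t * (c * V w))) * sin (t * (s * V w))).
Proof. by rewrite /Qs !(mulrCA _ t). Qed.

(** At most one of the parts [Vp], [Vm] is nonzero, and the parity of cosine and sine accounts for
    the sign of the score. The factor t makes every term a function of t V, as the Abelian limits
    require. *)
Let res1E t w : t * residual c s k1 k2 t (z w) (q w) =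
  (c - k1 * c + k2 * s) * Qc Vp t w + (- c - k1 * c - k2 * s) * Qc Vm t w +
  (s - k1 * s - k2 * c) * Qs Vp t w + (- s - k1 * s + k2 * c) * Qs Vm t w.
Proof.
rewrite !QcE !QsE /residual /L1 /L2.
case: (parts w) => -[-> [-> ->]]; first by ring.
by rewrite !mulrN !cosN !sinN !opprK; ring.
Qed.

Let res2E t w : t * residual2 c s k1 k2 t (z w) (q w) =
  (s - k1 * s - k2 * c) * Qc Vp t w + (s + k1 * s - k2 * c) * Qc Vm t w -
  (c - k1 * c + k2 * s) * Qs Vp t w - (c + k1 * c + k2 * s) * Qs Vm t w.
Proof.
rewrite !QcE !QsE /residual2 /L1 /L2.
case: (parts w) => -[-> [-> ->]]; first by ring.
by rewrite !mulrN !cosN !sinN !opprK; ring.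
Qed.

Let V_facts (f : {mfun R >-> R}) : (forall x, 0 <= f x) ->
  let V := breiman_product X Y f in measurable_fun setT V /\ forall w, 0 <= V w.
Proof.
by move=> f0 V; split; [exact: measurable_breiman_product|exact: breiman_product_ge0].
Qed.

Let Q_int (V : T -> R) t (tr : R -> R) : measurable_fun setT V -> (forall w, 0 <= V w) -> 0 < t ->
  continuous tr -> (forall x, `|tr x| <= 1) ->
  P.-integrable setT (EFin \o (fun w => t * V w * (expR (- (c * (t * V w))) * tr (s * (t * V w))))).
Proof.
move=> mV V0 t0 ctr tr1; apply: (@bounded_integrable _ _ _ P _ c^-1).
  have mtV : measurable_fun setT (fun w => t * V w) by exact: measurable_funM.
  have mk k : measurable_fun setT (fun w => k * (t * V w)) by exact: measurable_funM.
  apply: measurable_funM => //; apply: measurable_funM.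
    by apply: (measurableT_comp (@measurable_expR R)); exact: measurableT_comp.
  by apply: (measurableT_comp _ (mk s)); exact: continuous_measurable_fun.
move=> w; have tV : 0 <= t * V w by rewrite mulr_ge0// ltW.
rewrite mulrA normrM; apply: (@le_trans _ _ `|t * V w * expR (- (c * (t * V w)))|).
  by rewrite ler_piMr.
rewrite ger0_norm; last by apply: mulr_ge0 => //; exact: expR_ge0.
by rewrite -[leRHS]mulr1 ler_pdivlMl// mulrA; exact: mul_expRN_le.
Qed.

Let cos1 (x : R) : `|cos x| <= 1. Proof. by rewrite ler_norml cos_geN1 cos_le1. Qed.
Let sin1 (x : R) : `|sin x| <= 1. Proof. by rewrite ler_norml sin_geN1 sin_le1. Qed.

Let iQc t : 0 < t -> P.-integrable setT (EFin \o Qc Vp t) /\ P.-integrable setT (EFin \o Qc Vm t).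
Proof.
move=> t0; have [m1 h1] := V_facts (pospart_ge0 psi); have [m2 h2] := V_facts (negpart_ge0 psi).
by split; apply: Q_int => //; exact: continuous_cos.
Qed.

Let iQs t : 0 < t -> P.-integrable setT (EFin \o Qs Vp t) /\ P.-integrable setT (EFin \o Qs Vm t).
Proof.
move=> t0; have [m1 h1] := V_facts (pospart_ge0 psi); have [m2 h2] := V_facts (negpart_ge0 psi).
by split; apply: Q_int => //; exact: continuous_sin.
Qed.

Let comb (x1 x2 x3 x4 : R) t w := x1 * Qc Vp t w + x2 * Qc Vm t w + x3 * Qs Vp t w + x4 * Qs Vm t w.

Let comb_int x1 x2 x3 x4 t : 0 < t ->
  P.-integrable setT (EFin \o comb x1 x2 x3 x4 t) /\
  \int[P]_w comb x1 x2 x3 x4 t w =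
    x1 * \int[P]_w Qc Vp t w + x2 * \int[P]_w Qc Vm t w +
    x3 * \int[P]_w Qs Vp t w + x4 * \int[P]_w Qs Vm t w.
Proof.
move=> t0; have [i1 i2] := iQc t0; have [i3 i4] := iQs t0.
have j1 := RintegrableZ x1 measurableT i1; have j2 := RintegrableZ x2 measurableT i2.
have j3 := RintegrableZ x3 measurableT i3; have j4 := RintegrableZ x4 measurableT i4.
have k2' := RintegrableD measurableT j1 j2; have k3' := RintegrableD measurableT k2' j3.
split; first exact: (RintegrableD measurableT k3' j4).
rewrite /comb RintegralD// RintegralD// RintegralD//.
by rewrite !RintegralZl.
Qed.

Let comb_lim x1 x2 x3 x4 :
  (\int[P]_w comb x1 x2 x3 x4 t w) / g t @[t --> 0^'+] -->
  x1 * (cp * kap * cos gam) + x2 * (cm * kap * cos gam) +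
  x3 * (cp * kap * sin gam) + x4 * (cm * kap * sin gam).
Proof.
have [l1 l3] := abel pos_le; have [l2 l4] := abel neg_le.
have : x1 * ((\int[P]_w Qc Vp t w) / g t) + x2 * ((\int[P]_w Qc Vm t w) / g t) +
  x3 * ((\int[P]_w Qs Vp t w) / g t) + x4 * ((\int[P]_w Qs Vm t w) / g t) @[t --> 0^'+] -->
  x1 * (cp * kap * cos gam) + x2 * (cm * kap * cos gam) +
  x3 * (cp * kap * sin gam) + x4 * (cm * kap * sin gam).
  have scale (k l : R) (f : R -> R) : f t @[t --> 0^'+] --> l -> k * f t @[t --> 0^'+] --> k * l.
    by move=> fl; apply: cvgM; [exact: cvg_cst|exact: fl].
  exact: (cvgD (cvgD (cvgD (scale x1 _ _ l1) (scale x2 _ _ l2)) (scale x3 _ _ l3)) (scale x4 _ _ l4)).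
apply: cvg_trans; apply: near_eq_cvg; near=> t.
have t0 : 0 < t by [].
have [_ ->] := comb_int x1 x2 x3 x4 t0; ring.
Unshelve. all: by end_near. Qed.

(** Multiplication by Theta or Omega adds the angle a to - gam, and a - gam = b a. *)
Let cosb : c * cos gam + s * sin gam = cos (b * a).
Proof. by rewrite -cosB; congr cos; rewrite /gam; ring. Qed.

Let sinb : s * cos gam - c * sin gam = sin (b * a).
Proof. by rewrite -sinB; congr sin; rewrite /gam; ring. Qed.

(** Real part of the defining equation Pr C + i S = kappa (C + i Pr S); the imaginary part is
    [kappa_im]. *)
Let kappa_re : Pr * cos (b * a) - k1 * cos (b * a) + k2 * (Pr * sin (b * a)) = 0.
Proof.
have CS := cos2Dsin2 (b * a); have dn := den0.
rewrite /k1 /k2; set C := cos (b * a) in CS *; set S := sin (b * a) in CS *.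
have D1 : den = C ^+ 2 + Pr ^+ 2 * S ^+ 2 by [].
have -> : Pr * C - Pr / den * C + S * C * (1 - Pr ^+ 2) / den * (Pr * S) =
  Pr * C / den * (den - 1 + S ^+ 2 * (1 - Pr ^+ 2)) by field; rewrite gt_eqF.
have C2 : C ^+ 2 = 1 - S ^+ 2 by rewrite -CS addrK.
have -> : den - 1 + S ^+ 2 * (1 - Pr ^+ 2) = 0 by rewrite D1 C2; ring.
by rewrite mulr0.
Qed.

Let kappa_im : sin (b * a) - k1 * (Pr * sin (b * a)) - k2 * cos (b * a) = 0.
Proof.
have CS := cos2Dsin2 (b * a); have dn := den0.
rewrite /k1 /k2; set C := cos (b * a) in CS *; set S := sin (b * a) in CS *.
have D1 : den = C ^+ 2 + Pr ^+ 2 * S ^+ 2 by [].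
have -> : S - Pr / den * (Pr * S) - S * C * (1 - Pr ^+ 2) / den * C =
  S / den * (den - Pr ^+ 2 - C ^+ 2 * (1 - Pr ^+ 2)) by field; rewrite gt_eqF.
have -> : den - Pr ^+ 2 - C ^+ 2 * (1 - Pr ^+ 2) = Pr ^+ 2 * (C ^+ 2 + S ^+ 2) - Pr ^+ 2 by rewrite D1; ring.
by rewrite CS mulr1 subrr mulr0.
Qed.

Let PrE : cp - cm = Pr * (cp + cm).
Proof. by rewrite /Pr divfK// gt_eqF. Qed.

Let damped t := \int[P]_w (q w * expR (- (t * (c * q w)))).

Let q0 w : 0 <= q w. Proof. exact: normr_ge0. Qed.

Let mq : measurable_fun setT q.
Proof. exact: (measurableT_comp (measurable_funPT (score_norm psi)) (measurable_mfun_pair X Y)). Qed.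

Let damped_int t : 0 < t -> P.-integrable setT (EFin \o (fun w => q w * expR (- (t * (c * q w))))).
Proof.
move=> t0; apply: (@bounded_integrable _ _ _ P _ (t * c)^-1).
  apply: measurable_funM => //; apply: (measurableT_comp (@measurable_expR R)).
  by apply: measurableT_comp => //; apply: measurable_funM => //; apply: measurable_funM.
by move=> w; rewrite ger0_norm ?mulr_ge0 ?expR_ge0//; exact: damped_mass_bound.
Qed.

(** Bounding a cosine by 1 compares the damped mass with a combination whose Abelian limit is
    already known and positive, so the mass needs no asymptotics of its own. *)
Let damped_ge t : 0 < t -> t^-1 * \int[P]_w comb 1 1 0 0 t w <= damped t.
Proof.
move=> t0; have [ic _] := comb_int 1 1 0 0 t0.
rewrite -RintegralZl//; apply: le_Rintegral => //; first exact: RintegrableZ.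
  exact: damped_int.
move=> w _; rewrite ler_pdivrMl// /comb !mul1r !mul0r !addr0 !QcE.
have -> : t * Vp w * (expR (- (t * (c * Vp w))) * cos (t * (s * Vp w))) +
    t * Vm w * (expR (- (t * (c * Vm w))) * cos (t * (s * Vm w))) =
    t * (q w * expR (- (t * (c * q w)))) * cos (t * (s * q w)).
  by case: (parts w) => -[-> [-> ->]]; ring.
rewrite ler_piMr ?cos_le1//; apply: mulr_ge0; first exact: ltW.
by apply: mulr_ge0 => //; exact: expR_ge0.
Qed.

Let lim0 : (\int[P]_w comb 1 1 0 0 t w) / g t @[t --> 0^'+] --> kap * (cp + cm) * cos gam.
Proof.
by have := @comb_lim 1 1 0 0; congr (_ @ _ --> _); ring.
Qed.

Let cosgam : 0 < cos gam.
Proof.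
have /andP[a0 a1] := aI; have p0 := pi_gt0 R; have /andP[b0 b1] := b01.
apply: cos_gt0_pihalf; rewrite /gam; apply/andP; split; nra.
Qed.

(** A combination with limit 0 is o(g t), whereas t times the damped mass is at least a positive
    multiple of g t. The quotient of the two means is therefore eventually below any e. *)
Let small (x1 x2 x3 x4 : R) (f : R -> T -> R) e :
  (forall t w, t * f t w = comb x1 x2 x3 x4 t w) ->
  x1 * (cp * kap * cos gam) + x2 * (cm * kap * cos gam) +
  x3 * (cp * kap * sin gam) + x4 * (cm * kap * sin gam) = 0 -> 0 < e ->
  \forall t \near 0^'+, `|\int[P]_w f t w| <= e * damped t.
Proof.
move=> fE L0 e0; have := @comb_lim x1 x2 x3 x4; rewrite L0 => l0.
pose Lc := kap * (cp + cm) * cos gam.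
have Lc0 : 0 < Lc by rewrite mulr_gt0// mulr_gt0.
have Lc2 : Lc / 2 < Lc by lra.
have eL : 0 < e * (Lc / 2) by rewrite mulr_gt0// divr_gt0.
near=> t; have t0 : 0 < t by [].
have gt0 : 0 < g t by exact: Gpos.
have h1 : Lc / 2 <= (\int[P]_w comb 1 1 0 0 t w) / g t.
  by near: t; exact: (cvgr_ge _ lim0).
have h2 : `|(\int[P]_w comb x1 x2 x3 x4 t w) / g t| <= e * (Lc / 2).
  by near: t; apply: (cvgr0_norm_le _ l0).
have [ic _] := comb_int x1 x2 x3 x4 t0.
have -> : \int[P]_w f t w = t^-1 * \int[P]_w comb x1 x2 x3 x4 t w.
  by rewrite -RintegralZl//; apply: eq_Rintegral => w _; rewrite -fE mulKf// gt_eqF.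
rewrite normrM gtr0_norm ?invr_gt0//.
apply: (@le_trans _ _ (e * (t^-1 * \int[P]_w comb 1 1 0 0 t w))); last first.
  by rewrite ler_wpM2l ?(ltW e0)// damped_ge.
rewrite mulrCA ler_wpM2l ?invr_ge0 ?(ltW t0)//.
rewrite normrM normfV (gtr0_norm gt0) ler_pdivrMr// in h2.
rewrite ler_pdivlMr// in h1.
by apply: le_trans h2 _; rewrite -mulrA ler_wpM2l// ltW.
Unshelve. all: by end_near. Qed.

Let near_right (Q : R -> Prop) : (\forall t \near 0^'+, Q t) ->
  exists2 e : R, 0 < e & forall t, 0 < t <= e -> Q t.
Proof.
move=> [e /= e0 H]; exists (e / 2); first by rewrite divr_gt0.
move=> t /andP[t0 te]; apply: H => //=; rewrite sub0r normrN gtr0_norm//.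
by apply: le_lt_trans te _; lra.
Qed.

Let small_residuals e : 0 < e -> exists2 dl, 0 < dl & forall t, 0 < t <= dl ->
  `|\int[P]_w residual c s k1 k2 t (z w) (q w)| <= e * damped t /\
  `|\int[P]_w residual2 c s k1 k2 t (z w) (q w)| <= e * damped t.
Proof.
move=> e0; apply: near_right.
have H1 := @small (c - k1 * c + k2 * s) (- c - k1 * c - k2 * s) (s - k1 * s - k2 * c)
  (- s - k1 * s + k2 * c) (fun t w => residual c s k1 k2 t (z w) (q w)) e.
have H2 := @small (s - k1 * s - k2 * c) (s + k1 * s - k2 * c) (- (c - k1 * c + k2 * s))
  (- (c + k1 * c + k2 * s)) (fun t w => residual2 c s k1 k2 t (z w) (q w)) e.
near=> t; split; near: t.
  apply: H1; [by move=> ? ?; rewrite res1E /comb; ring| |exact: e0].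
  transitivity (kap * (cp + cm) * (Pr * cos (b * a) - k1 * cos (b * a) + k2 * (Pr * sin (b * a)))).
    rewrite -cosb -sinb.
    have -> : forall x y z' : R, kap * (cp + cm) * (Pr * x - y + k2 * (Pr * z')) =
      kap * ((Pr * (cp + cm)) * x - (cp + cm) * y + k2 * ((Pr * (cp + cm)) * z')) by move=> x y z'; ring.
    by rewrite -PrE; ring.
  by rewrite kappa_re mulr0.
apply: H2; [by move=> ? ?; rewrite res2E /comb; ring| |exact: e0].
transitivity (kap * (cp + cm) * (sin (b * a) - k1 * (Pr * sin (b * a)) - k2 * cos (b * a))).
  rewrite -cosb -sinb.
  have -> : forall x y z' : R, kap * (cp + cm) * (x - k1 * (Pr * y) - z') =
    kap * ((cp + cm) * x - k1 * ((Pr * (cp + cm)) * y) - (cp + cm) * z') by move=> x y z'; ring.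
  by rewrite -PrE; ring.
by rewrite kappa_im mulr0.
Unshelve. all: by end_near. Qed.

(** For small t the damped mass is positive, and 1 - e^(-u) >= u e^(-u) with u = t c q turns this
    into a strict inequality. Larger t follow by monotonicity. *)
Let damp_lt1 t : 0 < t -> \int[P]_w expR (- (t * (c * q w))) < 1.
Proof.
have [t0 t00 H] : exists2 e : R, 0 < e & forall t, 0 < t <= e -> 0 < damped t.
  apply: near_right; have L0 : 0 < kap * (cp + cm) * cos gam by rewrite mulr_gt0// mulr_gt0.
  near=> u; have up : 0 < u by [].
  apply: lt_le_trans (damped_ge up); rewrite mulr_gt0 ?invr_gt0//.
  have gu0 : 0 < (g u)^-1 by rewrite invr_gt0; exact: Gpos.
  rewrite -(pmulr_lgt0 _ gu0).
  by near: u; exact: (cvgr_gt _ lim0).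
have id x : 0 <= x -> P.-integrable setT (EFin \o (fun w => expR (- (x * (c * q w))))).
  move=> x0; apply: (@bounded_integrable _ _ _ P _ 1).
    apply: (measurableT_comp (@measurable_expR R)).
    by apply: measurableT_comp => //; apply: measurable_funM => //; apply: measurable_funM.
  move=> w; rewrite ger0_norm ?expR_ge0// -[leRHS]expR0 ler_expR oppr_le0.
  by rewrite mulr_ge0// mulr_ge0// ltW.
have lt x : 0 < x <= t0 -> \int[P]_w expR (- (x * (c * q w))) < 1.
  move=> xI; have /andP[x0 _] := xI; have Hx := H x xI.
  have : x * c * damped x <= 1 - \int[P]_w expR (- (x * (c * q w))).
    have i1 : P.-integrable setT (EFin \o (fun=> 1 : R)).
      by apply: (@bounded_integrable _ _ _ P _ 1) => // w; rewrite normr1.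
    have ix := id x (ltW x0).
    have -> : x * c * damped x = \int[P]_w (x * c * (q w * expR (- (x * (c * q w))))).
      by rewrite RintegralZl//; exact: damped_int.
    have -> : 1 - \int[P]_w expR (- (x * (c * q w))) = \int[P]_w (1 - expR (- (x * (c * q w)))).
      by rewrite RintegralB// Rintegral_cstT.
    apply: le_Rintegral => //.
    - by apply: RintegrableZ => //; exact: damped_int.
    - by rewrite /comp; under eq_fun do rewrite EFinB; exact: integrableB.
    - move=> w _; set u := x * (c * q w).
      have -> : x * c * (q w * expR (- u)) = u * expR (- u) by rewrite /u; ring.
      have h1 := expR_ge1Dx u; have e0 := expR_gt0 (- u).
      have : (1 + u) * expR (- u) <= expR u * expR (- u) by rewrite ler_wpM2r// ltW.
      by rewrite -expRD subrr expR0; lra.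
  have : 0 < x * c * damped x by rewrite mulr_gt0// mulr_gt0.
  lra.
move=> tp; have [tt|tt] := leP t t0; first by apply: lt; rewrite tp.
apply: le_lt_trans (lt t0 _); last by rewrite t00 lexx.
apply: le_Rintegral => //; [exact: id (ltW tp)|exact: id (ltW t00)|].
by move=> w _; rewrite ler_expR lerN2 ler_wpM2r ?(ltW tt)// mulr_ge0// ltW.
Unshelve. all: by end_near. Qed.

Let Zs i := mfun_pair (Xs i) (Ys i).
Let S_ n w := \sum_(j <- iota 0 n) score psi (Zs j w).
Let M_ n w := \sum_(j <- iota 0 n) score_norm psi (Zs j w).

Let indZ : mutually_independent P (fun i w => Zs i w). Proof. by case: iid. Qed.
Let lawZ i : same_law P (Zs i) Z0. Proof. by case: iid => _ /(_ i). Qed.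

Lemma mean_damp_score n t : 0 <= t ->
  \int[P]_w expR (- (t * (c * M_ n w))) = (\int[P]_w expR (- (t * (c * q w)))) ^+ n.
Proof.
move=> t0; have pq x : `|score psi x| <= score_norm psi x by [].
have := mean_damp_partial_sums indZ lawZ pq s c01 t0 (iota_uniq 0 n).
by rewrite size_iota.
Qed.

(** Since e^(-c M) = 1 where M = 0, this controls the event on which the ratio S / M is only a
    default value. *)
Lemma damp_score_cvg0 : \int[P]_w expR (- (c * M_ n w)) @[n --> \oo] --> 0.
Proof.
have E n : \int[P]_w expR (- (c * M_ n w)) = (\int[P]_w expR (- (1 * (c * q w)))) ^+ n.
  by rewrite -mean_damp_score//; apply: eq_Rintegral => w _; rewrite mul1r.
rewrite (funext E); apply: cvg_expr; rewrite ger0_norm; first exact: damp_lt1.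
by apply: Rintegral_ge0 => w _; exact: expR_ge0.
Qed.

Lemma score_ratio_limit :
  \int[P]_w (let r := S_ n w / M_ n w in r / (c ^+ 2 + (s * r) ^+ 2)) @[n --> \oo] -->
  Pr / (cos (b * a) ^+ 2 + Pr ^+ 2 * sin (b * a) ^+ 2).
Proof.
have pq x : `|score psi x| <= score_norm psi x by [].
have Hd : forall e, 0 < e -> exists2 dl, 0 < dl & forall t, 0 < t <= dl ->
     `|\int[P]_w residual c s k1 k2 t (score psi (Z0 w)) (score_norm psi (Z0 w))| <=
       e * \int[P]_w (score_norm psi (Z0 w) * expR (- (t * (c * score_norm psi (Z0 w))))) /\
     `|\int[P]_w residual2 c s k1 k2 t (score psi (Z0 w)) (score_norm psi (Z0 w))| <=
       e * \int[P]_w (score_norm psi (Z0 w) * expR (- (t * (c * score_norm psi (Z0 w))))).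
  exact: small_residuals.
have L := self_normalized_limit indZ lawZ pq c01 s1 Hd damp_lt1.
have mS n : measurable_fun setT (S_ n).
  by apply: measurable_sum => j; apply: measurableT_comp; exact: measurable_funPT.
have mM n : measurable_fun setT (M_ n).
  by apply: measurable_sum => j; apply: measurableT_comp; exact: measurable_funPT.
have SM n w : `|S_ n w| <= M_ n w.
  by apply: le_trans (ler_norm_sum _ _ _) _; apply: ler_sum.
have M0 n w : 0 <= M_ n w by exact: le_trans (normr_ge0 _) (SM n w).
have cs1 : c ^+ 2 + s ^+ 2 = 1 by exact: cos2Dsin2.
pose f n w := let r := S_ n w / M_ n w in r / (c ^+ 2 + (s * r) ^+ 2).
(* Where M > 0 the left side is 0, because c^2 + s^2 = 1 makes the real part of Omega / Theta equal
   to the kernel. Where M = 0 both [f] and [m1] are 0 by convention, and the error k1 is covered by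
   the exponential, which equals 1. *)
have fE n w : `|f n w - k1 - m1 c s k1 k2 (S_ n w) (M_ n w)| <= `|k1| * expR (- (c * M_ n w)).
  rewrite /f /=; have [Mz|Mn] := eqVneq (M_ n w) 0.
    have S0 : S_ n w = 0 by apply/eqP; rewrite -normr_le0 -Mz.
    rewrite /m1 /L1 /L2 Mz S0 !(mulr0, mul0r, invr0, subr0, addr0) oppr0 expR0 mulr1.
    by rewrite sub0r normrN.
  have N0 : sqnorm c s (S_ n w) (M_ n w) != 0.
    rewrite gt_eqF//; apply: lt_le_trans (sqnorm_ge c s (S_ n w) (M_ n w)).
    by rewrite exprn_even_gt0//= mulf_neq0// gt_eqF.
  rewrite [X in `|X|](_ : _ = 0) ?normr0 ?mulr_ge0 ?expR_ge0//.
  have E1 : m1 c s k1 k2 (S_ n w) (M_ n w) = S_ n w * M_ n w / sqnorm c s (S_ n w) (M_ n w) - k1.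
    rewrite -[X in _ - X](mulfK N0) -mulrBl /m1; congr (_ / _).
    by rewrite -(mul1r (S_ n w * M_ n w)) -cs1 /L1 /L2 /sqnorm; ring.
  have E2 : c ^+ 2 + (s * (S_ n w / M_ n w)) ^+ 2 = sqnorm c s (S_ n w) (M_ n w) / M_ n w ^+ 2.
    by rewrite /sqnorm; field.
  rewrite E1 E2 invfM invrK.
  by move: N0; set N := sqnorm _ _ _ _ => N0; field; rewrite ?Mn ?N0.
have mf n : measurable_fun setT (f n).
  have mr : measurable_fun setT (fun w => S_ n w / M_ n w).
    apply: measurable_funM; first exact: mS.
    by apply: (measurableT_comp measurable_inv); exact: mM.
  apply: measurable_funM => //; apply: (measurableT_comp measurable_inv).
  apply: measurable_funD => //; apply: measurable_funX; exact: measurable_funM.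
have mm1 n := measurable_m1 c s k1 k2 (mS n) (mM n).
have im1 n : P.-integrable setT (EFin \o (fun w => m1 c s k1 k2 (S_ n w) (M_ n w))).
  apply: (@bounded_integrable _ _ _ P _ _ (mm1 n)) => w.
  by have [h1 _] := m12_bound k1 k2 c01 s1 (SM n w); exact: h1.
have ie n : P.-integrable setT (EFin \o (fun w => expR (- (c * M_ n w)))).
  apply: (@bounded_integrable _ _ _ P _ 1).
    apply: (measurableT_comp (@measurable_expR R)).
    by apply: measurableT_comp => //; apply: measurable_funM.
  move=> w; rewrite ger0_norm ?expR_ge0// -[leRHS]expR0 ler_expR oppr_le0.
  by rewrite mulr_ge0// ltW.
have ifm n : P.-integrable setT (EFin \o (fun w => f n w - k1 - m1 c s k1 k2 (S_ n w) (M_ n w))).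
  apply: (@le_Rintegrable _ _ _ P setT _ (fun w => `|k1| * expR (- (c * M_ n w)))) => //.
    by apply: measurable_funB => //; apply: measurable_funB.
  exact: RintegrableZ.
have ik : P.-integrable setT (EFin \o (fun=> k1)) by apply: (@bounded_integrable _ _ _ P _ `|k1|).
have fI n : \int[P]_w f n w - k1 = \int[P]_w (f n w - k1 - m1 c s k1 k2 (S_ n w) (M_ n w)) +
    \int[P]_w m1 c s k1 k2 (S_ n w) (M_ n w).
  rewrite -RintegralD//.
  rewrite -{1}(Rintegral_cstT P k1) -RintegralB//.
    by apply: eq_Rintegral => w _; ring.
  rewrite (_ : f n = fun w => (f n w - k1 - m1 c s k1 k2 (S_ n w) (M_ n w)) +
      (m1 c s k1 k2 (S_ n w) (M_ n w) + k1)); last by apply/funext => w; ring.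
  by apply: RintegrableD => //; exact: RintegrableD.
have B n : `|\int[P]_w (f n w - k1 - m1 c s k1 k2 (S_ n w) (M_ n w))| <=
    `|k1| * \int[P]_w expR (- (c * M_ n w)).
  rewrite -RintegralZl//; apply: ler_norm_Rintegral => //.
  - by apply: measurable_funB => //; apply: measurable_funB.
  - exact: RintegrableZ.
have L2 : \int[P]_w (f n w - k1 - m1 c s k1 k2 (S_ n w) (M_ n w)) @[n --> \oo] --> 0.
  apply: norm_cvg0; apply: (@squeeze_cvgr _ _ _ _ (cst 0) (fun n => `|k1| * \int[P]_w expR (- (c * M_ n w)))).
  - by apply: nearW => n; rewrite normr_ge0/= B.
  - exact: cvg_cst.
  - by rewrite -[X in _ --> X](mulr0 `|k1|); apply: cvgM; [exact: cvg_cst|exact: damp_score_cvg0].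
apply/subr_cvg0; rewrite (funext fI) -[X in _ --> X](addr0 0); apply: cvgD; [exact: L2|exact: L].
Qed.

End LimitK.

(** * Integration of the kernel in the angle *)

Section MeanAtan.
Context d (T : measurableType d) (R : realType) (P : probability T R).
Notation mu := (@lebesgue_measure R).

Definition atan_kernel (a r : R) : R := r / (cos a ^+ 2 + (sin a * r) ^+ 2).

Lemma is_derive_atan_tan (r a : R) : cos a != 0 ->
  is_derive a 1 (fun x => atan (r * tan x)) (atan_kernel a r).
Proof.
move=> ca.
have -> : (fun x => atan (r * tan x)) = (fun x => atan (r * (sin x / cos x))) by [].
have CS := cos2Dsin2 a.
have D0 : cos a ^+ 2 + (sin a * r) ^+ 2 != 0.
  by rewrite gt_eqF// ltr_pwDl ?sqr_ge0// exprn_even_gt0.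
have -> : atan_kernel a r = r * (cos a ^+ 2 + sin a ^+ 2) / (cos a ^+ 2 + (sin a * r) ^+ 2).
  by rewrite CS mulr1.
apply: has_derivW; first by derive.
by rewrite /=; field; rewrite ca /= D0.
Qed.

Lemma atan_kernel_bound (a c r : R) : 0 < c -> c <= cos a -> `|r| <= 1 ->
  `|atan_kernel a r| <= (c ^+ 2)^-1.
Proof.
move=> c0 ca r1; have c2 : 0 < c ^+ 2 by rewrite exprn_gt0.
have D : c ^+ 2 <= cos a ^+ 2 + (sin a * r) ^+ 2.
  apply: (@le_trans _ _ (cos a ^+ 2)); last by rewrite lerDl sqr_ge0.
  by rewrite lerXn2r// nnegrE ltW//; apply: lt_le_trans ca.
have D0 := lt_le_trans c2 D.
rewrite normrM normfV (gtr0_norm D0) -[leRHS]mul1r ler_pM ?invr_ge0 ?(ltW D0)//.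
by rewrite lef_pV2.
Qed.

Lemma continuous_atan_kernel (a r : R) : cos a != 0 -> {for a, continuous (atan_kernel^~ r)}.
Proof.
move=> ca; apply: has_deriv_continuous; derive.
by rewrite gt_eqF// ltr_pwDl ?sqr_ge0// exprn_even_gt0.
Qed.

Lemma measurable_atan_kernel (a : R) (f : T -> R) : measurable_fun setT f ->
  measurable_fun setT (fun w => atan_kernel a (f w)).
Proof.
move=> mf; apply: measurable_funM => //; apply: (measurableT_comp measurable_inv).
by apply: measurable_funD => //; apply: measurable_funX; exact: measurable_funM.
Qed.

Lemma cos_lower_bound (a1 x : R) : 0 <= a1 < pi / 2 -> `|x| < a1 -> cos a1 <= cos x.
Proof.
move=> /andP[a0 a1p] xa; have p0 := pi_gt0 R.
have -> : cos x = cos `|x| by have [x0|x0] := ger0P x => //; rewrite cosN.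
have x0 := normr_ge0 x.
by rewrite ltW// ltr_cos ?in_itv//=; apply/andP; split; lra.
Qed.

Variables (r : T -> R).
Hypothesis mr : measurable_fun setT r.
Hypothesis r1 : forall w, `|r w| <= 1.

Let mean_kernel a := \int[P]_w atan_kernel a (r w).
Let mean_atan a := \int[P]_w atan (r w * tan a).

Lemma matan (k : R) : measurable_fun setT (fun w => atan (r w * k)).
Proof.
have mk : measurable_fun setT (fun w => r w * k) by exact: measurable_funM.
by apply: (measurableT_comp _ mk); apply: continuous_measurable_fun; exact: continuous_atan.
Qed.

Lemma atan_bounded (x : R) : `|atan x| <= pi / 2.
Proof. by rewrite ler_norml ltW ?atan_gtNpi2// ltW// atan_ltpi2. Qed.

Lemma integrable_atan (k : R) : P.-integrable setT (EFin \o (fun w => atan (r w * k))).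
Proof.
by apply: (@bounded_integrable _ _ _ P _ (pi / 2)) => [|w]; [exact: matan|exact: atan_bounded].
Qed.

Lemma mean_atan_FTC (a : R) : 0 < a < pi / 2 ->
  {within `[0, a], continuous mean_kernel} /\
  (\int[mu]_(x in `[0%R, a]) (mean_kernel x)%:E = (mean_atan a)%:E)%E.
Proof.
(* The midpoint between a and pi/2 leaves a margin around [0, a] on which the cosine is at least cos
   a1 > 0, so one constant dominates the kernel for all nearby angles. *)
move=> /andP[a0 ap]; pose a1 := (a + pi / 2) / 2.
have aa1 : a < a1 by rewrite /a1; lra.
have a1p : 0 <= a1 < pi / 2 by apply/andP; split; rewrite /a1; lra.
have a10 : 0 < a1 by lra.
have p0 := pi_gt0 R.
have c0 : 0 < cos a1.
  by have /andP[? ?] := a1p; apply: cos_gt0_pihalf; apply/andP; split; lra.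
have cn x : `|x| < a1 -> cos x != 0.
  by move=> xa; rewrite gt_eqF// (lt_le_trans c0)// cos_lower_bound.
have ib (C : R) : P.-integrable setT (EFin \o (fun=> C)).
  by apply: (@bounded_integrable _ _ _ P _ `|C|).
have dm (x : R) : `|x| <= a -> is_derive x 1 mean_atan (mean_kernel x).
  move=> xa; pose e := a1 - a.
  have e0 : 0 < e by rewrite subr_gt0.
  have near_x y : `|y - x| < e -> `|y| < a1.
    move=> yx; have -> : y = (y - x) + x by rewrite subrK.
    by apply: le_lt_trans (ler_normD _ _) _; rewrite /e in yx; lra.
  have D y w : `|y - x| < e -> setT w ->
      is_derive y 1 (fun z => atan (r w * tan z)) (atan_kernel y (r w)).
    by move=> yx _; apply: is_derive_atan_tan; apply: cn; exact: near_x.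
  apply: (@is_derive_Rintegral _ _ _ P (fun y w => atan (r w * tan y))
    (fun y w => atan_kernel y (r w)) setT (fun=> (cos a1 ^+ 2)^-1) x e _ e0 _ D) => //.
  - by move=> y _; exact: integrable_atan.
  - move=> y w yx _; apply: atan_kernel_bound => //.
    by apply: cos_lower_bound => //; exact: near_x.
have cm : {in `]- a1, a1[, continuous mean_kernel}.
  have mI : forall x, `]- a1, a1[%classic x -> `|x| < a1.
    by move=> x; rewrite /= in_itv/= => /andP[? ?]; rewrite ltr_norml; apply/andP.
  have := @continuity_under_integral R _ T P (fun x w => atan_kernel x (r w)) setT measurableT
    (- a1) a1 _ _ (fun=> (cos a1 ^+ 2)^-1) (ib _) _.
  move=> H x xI; apply: H; rewrite ?inE//.
  - move=> y yI; apply: (@bounded_integrable _ _ _ P _ (cos a1 ^+ 2)^-1).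
      exact: measurable_atan_kernel.
    move=> w; apply: atan_kernel_bound => //; apply: cos_lower_bound => //; exact: mI.
  - apply: aeW => w _ y /set_mem yI; apply: continuous_atan_kernel; apply: cn; exact: mI.
  - move=> y yI; apply: aeW => w _; apply: atan_kernel_bound => //.
    by apply: cos_lower_bound => //; exact: mI.
have cw : {within `[0, a], continuous mean_kernel}.
  apply: continuous_in_subspaceT => x /set_mem/=; rewrite in_itv/= => /andP[x0 xa].
  by apply: cm; rewrite in_itv/=; apply/andP; split; lra.
split => //.
have g0 : mean_atan 0 = 0.
  rewrite /mean_atan -[RHS](Rintegral_cstT P 0); apply: eq_Rintegral => w _.
  by rewrite tan0 mulr0 atan0.
have na x : 0 <= x <= a -> `|x| <= a by move=> /andP[x0 xa]; rewrite ger0_norm.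
rewrite (@continuous_FTC2 _ _ mean_atan) ?g0 ?sube0//.
- split.
  + move=> x; rewrite in_itv/= => /andP[x0 xa].
    by have [] := dm x (na x _); rewrite ?(ltW x0) ?(ltW xa).
  + by apply: cvg_at_right_filter; apply: (has_deriv_continuous (dm 0 _)); rewrite normr0 ltW.
  + by apply: cvg_at_left_filter; apply: (has_deriv_continuous (dm a _)); rewrite gtr0_norm.
- move=> x; rewrite in_itv/= => /andP[x0 xa].
  by apply: is_derive_derive1; apply: dm; apply: na; rewrite !ltW.
Qed.

End MeanAtan.

Section MeanAtanLimit.
Context d (T : measurableType d) (R : realType) (P : probability T R).
Notation mu := (@lebesgue_measure R).
Variables (r : nat -> T -> R) (p b : R).
Hypothesis mr : forall n, measurable_fun setT (r n).
Hypothesis r1 : forall n w, `|r n w| <= 1.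
Hypothesis b01 : 0 < b < 1.
Hypothesis lim : forall a, 0 <= a < pi / 2 ->
  \int[P]_w atan_kernel a (r n w) @[n --> \oo] -->
  p / (cos (b * a) ^+ 2 + p ^+ 2 * sin (b * a) ^+ 2).

(** The limiting kernel is the derivative of b^-1 atan (p tan (b x)), where b < 1 keeps b x below
    pi/2. Dominated convergence in the angle uses the constant (cos a)^-2, valid on all of
    [0, a]. *)
Lemma mean_atan_limit (a : R) : 0 <= a < pi / 2 ->
  \int[P]_w atan (r n w * tan a) @[n --> \oo] --> b^-1 * atan (p * tan (b * a)).
Proof.
move=> /andP[]; rewrite le_eqVlt => /predU1P[<- _|a0 ap].
  rewrite mulr0 tan0 mulr0 atan0 mulr0; apply: cvg_near_cst; apply: nearW => n.
  rewrite -[RHS](Rintegral_cstT P 0); apply: eq_Rintegral => w _; by rewrite mulr0 atan0.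
have aI : 0 < a < pi / 2 by rewrite a0.
have p0 := pi_gt0 R; have /andP[b0 b1] := b01.
have FT n := mean_atan_FTC P (mr n) (r1 n) aI.
pose k x := p / (cos (b * x) ^+ 2 + p ^+ 2 * sin (b * x) ^+ 2).
have cb x : 0 <= x <= a -> 0 < cos (b * x).
  move=> /andP[x0 xa]; apply: cos_gt0_pihalf; have bx : 0 <= b * x by rewrite mulr_ge0// ltW.
  have bxx : b * x <= x by rewrite ler_piMl// ltW.
  by apply/andP; split; lra.
have D0 x : 0 <= x <= a -> cos (b * x) ^+ 2 + p ^+ 2 * sin (b * x) ^+ 2 != 0.
  by move=> xI; rewrite gt_eqF// ltr_pwDl ?exprn_gt0 ?cb// mulr_ge0 ?sqr_ge0.
have dk (x : R) : 0 <= x <= a -> is_derive x 1 (fun y => b^-1 * atan (p * tan (b * y))) (k x).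
  move=> xI; have cx := cb x xI; have Dx := D0 x xI.
  have -> : (fun y => b^-1 * atan (p * tan (b * y))) =
    (fun y => b^-1 * atan (p * (sin (b * y) / cos (b * y)))) by [].
  have CS := cos2Dsin2 (b * x).
  have -> : k x = p * (cos (b * x) ^+ 2 + sin (b * x) ^+ 2) / (cos (b * x) ^+ 2 + p ^+ 2 * sin (b * x) ^+ 2).
    by rewrite CS mulr1.
  apply: has_derivW; first by derive; rewrite gt_eqF.
  have Dx' : cos (b * x) ^+ 2 + (p * sin (b * x)) ^+ 2 != 0 by rewrite exprMn.
  by rewrite /=; field; rewrite ?Dx ?Dx' ?(gt_eqF cx) ?(gt_eqF b0).
have cks (x : R) : 0 <= x <= a -> {for x, continuous k}.
  by move=> xI; apply: has_deriv_continuous; derive; exact: D0.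
have FTk : (\int[mu]_(x in `[0%R, a]) (k x)%:E = (b^-1 * atan (p * tan (b * a)))%:E)%E.
  have ni x : x \in `]0, a[ -> 0 <= x <= a by rewrite in_itv/= => /andP[? ?]; rewrite !ltW.
  rewrite (@continuous_FTC2 _ _ (fun y => b^-1 * atan (p * tan (b * y)))) ?mulr0 ?tan0 ?mulr0 ?atan0 ?mulr0 ?sube0//.
  - by apply: continuous_in_subspaceT => x /set_mem/=; rewrite in_itv/=; exact: cks.
  - split.
    + by move=> x /ni xI; have [] := dk x xI.
    + apply: cvg_at_right_filter; apply: (has_deriv_continuous (dk 0 _)).
      by rewrite lexx ltW.
    + apply: cvg_at_left_filter; apply: (has_deriv_continuous (dk a _)).
      by rewrite lexx ltW.
  - by move=> x /ni xI; apply: is_derive_derive1; exact: dk.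
have gE n : \int[P]_w atan (r n w * tan a) = \int[mu]_(x in `[0%R, a]) \int[P]_w atan_kernel x (r n w).
  by have [_ E] := FT n; rewrite [RHS]/Rintegral E.
rewrite (funext gE).
have -> : b^-1 * atan (p * tan (b * a)) = \int[mu]_(x in `[0%R, a]) k x by rewrite /Rintegral FTk.
have ca : 0 < cos a by apply: cos_gt0_pihalf; apply/andP; split; lra.
have ca2 : 0 < (cos a ^+ 2)^-1 by rewrite invr_gt0 exprn_gt0.
have mI : measurable (`[0%R, a]%classic : set (measurableTypeR R)) by exact: measurable_itv.
apply: (@Rintegral_cvg _ _ _ mu `[0%R, a] _ k (fun=> (cos a ^+ 2)^-1) mI _ _ _ _).2.
- move=> n; have [cw _] := FT n; exact: subspace_continuous_measurable_fun.
- apply: measurable_bounded_integrable => //.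
    by rewrite /= lebesgue_measure_itv/= lte_fin a0 -EFinB ltry.
  by exists (cos a ^+ 2)^-1; split; [exact: num_real|move=> M CM x _ /=; rewrite gtr0_norm// ltW].
- move=> n x; rewrite /= in_itv/= => /andP[x0 xa].
  rewrite -[leRHS](Rintegral_cstT P); apply: ler_norm_Rintegral => //.
  + exact: measurable_atan_kernel.
  + by apply: (@bounded_integrable _ _ _ P _ `|(cos a ^+ 2)^-1|).
  + move=> w _; apply: atan_kernel_bound => //.
    move: xa; rewrite le_eqVlt => /predU1P[->//|xa].
    by apply: cos_lower_bound; rewrite ?(ltW a0)// ger0_norm.
- move=> x; rewrite /= in_itv/= => /andP[x0 xa].
  by apply: lim; rewrite x0 (le_lt_trans xa).
Qed.

End MeanAtanLimit.

(** * Skewed scores and the upper bound for the probability of a nonnegative sum *)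

Section Skew.
Context {R : realType} (phi : {mfun R >-> R}) (l : R).

Definition skew x : R := l * pospart phi x - negpart phi x.

Let mskew : measurable_fun setT skew.
Proof.
by apply: measurable_funB; last (exact: measurable_funPT); apply: measurable_funM => //; exact: measurable_funPT.
Qed.

HB.instance Definition _ := isMeasurableFun.Build _ _ _ _ skew mskew.

Lemma pos_neg_parts x : (pospart phi x = phi x /\ negpart phi x = 0 /\ 0 <= phi x) \/
  (pospart phi x = 0 /\ negpart phi x = - phi x /\ phi x < 0).
Proof.
rewrite /pospart /negpart; have [p0|] := boolP (0 <= phi x); last rewrite -ltNge => p0.
  by left; rewrite max_l// max_r// oppr_le0.
by right; rewrite max_r ?(ltW p0)// max_l// oppr_ge0 ltW.
Qed.

Lemma score_parts z : score phi z = score (pospart phi) z - score (negpart phi) z.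
Proof. by rewrite /score /=; case: (pos_neg_parts z.1) => -[-> [-> _]]; ring. Qed.

Lemma score_pospart_ge0 z : 0 <= score (pospart phi) z.
Proof. by rewrite /score mulr_ge0 ?pospart_ge0// le_max lexx orbT. Qed.

Lemma score_negpart_ge0 z : 0 <= score (negpart phi) z.
Proof. by rewrite /score mulr_ge0 ?negpart_ge0// le_max lexx orbT. Qed.

Lemma score_skew z : score skew z = l * score (pospart phi) z - score (negpart phi) z.
Proof. by rewrite /score /= /skew; ring. Qed.

Hypothesis l0 : 0 < l.

Lemma pospart_skew x : pospart skew x = l * pospart phi x.
Proof.
have -> : pospart skew x = Num.max (l * pospart phi x - negpart phi x) 0 by [].
case: (pos_neg_parts x) => -[-> [-> p0]].
  by rewrite subr0 max_l// mulr_ge0// ltW.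
by rewrite mulr0 sub0r opprK max_r// ltW.
Qed.

Lemma negpart_skew x : negpart skew x = negpart phi x.
Proof.
have -> : negpart skew x = Num.max (- (l * pospart phi x - negpart phi x)) 0 by [].
case: (pos_neg_parts x) => -[-> [-> p0]].
  by rewrite subr0 max_r// oppr_le0 mulr_ge0// ltW.
by rewrite mulr0 sub0r !opprK max_l// oppr_ge0 ltW.
Qed.

Lemma norm_skew x : `|skew x| = l * pospart phi x + negpart phi x.
Proof.
rewrite /skew; case: (pos_neg_parts x) => -[-> [-> p0]].
  by rewrite subr0 addr0 ger0_norm// mulr_ge0// ltW.
by rewrite mulr0 sub0r add0r opprK ltr0_norm.
Qed.

Lemma score_norm_skew z :
  score_norm skew z = l * score (pospart phi) z + score (negpart phi) z.
Proof.
rewrite /score_norm {1}/score normrM norm_skew ger0_norm ?le_max ?lexx ?orbT//.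
by rewrite /score /=; ring.
Qed.

End Skew.

Section Squeeze.
Context {R : realType}.

(* Skewing the positive part by l > 1 turns A >= B into a uniform lower bound on the ratio. *)
Lemma step_le_atan (l N A B : R) : 1 < l -> 0 < N -> 0 <= A -> 0 <= B ->
  ((B <= A)%R%:R - expR (- (l * A + B))) * (pi / 2 + atan ((l - 1) / (l + 1) * N)) <=
  pi / 2 + atan ((l * A - B) / (l * A + B) * N).
Proof.
move=> l1 N0 A0 B0; have lt := atan_gtNpi2 ((l * A - B) / (l * A + B) * N).
have k0 := atan_gtNpi2 ((l - 1) / (l + 1) * N).
have r0 : 0 <= pi / 2 + atan ((l * A - B) / (l * A + B) * N) by lra.
have e0 := expR_gt0 (- (l * A + B)).
have [BA|AB] := leP B A; last first.
  by apply: le_trans r0; rewrite mulr0n sub0r mulNr oppr_le0 mulr_ge0//; lra.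
have lA : 0 <= l * A by rewrite mulr_ge0//; lra.
have : 0 <= l * A + B by rewrite addr_ge0.
(* If l A + B = 0 the ratio is a default 0 and gives no lower bound; the subtracted exponential
   equals 1 there and cancels the indicator. *)
rewrite le_eqVlt => /predU1P[Z|M0].
  by rewrite -Z in r0 *; rewrite oppr0 expR0 subrr mul0r.
apply: (@le_trans _ _ (pi / 2 + atan ((l - 1) / (l + 1) * N))).
  by rewrite mulr1n ler_piMl; lra.
(* For A >= B the ratio is smallest at A = B. *)
have : (l - 1) / (l + 1) * N <= (l * A - B) / (l * A + B) * N.
  have lp : 0 < l + 1 by lra.
  rewrite ler_wpM2r ?(ltW N0)// ler_pdivrMr// mulrAC ler_pdivlMr//; nra.
by rewrite lerD2l => /le_atan.
Qed.

Lemma step_probability_le d (T : measurableType d) (P : probability T R) (A B : T -> R) (l N : R) :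
  measurable_fun setT A -> measurable_fun setT B -> (forall w, 0 <= A w) -> (forall w, 0 <= B w) ->
  1 < l -> 0 < N -> fine (P [set w | B w <= A w]) <=
  (pi / 2 + atan ((l - 1) / (l + 1) * N))^-1 *
    (pi / 2 + \int[P]_w atan ((l * A w - B w) / (l * A w + B w) * N)) +
  \int[P]_w expR (- (l * A w + B w)).
Proof.
move=> mA mB A0 B0 l1 N0; set kap := pi / 2 + atan _; set E := [set w | _].
have kap0 : 0 < kap.
  by have := atan_gtNpi2 ((l - 1) / (l + 1) * N); rewrite /kap; lra.
have l0 : 0 < l by lra.
have mM : measurable_fun setT (fun w => l * A w + B w).
  by apply: measurable_funD => //; exact: measurable_funM.
have mr : measurable_fun setT (fun w => (l * A w - B w) / (l * A w + B w)).
  apply: measurable_funM; last exact: (measurableT_comp measurable_inv).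
  by apply: measurable_funB => //; exact: measurable_funM.
have mE : measurable E.
  have -> : E = (fun w => A w - B w) @^-1` `[0, +oo[.
    by apply/seteqP; split => w; rewrite /E/= in_itv/= andbT subr_ge0.
  by rewrite -[X in measurable X]setTI; exact: measurable_funB.
have ie : P.-integrable setT (EFin \o (fun w => expR (- (l * A w + B w)))).
  apply: (@bounded_integrable _ _ _ P _ 1).
    by apply: (measurableT_comp (@measurable_expR R)); exact: measurableT_comp.
  move=> w; rewrite ger0_norm ?expR_ge0// -[leRHS]expR0 ler_expR oppr_le0.
  by rewrite addr_ge0// mulr_ge0// ltW.
have i1 : P.-integrable setT (EFin \o (\1_E : T -> R)).
  apply: (@bounded_integrable _ _ _ P _ 1) => // w.
  by rewrite indicE; case: (_ \in _) => /=; rewrite ?normr1 ?normr0.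
have ia := integrable_atan P mr N.
have ip : P.-integrable setT (EFin \o (fun=> pi / 2)).
  by apply: (@bounded_integrable _ _ _ P _ `|pi / 2|).
pose D w := \1_E w - expR (- (l * A w + B w)).
have iD : P.-integrable setT (EFin \o D).
  by rewrite /comp /D; under eq_fun do rewrite EFinB; exact: integrableB.
have -> : fine (P E) = \int[P]_w D w + \int[P]_w expR (- (l * A w + B w)).
  by rewrite /D RintegralB// subrK Rintegral_indic.
rewrite lerD2r ler_pdivlMl// -RintegralZl//.
have -> : pi / 2 + \int[P]_w atan ((l * A w - B w) / (l * A w + B w) * N) =
    \int[P]_w (pi / 2 + atan ((l * A w - B w) / (l * A w + B w) * N)).
  by rewrite RintegralD// Rintegral_cstT.
apply: le_Rintegral => //; [exact: RintegrableZ|exact: RintegrableD|].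
move=> w _; rewrite /D mulrC.
rewrite (_ : \1_E w = (B w <= A w)%R%:R); first exact: step_le_atan.
rewrite indicE; congr (nat_of_bool _)%:R.
by apply/idP/idP => [/set_mem//|h]; exact/mem_set.
Qed.

End Squeeze.

Section UpperBound.
Context d (T : measurableType d) (R : realType) (P : probability T R).
Variables (X Y : {mfun T >-> R}) (Xs Ys : nat -> {mfun T >-> R}).
Hypothesis XY : independent_rv P X Y.
Hypothesis iid : iid_copies P (fun w => (X w, Y w)) (fun i w => (Xs i w, Ys i w)).
Variables (b dlt : R).
Hypothesis bI : 0 < b < dlt.
Hypothesis d1 : dlt < 1.
Let G y := fine (P [set w | y < Y w]).
Hypothesis Gpos : forall y, 0 < G y.
Hypothesis Grv : forall t, 0 < t -> G (t * y) / G y @[y --> +oo] --> t `^ (- b).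
Variable phi : {mfun R >-> R}.
Hypothesis phi_int : P.-integrable setT (EFin \o (fun w => `|phi (X w)| `^ dlt)).

Let cp := \int[P]_w (pospart phi (X w) `^ b).
Let cm := \int[P]_w (negpart phi (X w) `^ b).
Hypothesis cpm : 0 < cp + cm.

Let Z j := mfun_pair (Xs j) (Ys j).

Let cp0 : 0 <= cp. Proof. by apply: Rintegral_ge0 => w _; exact: powR_ge0. Qed.
Let cm0 : 0 <= cm. Proof. by apply: Rintegral_ge0 => w _; exact: powR_ge0. Qed.

Let pI : 0 < pi / 2 :> R. Proof. by rewrite divr_gt0// pi_gt0. Qed.

Section FixedSkew.
Variables (l N : R).
Hypotheses (l1 : 1 < l) (N0 : 0 < N).
Let psi := skew phi l.
Let l0 : 0 < l. Proof. by apply: lt_trans l1. Qed.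

Let int_dlt (f : {mfun R >-> R}) C : 0 <= C -> (forall x, `|f x| <= C * `|phi x|) ->
  P.-integrable setT (EFin \o (fun w => `|f (X w)| `^ dlt)).
Proof.
move=> C0 fC; have /andP[b0 bd] := bI; have dp := lt_trans b0 bd.
apply: (@le_Rintegrable _ _ _ P setT _ (fun w => C `^ dlt * `|phi (X w)| `^ dlt)) => //.
- apply: (measurableT_comp (measurable_powR dlt)); apply: measurableT_comp => //.
  by apply: (measurableT_comp (measurable_funPT f)); exact: measurable_funPT.
- move=> w _; rewrite ger0_norm ?powR_ge0// -powRM//.
  by apply: ge0_ler_powR => //; rewrite ?nnegrE ?mulr_ge0// ltW.
- exact: RintegrableZ.
Qed.

Let psi_int : P.-integrable setT (EFin \o (fun w => `|psi (X w)| `^ dlt)).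
Proof.
apply: (@int_dlt psi l); first exact: ltW.
move=> x; rewrite norm_skew//; case: (pos_neg_parts phi x) => -[-> [-> p0]].
  by rewrite addr0 ger0_norm.
rewrite mulr0 add0r ltr0_norm//; rewrite ler_peMl// ?oppr_ge0 ltW//.
Qed.

Let pos_int : P.-integrable setT (EFin \o (fun w => pospart phi (X w) `^ b)).
Proof.
apply: (integrable_powR bI).
- by apply: (measurableT_comp (measurable_funPT (pospart phi))); exact: measurable_funPT.
- by move=> w; exact: pospart_ge0.
- rewrite [X in _ \o X](_ : _ = fun w => `|pospart phi (X w)| `^ dlt); last first.
    by apply/funext => w; rewrite ger0_norm ?pospart_ge0.
  apply: (@int_dlt (pospart phi) 1) => // x; rewrite mul1r; change (`|pospart phi x| <= `|phi x|).
  by case: (pos_neg_parts phi x) => -[-> _] //; rewrite normr0.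
Qed.

Let cpE : \int[P]_w (pospart psi (X w) `^ b) = l `^ b * cp.
Proof.
rewrite /cp -RintegralZl//; apply: eq_Rintegral => w _.
by rewrite pospart_skew// powRM ?pospart_ge0// ltW.
Qed.

Let cmE : \int[P]_w (negpart psi (X w) `^ b) = cm.
Proof. by apply: eq_Rintegral => w _; rewrite negpart_skew. Qed.

Let lb0 : 0 < l `^ b. Proof. exact: powR_gt0. Qed.

Let cpml : 0 < \int[P]_w (pospart psi (X w) `^ b) + \int[P]_w (negpart psi (X w) `^ b).
Proof. rewrite cpE cmE; move: cp0 cm0 cpm lb0; nra. Qed.

(** The constant p of the skewed score: skewing multiplies the weight of the positive part by l^b
    and keeps the other weight. *)
Definition skew_balance := (l `^ b * cp - cm) / (l `^ b * cp + cm).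

Let A n w := \sum_(j <- iota 0 n) score (pospart phi) (Z j w).
Let B n w := \sum_(j <- iota 0 n) score (negpart phi) (Z j w).
Let S n w := \sum_(j <- iota 0 n) score psi (Z j w).
Let M n w := \sum_(j <- iota 0 n) score_norm psi (Z j w).
Let r n w := S n w / M n w.

Let SE n w : S n w = l * A n w - B n w.
Proof. by rewrite /S /A /B mulr_sumr -sumrB; apply: eq_bigr => j _; rewrite score_skew. Qed.

Let ME n w : M n w = l * A n w + B n w.
Proof. by rewrite /M /A /B mulr_sumr -big_split/=; apply: eq_bigr => j _; rewrite score_norm_skew. Qed.

Let phiE n w : \sum_(j <- iota 0 n) score phi (Z j w) = A n w - B n w.
Proof. by rewrite /A /B -sumrB; apply: eq_bigr => j _; rewrite score_parts. Qed.

Let A0 n w : 0 <= A n w. Proof. by apply: sumr_ge0 => j _; exact: score_pospart_ge0. Qed.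
Let B0 n w : 0 <= B n w. Proof. by apply: sumr_ge0 => j _; exact: score_negpart_ge0. Qed.

Let msum (f : {mfun (R * R)%type >-> R}) n :
  measurable_fun setT (fun w => \sum_(j <- iota 0 n) f (Z j w)).
Proof. by apply: measurable_sum => j; apply: measurableT_comp; exact: measurable_funPT. Qed.

Let mr n : measurable_fun setT (r n).
Proof.
apply: measurable_funM; first exact: (msum (score psi)).
by apply: (measurableT_comp measurable_inv); exact: (msum (score_norm psi)).
Qed.

Let r1 n w : `|r n w| <= 1.
Proof.
have SM : `|S n w| <= M n w by apply: le_trans (ler_norm_sum _ _ _) _; exact: ler_sum.
have M0 := le_trans (normr_ge0 _) SM.
rewrite /r normrM normfV (ger0_norm M0).
move: M0; rewrite le_eqVlt => /predU1P[<-|M0]; first by rewrite invr0 mulr0.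
by rewrite ler_pdivrMr// mul1r.
Qed.

Let kap := pi / 2 + atan ((l - 1) / (l + 1) * N).

Let E n := [set w | 0 <= \sum_(j <- iota 0 n) score phi (Z j w)].

(** [cos 0] is left unevaluated so that the last term is literally the one in [damp_score_cvg0] at
    angle 0. *)
Let bound n : fine (P (E n)) <=
  kap^-1 * (pi / 2 + \int[P]_w atan (r n w * N)) + \int[P]_w expR (- (cos 0 * M n w)).
Proof.
have H := step_probability_le P (msum (score (pospart phi)) n) (msum (score (negpart phi)) n)
  (A0 n) (B0 n) l1 N0.
rewrite (_ : E n = [set w | B n w <= A n w]); last first.
  by apply/seteqP; split => w; rewrite /E/= phiE subr_ge0.
rewrite (_ : \int[P]_w atan (r n w * N) =
    \int[P]_w atan ((l * A n w - B n w) / (l * A n w + B n w) * N)); last first.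
  by apply: eq_Rintegral => w _; rewrite /r SE ME.
rewrite (_ : \int[P]_w expR (- (cos 0 * M n w)) = \int[P]_w expR (- (l * A n w + B n w))).
  exact: H.
by apply: eq_Rintegral => w _; rewrite cos0 mul1r ME.
Qed.

Lemma skew_bound e : 0 < e -> \forall n \near \oo, fine (P (E n)) <=
  kap^-1 * (pi / 2 + b^-1 * atan (skew_balance * tan (b * atan N))) + e.
Proof.
move=> e0; have b01 : 0 < b < 1 by have /andP[b0 bd] := bI; rewrite b0 (lt_trans bd).
have aI : 0 <= (0 : R) < pi / 2 by rewrite lexx.
have L1 := damp_score_cvg0 XY iid bI d1 Gpos Grv psi_int cpml aI.
have L2 := mean_atan_limit mr r1 b01 (@score_ratio_limit _ _ _ _ _ _ _ _ XY iid _ _ bI d1 Gpos Grv _ psi_int cpml).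
(* The limit theorem is used at the angle whose tangent is N. *)
have nI : 0 <= atan N < pi / 2.
  by rewrite atan_ltpi2 andbT -(@atan0 R) ltW// lt_atan.
have := L2 _ nI; rewrite atanK cpE cmE -/skew_balance => {}L2.
have L : kap^-1 * (pi / 2 + \int[P]_w atan (r n w * N)) + \int[P]_w expR (- (cos 0 * M n w)) @[n --> \oo] -->
    kap^-1 * (pi / 2 + b^-1 * atan (skew_balance * tan (b * atan N))) + 0.
  apply: cvgD; last exact: L1.
  apply: cvgM; first exact: cvg_cst.
  by apply: cvgD; [exact: cvg_cst|exact: L2].
rewrite addr0 in L.
near=> n; apply: le_trans (bound n) _; near: n.
by apply: (cvgr_le _ L); rewrite ltrDl.
Unshelve. all: by end_near. Qed.

End FixedSkew.

Let p := (cp - cm) / (cp + cm).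
Let balance l := skew_balance l.

(** Three limits in this order: n to infinity with l and N fixed, then N to infinity, where [kap]
    tends to pi and atan N to pi/2, then l to 1 from above, where [balance] tends to p. Backwards, l
    is chosen first, then N, then n, each at the cost of e / 3; [V] is the limit in N and [W] the
    limit in n. *)
Lemma nonneg_score_probability e : 0 < e -> \forall n \near \oo,
  fine (P [set w | 0 <= \sum_(j <- iota 0 n) score phi (Z j w)]) <=
  2^-1 + (pi * b)^-1 * atan (p * tan (pi * b / 2)) + e.
Proof.
move=> e0; have /andP[b0 bd] := bI; have b1 := lt_trans bd d1; have pp := pi_gt0 R.
pose t : R := tan (b * (pi / 2)).
have tE : tan (pi * b / 2) = t by rewrite /t; congr tan; ring.
have ct : cos (b * (pi / 2)) != 0.
  by rewrite gt_eqF//; apply: cos_gt0_pihalf; apply/andP; split; nra.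
pose V l := (pi / 2 + b^-1 * atan (balance l * t)) / pi.
have V1 : V 1 = 2^-1 + (pi * b)^-1 * atan (p * tan (pi * b / 2)).
  rewrite /V /balance /skew_balance powR1 !mul1r -/p tE.
  move: (atan _) (@pi R) pp => y q q0; field.
  by rewrite !gt_eqF.
have cV : V l @[l --> 1^'+] --> V 1.
  have cV1 : {for 1, continuous V}.
    rewrite /V /balance /skew_balance; apply: has_deriv_continuous; derive => //.
    by rewrite powR1 mul1r gt_eqF.
  by apply: cvg_at_right_filter; exact: cV1.
have [l l1 Vl] : exists2 l, 1 < l & V l < V 1 + e / 3.
  have : \forall l \near 1^'+, 1 < l /\ V l < V 1 + e / 3.
    near=> l; split; first by near: l; exact: nbhs_right_gt.
    by near: l; apply: (cvgr_lt _ cV); lra.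
  by move=> /filter_ex[l [? ?]]; exists l.
pose kap N := pi / 2 + atan ((l - 1) / (l + 1) * N).
pose W N := (kap N)^-1 * (pi / 2 + b^-1 * atan (balance l * tan (b * atan N))).
have k0 : 0 < (l - 1) / (l + 1) by apply: divr_gt0; lra.
have cW : W N @[N --> +oo] --> V l.
  have -> : V l = pi^-1 * (pi / 2 + b^-1 * atan (balance l * t)) by rewrite mulrC.
  have ck : kap N @[N --> +oo] --> pi.
    rewrite [X in _ --> X](_ : _ = pi / 2 + pi / 2); last by field.
    apply: cvgD; first exact: cvg_cst.
    apply: cvg_comp (@cvgy_atan R).
    apply/cvgryPge => A; near=> N.
    by rewrite -ler_pdivrMl//; near: N; apply: nbhs_pinfty_ge; exact: num_real.
  apply: cvgM; first by apply: cvgV => //; rewrite gt_eqF.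
  apply: cvgD; first exact: cvg_cst.
  apply: cvgM; first exact: cvg_cst.
  apply: continuous_cvg; first exact: continuous_atan.
  apply: cvgM; first exact: cvg_cst.
  apply: continuous_cvg; first exact: continuous_tan.
  by apply: cvgM; [exact: cvg_cst|exact: cvgy_atan].
have [N N0 WN] : exists2 N, 0 < N & W N < V l + e / 3.
  have : \forall N \near +oo, 0 < N /\ W N < V l + e / 3.
    near=> N; split; first by near: N; exact: nbhs_pinfty_gt.
    by near: N; apply: (cvgr_lt _ cW); lra.
  by move=> /filter_ex[N [? ?]]; exists N.
have e3 : 0 < e / 3 by lra.
have H := skew_bound l1 N0 e3.
near=> n; rewrite -V1; apply: (@le_trans _ _ (W N + e / 3)); last by lra.
by near: n; exact: H.
Unshelve. all: by end_near. Qed.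

End UpperBound.

(** * A random variable with a given cdf, and regular variation of the tail of Y *)

Section CdfRealization.
Context {R : realType} (F : R -> R).
Hypotheses (F_nd : nondecreasing F) (F_rc : right_continuous F).
Hypotheses (F_Ny : F @ -oo --> (0 : R)) (F_y : F @ +oo --> (1 : R)).

#[local] HB.instance Definition _ := isCumulative.Build R _ R F F_nd F_rc.
#[local] HB.instance Definition _ := isCumulativeBounded.Build R 0 1 F F_Ny F_y.

Let idTR : measurableTypeR R -> R := idfun.

#[local] HB.instance Definition _ :=
  @isMeasurableFun.Build _ _ _ _ idTR (@measurable_id _ _ setT).

Lemma exists_rv_cdf : exists (d' : measure_display) (Omega' : measurableType d')
  (P' : probability Omega' R) (T : {RV P' >-> R}), forall x, cdf T x = (F x)%:E.
Proof.
exists _, (measurableTypeR R), (lebesgue_stieltjes_measure F), idTR => x.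
exact: cdf_lebesgue_stieltjes_id.
Qed.

End CdfRealization.

Section RegularTail.
Context d (T : measurableType d) (R : realType) (P : probability T R).
Variables (Y : {RV P >-> R}) (b : R).
Hypothesis hD : in_D b Y.
Let G y := fine (P [set w | y < Y w]).

Let ccdfE y : ccdf Y y = P [set w | y < Y w].
Proof.
rewrite /ccdf /distribution /pushforward; congr (P _).
by apply/seteqP; split => w; rewrite /= in_itv/= andbT.
Qed.

Let G_le x y : x <= y -> G y <= G x.
Proof.
have mY z : measurable [set w | z < Y w] by apply: measurable_tail_set; exact: measurable_funPT.
move=> xy; rewrite fine_le ?fin_num_measure// le_measure ?inE//.
by move=> w /=; exact: le_lt_trans.
Qed.

(** L is known to be positive only far out; the tail is nonincreasing, so positivity there gives it
    everywhere. *)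
Lemma regular_tail_gt0 y : 0 < G y.
Proof.
have [L [[[A [_ Lp]] _] LE]] := hD.
pose m := Num.max y (Num.max A 1).
have m0 : 0 < m by rewrite !lt_max ltr01 !orbT.
apply: (@lt_le_trans _ _ (G m)); last by apply: G_le; rewrite le_max lexx.
by rewrite /G -ccdfE LE//= mulr_gt0 ?powR_gt0// Lp// !le_max lexx !orbT.
Qed.

Lemma regular_tail_ratio t : 0 < t -> G (t * y) / G y @[y --> +oo] --> t `^ (- b).
Proof.
move=> t0; have [L [[[A [_ Lp]] Lsv] LE]] := hD.
have : t `^ (- b) * (L (t * y) / L y) @[y --> +oo] --> t `^ (- b) * 1.
  by apply: cvgM; [exact: cvg_cst|exact: Lsv].
rewrite mulr1; apply: cvg_trans; apply: near_eq_cvg; near=> y.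
have y0 : 0 < y by near: y; exact: nbhs_pinfty_gt.
have yA : A <= y by near: y; apply: nbhs_pinfty_ge; exact: num_real.
have Ly := Lp y yA.
rewrite /G -!ccdfE !LE ?mulr_gt0//= powRM ?(ltW t0) ?(ltW y0)//.
have yb : 0 < y `^ (- b) by exact: powR_gt0.
by field; rewrite !gt_eqF.
Unshelve. all: by end_near. Qed.

End RegularTail.

(** * Convergence of the cdf of the weighted mean *)

Section AffineScore.
Context {R : realType} (s x : R).

(** With s = 1 and s = -1, the same upper bound serves for an event and for its complement. *)
Definition affine_score u : R := s * (x - u).

Let maff : measurable_fun setT affine_score.
Proof. by apply: measurable_funM => //; exact: measurable_funB. Qed.

HB.instance Definition _ := isMeasurableFun.Build _ _ _ _ affine_score maff.

End AffineScore.

Section Parts.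
Context {R : realType} (b : R).
Hypothesis b0 : b != 0.

Lemma powR_parts (t : R) : Num.max t 0 `^ b + Num.max (- t) 0 `^ b = `|t| `^ b.
Proof.
have [t0|] := boolP (0 <= t).
  by rewrite max_l// max_r ?oppr_le0// powR0// addr0 ger0_norm.
by rewrite -ltNge => t0; rewrite max_r ?(ltW t0)// max_l ?oppr_ge0 ?(ltW t0)// powR0// add0r ltr0_norm.
Qed.

Lemma powR_parts_sg (t : R) :
  Num.max t 0 `^ b - Num.max (- t) 0 `^ b = `|t| `^ b * Num.sg t.
Proof.
have [t0|] := boolP (0 < t).
  by rewrite max_l ?(ltW t0)// max_r ?oppr_le0 ?(ltW t0)// powR0// subr0 gtr0_norm// gtr0_sg// mulr1.
rewrite -leNgt => t0; rewrite max_r// max_l ?oppr_ge0// powR0// sub0r ler0_norm//.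
move: t0; rewrite le_eqVlt => /predU1P[->|t0]; first by rewrite oppr0 powR0// oppr0 mul0r.
by rewrite ltr0_sg// mulrN1.
Qed.

End Parts.

(** From u + v <= 2 max (u, v): crude, but valid for every exponent p >= 0 and enough for
    domination. *)
Lemma powR_add_le {R : realType} (p u v : R) : 0 <= p -> 0 <= u -> 0 <= v ->
  (u + v) `^ p <= (2 * u) `^ p + (2 * v) `^ p.
Proof.
move=> p0 u0 v0; wlog uv : u v u0 v0 / u <= v => [H|].
  by have [uv|/ltW uv] := leP u v; [exact: H|rewrite addrC [leRHS]addrC; exact: H].
apply: (@le_trans _ _ ((2 * v) `^ p)); last by rewrite lerDr powR_ge0.
by apply: ge0_ler_powR; rewrite ?nnegrE//; lra.
Qed.

Lemma ae_le_measure d (T : measurableType d) (R : realType) (mu : {measure set T -> \bar R})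
  (A B : set T) : measurable A -> measurable B -> {ae mu, forall w, A w -> B w} ->
  (mu A <= mu B)%E.
Proof.
move=> mA mB AB; have mD : measurable (A `\` B) by exact: measurableD.
have D0 : mu (A `\` B) = 0%E.
  apply: measure_negligible => //; apply: negligibleS AB => w [Aw nBw] /=.
  by move=> /(_ Aw).
rewrite -[leRHS]add0e -D0 -measureU//.
  apply: le_measure; rewrite ?inE//; first exact: measurableU.
  by move=> w Aw; have [Bw|nBw] := pselect (B w); [right|left].
by rewrite setDKI.
Qed.

Section WeightedMeanLimit.
Context d (T : measurableType d) (R : realType) (P : probability T R).
Variables (X Y : {RV P >-> R}) (Xs Ys : nat -> {RV P >-> R}) (b dlt : R).
Hypothesis XY : independent_rv P X Y.
Hypothesis Xnd : nondegenerate_rv P X.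
Hypothesis Y_ge0 : {ae P, forall w, 0 <= Y w}.
Hypothesis iid : iid_copies P (fun w => (X w, Y w)) (fun i w => (Xs i w, Ys i w)).
Hypothesis bI : 0 < b < dlt.
Hypothesis d1 : dlt < 1.
Hypothesis YD : in_D b Y.
Hypothesis X_int : P.-integrable setT (EFin \o (fun w => `|X w| `^ dlt)).

Let b0 : 0 < b. Proof. by case/andP: bI. Qed.
Let bd : b < dlt. Proof. by case/andP: bI. Qed.

Let mX : measurable_fun setT (X : T -> R). Proof. exact: measurable_funPT. Qed.

Let mdist x p : measurable_fun setT (fun w => `|x - X w| `^ p).
Proof.
apply: (measurableT_comp (measurable_powR p)); apply: measurableT_comp => //.
exact: measurable_funB.
Qed.

Let X_int_b : P.-integrable setT (EFin \o (fun w => `|X w| `^ b)).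
Proof. by apply: (integrable_powR bI) => //; exact: measurableT_comp. Qed.

Let dist_bound x p c : 0 <= p -> `|x| <= c -> forall w,
  `|x - X w| `^ p <= (2 * c) `^ p + 2 `^ p * `|X w| `^ p.
Proof.
move=> p0 xc w; rewrite -powRM//; apply: le_trans (powR_add_le p0 _ _) => //.
  apply: ge0_ler_powR; rewrite ?nnegrE ?addr_ge0 ?(le_trans _ xc)//.
  by apply: le_trans (ler_normB _ _) _; rewrite lerD2r.
exact: le_trans xc.
Qed.

Let bound_int p c : P.-integrable setT (EFin \o (fun w => `|X w| `^ p)) ->
  P.-integrable setT (EFin \o (fun w => c + 2 `^ p * `|X w| `^ p)).
Proof.
move=> iX; apply: RintegrableD => //; last exact: RintegrableZ.
by apply: (@bounded_integrable _ _ _ P _ `|c|).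
Qed.

Let dist_int x p : 0 <= p -> P.-integrable setT (EFin \o (fun w => `|X w| `^ p)) ->
  P.-integrable setT (EFin \o (fun w => `|x - X w| `^ p)).
Proof.
move=> p0 iX; apply: (le_Rintegrable measurableT (mdist x p) _ (bound_int ((2 * `|x|) `^ p) iX)).
by move=> w _; rewrite ger0_norm ?powR_ge0//; exact: dist_bound.
Qed.

Definition abs_moment x := \int[P]_w (`|x - X w| `^ b).
Definition sgn_moment x := \int[P]_w (`|x - X w| `^ b * Num.sg (x - X w)).

(** A vanishing moment would force X = x almost surely, which nondegeneracy excludes; hence the
    denominator in the limit never vanishes. *)
Lemma abs_moment_gt0 x : 0 < abs_moment x.
Proof.
have h0 : 0 <= abs_moment x by apply: Rintegral_ge0 => w _; exact: powR_ge0.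
rewrite lt_neqAle h0 andbT; apply/negP => /eqP E; apply: Xnd; exists x.
have ii := dist_int x (ltW b0) X_int_b.
have I0 : (\int[P]_w `|(`|x - X w| `^ b)%:E| = 0)%E.
  rewrite (_ : (0 = (abs_moment x)%:E)%E); last by rewrite -E.
  rewrite /abs_moment /Rintegral fineK; last exact: integrable_fin_num.
  by apply: eq_integral => w _; rewrite /= ger0_norm// powR_ge0.
have := (ae_eq_integral_abs P measurableT (measurable_int _ ii)).1 I0 => ae0.
have mE : measurable [set w | X w = x].
  by have := mX measurableT (measurable_set1 x); rewrite setTI.
apply/eqP; rewrite eq_le probability_le1//= -[leLHS](probability_setT P).
apply: ae_le_measure => //; apply: filterS ae0 => w /= /(_ I) [+] _.
move=> /eqP; rewrite powR_eq0 (gt_eqF b0) andbT normr_eq0 subr_eq0 => /eqP ->//.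
Qed.

Definition limit_cdf x := 2^-1 + (pi * b)^-1 * atan (sgn_moment x / abs_moment x * tan (pi * b / 2)).

Let Z j := mfun_pair (Xs j) (Ys j).
Let S s x n w := \sum_(j <- iota 0 n) score (affine_score s x) (Z j w).

Let mS s x n : measurable_fun setT (S s x n).
Proof. by apply: measurable_sum => j; apply: measurableT_comp; exact: measurable_funPT. Qed.

Let E s x n := [set w | 0 <= S s x n w].

Let mE s x n : measurable (E s x n).
Proof.
have -> : E s x n = S s x n @^-1` `[0, +oo[.
  by apply/seteqP; split => w; rewrite /= in_itv/= andbT.
by rewrite -[X in measurable X]setTI; exact: mS.
Qed.

(** For the score s (x - u), the sum of the two weights is [abs_moment x] and their difference is s
    times [sgn_moment x], so the sign s moves outside the ratio. *)
Let upper s x e : `|s| = 1 -> 0 < e -> \forall n \near \oo,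
  fine (P (E s x n)) <= 2^-1 + (pi * b)^-1 *
    atan (s * (sgn_moment x / abs_moment x * tan (pi * b / 2))) + e.
Proof.
move=> s1 e0; pose phi := affine_score s x.
have nphi u : `|phi u| = `|x - u| by rewrite /phi /= /affine_score normrM s1 mul1r.
have dlt0 : 0 <= dlt by apply: ltW; exact: lt_trans bd.
have int_phi : P.-integrable setT (EFin \o (fun w => `|phi (X w)| `^ dlt)).
  rewrite (_ : (fun w => _) = fun w => `|x - X w| `^ dlt); first exact: dist_int.
  by apply/funext => w; rewrite nphi.
have bn : b != 0 by rewrite gt_eqF.
pose cp := \int[P]_w (pospart phi (X w) `^ b); pose cm := \int[P]_w (negpart phi (X w) `^ b).
have part_int (f : {mfun R >-> R}) : (forall u, 0 <= f u <= `|phi u|) ->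
    P.-integrable setT (EFin \o (fun w => f (X w) `^ b)).
  move=> fI; apply: (le_Rintegrable measurableT _ _ (dist_int x (ltW b0) X_int_b)).
    by apply: (measurableT_comp (measurable_powR b)); exact: measurableT_comp.
  move=> w _; have /andP[f0 f1] := fI (X w); rewrite ger0_norm ?powR_ge0//.
  by apply: ge0_ler_powR; rewrite ?nnegrE ?(ltW b0)// -nphi.
have ip : P.-integrable setT (EFin \o (fun w => pospart phi (X w) `^ b)).
  apply: (part_int (pospart phi)) => u.
  by change (0 <= pospart phi u <= `|phi u|); rewrite pospart_ge0 /pospart ge_max normr_ge0 ler_norm.
have im : P.-integrable setT (EFin \o (fun w => negpart phi (X w) `^ b)).
  apply: (part_int (negpart phi)) => u; change (0 <= negpart phi u <= `|phi u|).
  by rewrite negpart_ge0 /negpart ge_max normr_ge0 -normrN ler_norm.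
have cpmE : cp + cm = abs_moment x.
  rewrite /cp /cm -RintegralD//; apply: eq_Rintegral => w _.
  by rewrite /pospart /negpart powR_parts// nphi.
have ss : s * s = 1 by rewrite -expr2 -real_normK ?num_real// s1 expr1n.
have s_sg : Num.sg s = s by rewrite [in RHS](numEsg s) s1 mulr1.
have iD : P.-integrable setT (EFin \o (fun w => pospart phi (X w) `^ b - negpart phi (X w) `^ b)).
  by rewrite /comp; under eq_fun do rewrite EFinB; exact: integrableB.
have sgE : sgn_moment x = s * (cp - cm).
  rewrite /cp /cm -RintegralB// -RintegralZl//; apply: eq_Rintegral => w _.
  by rewrite /pospart /negpart powR_parts_sg// nphi /phi /= /affine_score sgrM s_sg -[LHS]mul1r -ss; ring.
have cmpE : cp - cm = s * sgn_moment x by rewrite sgE mulrA ss mul1r.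
have c0 : 0 < cp + cm by rewrite cpmE abs_moment_gt0.
have := nonneg_score_probability XY iid bI d1 (regular_tail_gt0 YD) (regular_tail_ratio YD) int_phi c0 e0.
by rewrite -/cp -/cm cmpE cpmE !mulrA.
Qed.

Let Ys_ge0 : {ae P, forall w, forall i, 0 <= Ys i w}.
Proof.
apply: ae_foralln => i.
have mN : measurable [set z : R * R | z.2 < 0].
  rewrite (_ : mkset _ = snd @^-1` [set` `]-oo, 0[]); last first.
    by apply/seteqP; split => z; rewrite /= in_itv.
  rewrite -[X in measurable X]setTI; apply: (measurable_snd _ _) => //.
have law := iid.2 i _ mN.
exists [set w | Ys i w < 0]; split.
- rewrite -[X in measurable X]setTI (_ : mkset _ = Ys i @^-1` [set` `]-oo, 0[]); last first.
    by apply/seteqP; split => z; rewrite /= in_itv.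
  by apply: (measurable_funPT (Ys i)).
- rewrite [LHS]law; apply: measure_negligible.
    rewrite -[X in measurable X]setTI (_ : _ @^-1` _ = Y @^-1` [set` `]-oo, 0[]); last first.
      by apply/seteqP; split => z; rewrite /= in_itv.
    by apply: (measurable_funPT Y).
  apply: negligibleS Y_ge0 => w /= Yw /=; apply/negP; by rewrite -ltNge.
- by move=> w /= /negP; rewrite -ltNge.
Qed.

Let score_sum s x n w : (forall i, 0 <= Ys i w) ->
  S s x n w = s * (x * (\sum_(i < n) Ys i w) - \sum_(i < n) Xs i w * Ys i w).
Proof.
move=> Y0; have iE : iota 0 n = index_iota 0 n by rewrite /index_iota subn0.
rewrite /S iE big_mkord mulr_sumr -sumrB mulr_sumr; apply: eq_bigr => i _.
by rewrite /score /= /affine_score max_l//; ring.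
Qed.

(* When all the Y_i vanish the score sum is 0, so both events hold whatever the value of 0/0. *)
Let events x n w : (forall i, 0 <= Ys i w) ->
  (weighted_mean Xs Ys n w <= x -> 0 <= S 1 x n w) /\
  (x < weighted_mean Xs Ys n w -> 0 <= S (-1) x n w).
Proof.
move=> Y0; rewrite !score_sum// /weighted_mean.
set A := \sum_(i < n) Xs i w * Ys i w; set B := \sum_(i < n) Ys i w.
have B0 : 0 <= B by apply: sumr_ge0.
move: B0; rewrite le_eqVlt => /predU1P[Bz|Bp]; last first.
  by rewrite ler_pdivrMr// ltr_pdivlMr// mul1r mulN1r oppr_ge0 subr_ge0 subr_le0; split => // /ltW.
have Yz (i : 'I_n) : Ys i w = 0.
  have := esym Bz => /eqP; rewrite psumr_eq0//.
  by move=> /allP/(_ i); rewrite mem_index_enum => /(_ isT)/eqP.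
have -> : A = 0 by apply: big1 => i _; rewrite Yz mulr0.
by rewrite -Bz mulr0 subrr !mulr0.
Qed.

(** The upper bounds for the two signs have limits that add up to 1, since atan is odd. One bounds
    the cdf from above and the other its complement, so together they squeeze it. *)
Lemma cvg_cdf_weighted_mean x : fine (cdf (weighted_mean_rv Xs Ys n) x) @[n --> \oo] --> limit_cdf x.
Proof.
have mT n : measurable_fun setT (weighted_mean Xs Ys n) by exact: measurable_weighted_mean.
have mle n : measurable [set w | weighted_mean Xs Ys n w <= x].
  rewrite (_ : mkset _ = weighted_mean Xs Ys n @^-1` [set` `]-oo, x]]); last first.
    by apply/seteqP; split => w; rewrite /= in_itv.
  by rewrite -[X in measurable X]setTI; exact: mT.
have cE n : cdf (weighted_mean_rv Xs Ys n) x = P [set w | weighted_mean Xs Ys n w <= x].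
  by rewrite /cdf /distribution /pushforward; congr (P _); apply/seteqP; split => w; rewrite /= in_itv.
have gtE n : [set w | x < weighted_mean Xs Ys n w] = ~` [set w | weighted_mean Xs Ys n w <= x].
  by apply/seteqP; split => w /=; rewrite ltNge => /negP.
have mgt n : measurable [set w | x < weighted_mean Xs Ys n w].
  by rewrite gtE; exact: measurableC.
have le1 n : fine (P [set w | weighted_mean Xs Ys n w <= x]) <= fine (P (E 1 x n)).
  rewrite fine_le ?fin_num_measure//; apply: ae_le_measure => //.
  by apply: filterS Ys_ge0 => w Yw /=; exact: (events x n Yw).1.
have le2 n : fine (P [set w | x < weighted_mean Xs Ys n w]) <= fine (P (E (-1) x n)).
  rewrite fine_le ?fin_num_measure//; apply: ae_le_measure => //.
  by apply: filterS Ys_ge0 => w Yw /=; exact: (events x n Yw).2.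
have compl n : fine (P [set w | x < weighted_mean Xs Ys n w]) =
    1 - fine (P [set w | weighted_mean Xs Ys n w <= x]).
  by rewrite gtE probability_setC// fineB ?fin_num_measure.
apply/cvgrPdist_le => e e0.
have u1 := @upper 1 x e (normr1 _) e0.
have u2 := @upper (-1) x e (normrN1 _) e0.
near=> n; have h1 : fine (P (E 1 x n)) <= limit_cdf x + e.
  by near: n; move: u1; rewrite mul1r.
have h2 : fine (P (E (-1) x n)) <= 1 - limit_cdf x + e.
  have -> : 1 - limit_cdf x = 2^-1 - (pi * b)^-1 *
      atan (sgn_moment x / abs_moment x * tan (pi * b / 2)).
    by rewrite /limit_cdf; move: ((pi * b)^-1 * _) => z; lra.
  by near: n; move: u2; rewrite mulN1r atanN mulrN.
rewrite cE; have := le1 n; have := le2 n; rewrite compl => h3 h4.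
rewrite ler_norml; apply/andP; split; lra.
Unshelve. all: by end_near. Qed.

End WeightedMeanLimit.

(** * The limit function is a cdf: continuity and behaviour at infinity *)

Lemma continuous_powR_max (R : realType) (b : R) : 0 < b ->
  continuous (fun t : R => Num.max t 0 `^ b).
Proof.
move=> b0 t; have [t0|] := boolP (0 < t).
  have ct : {for t, continuous (fun u : R => u `^ b)}.
    by apply: has_deriv_continuous; derive.
  rewrite /continuous_at (max_l (ltW t0)).
  apply: cvg_trans ct; apply: near_eq_cvg; near=> u.
  by rewrite max_l// ltW//; near: u; exact: lt_nbhsr.
rewrite -leNgt le_eqVlt => /predU1P[->|t0].
  rewrite /continuous_at maxxx powR0 ?gt_eqF//; apply/cvgr0Pnorm_le => e e0.
  have eb : 0 < e `^ b^-1 by exact: powR_gt0.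
  near=> u; rewrite ger0_norm ?powR_ge0//.
  have -> : e = (e `^ b^-1) `^ b by rewrite -powRrM mulVf ?gt_eqF// powRr1// ltW.
  apply: ge0_ler_powR; rewrite ?nnegrE ?le_max ?lexx ?orbT ?(ltW b0) ?(ltW eb)//.
  rewrite ge_max (ltW eb) andbT; apply: ltW; near: u; exact: lt_nbhsl.
rewrite /continuous_at (max_r (ltW t0)) powR0 ?gt_eqF//.
apply: cvg_near_cst; near=> u.
by rewrite max_r ?powR0 ?gt_eqF// ltW//; near: u; exact: lt_nbhsl.
Unshelve. all: by end_near. Qed.

Section AffineMoment.
Context d (T : measurableType d) (R : realType) (P : probability T R).
Variables (X : {RV P >-> R}) (b : R).
Hypothesis b0 : 0 < b.
Hypothesis X_int_b : P.-integrable setT (EFin \o (fun w => `|X w| `^ b)).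

Lemma integrable_affine (g : R -> R) (p q : R) :
  continuous g -> (forall t, `|g t| <= `|t| `^ b) ->
  P.-integrable setT (EFin \o (fun w => g (p - X w * q))).
Proof.
move=> cg gb; have mX : measurable_fun setT (X : T -> R) by exact: measurable_funPT.
apply: (@le_Rintegrable _ _ _ P setT _ (fun w => (2 * `|p|) `^ b + (2 * `|q|) `^ b * `|X w| `^ b)) => //.
- apply: (measurableT_comp (continuous_measurable_fun cg)).
  by apply: measurable_funB => //; exact: measurable_funM.
- move=> w _; apply: le_trans (gb _) _.
  rewrite -powRM ?mulr_ge0// -mulrA; apply: le_trans (powR_add_le (ltW b0) _ _); rewrite ?mulr_ge0//.
  apply: ge0_ler_powR; rewrite ?nnegrE ?addr_ge0 ?mulr_ge0 ?(ltW b0)//.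
  by apply: le_trans (ler_normB _ _) _; rewrite normrM mulrC.
- apply: RintegrableD => //; last exact: RintegrableZ.
  by apply: (@bounded_integrable _ _ _ P _ `|(2 * `|p|) `^ b|).
Qed.

(** The form p - X q serves two limits: q = 1 with p varying gives continuity in x, and p = 1 with q
    = 1 / u tending to 0 gives the behaviour at infinity. Convergent sequences are bounded, which
    supplies the majorant. *)
Lemma cvg_affine_moment (g : R -> R) (p_ q_ : nat -> R) (p q : R) :
  continuous g -> (forall t, `|g t| <= `|t| `^ b) ->
  p_ n @[n --> \oo] --> p -> q_ n @[n --> \oo] --> q ->
  \int[P]_w g (p_ n - X w * q_ n) @[n --> \oo] --> \int[P]_w g (p - X w * q).
Proof.
move=> cg gb pp qq.
have bnd (u : nat -> R) (l : R) : u n @[n --> \oo] --> l -> exists2 C, 0 <= C & forall n, `|u n| <= C.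
  move=> ul; have [M [_ HM]] : bounded_fun u by apply: cvg_seq_bounded; apply/cvg_ex; exists l.
  by exists (`|M| + 1) => [|n]; [rewrite addr_ge0|apply: HM => //; rewrite (le_lt_trans (ler_norm M))// ltrDl].
have [C C0 pC] := bnd _ _ pp; have [D D0 qD] := bnd _ _ qq.
have mX : measurable_fun setT (X : T -> R) by exact: measurable_funPT.
have B : P.-integrable setT (EFin \o (fun w => (2 * C) `^ b + (2 * D) `^ b * `|X w| `^ b)).
  apply: RintegrableD => //; last exact: RintegrableZ.
  by apply: (@bounded_integrable _ _ _ P _ `|(2 * C) `^ b|).
apply: (Rintegral_cvg measurableT _ B _ _).2.
- move=> n; apply: (measurableT_comp (continuous_measurable_fun cg)).
  by apply: measurable_funB => //; exact: measurable_funM.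
- move=> n w _; apply: le_trans (gb _) _.
  rewrite -powRM ?mulr_ge0// -mulrA; apply: le_trans (powR_add_le (ltW b0) C0 _); last exact: mulr_ge0.
  apply: ge0_ler_powR; rewrite ?nnegrE ?addr_ge0 ?mulr_ge0 ?(ltW b0)//.
  by apply: le_trans (ler_normB _ _) _; apply: lerD => //; rewrite normrM mulrC ler_wpM2r.
- move=> w _; apply: continuous_cvg; first exact: cg.
  by apply: cvgB => //; apply: cvgM => //; exact: cvg_cst.
Qed.

End AffineMoment.

Section LimitCdf.
Context d (T : measurableType d) (R : realType) (P : probability T R).
Variables (X : {RV P >-> R}) (b dlt : R).
Hypothesis Xnd : nondegenerate_rv P X.
Hypothesis bI : 0 < b < dlt.
Hypothesis d1 : dlt < 1.
Hypothesis X_int : P.-integrable setT (EFin \o (fun w => `|X w| `^ dlt)).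

Let b0 : 0 < b. Proof. by case/andP: bI. Qed.
Let b1 : b < 1. Proof. by case/andP: bI => _ h; exact: lt_trans d1. Qed.

Let X_int_b : P.-integrable setT (EFin \o (fun w => `|X w| `^ b)).
Proof.
apply: (integrable_powR bI) => //; apply: measurableT_comp => //; exact: measurable_funPT.
Qed.

Let g1 (t : R) := `|t| `^ b.
Let g2 (t : R) := `|t| `^ b * Num.sg t.

Let hE (t : R) : (`|t| `^ b = Num.max t 0 `^ b + Num.max (- t) 0 `^ b) *
  (`|t| `^ b * Num.sg t = Num.max t 0 `^ b - Num.max (- t) 0 `^ b).
Proof.
have bn : b != 0 by rewrite gt_eqF.
by split; rewrite ?powR_parts ?powR_parts_sg.
Qed.

Let c_neg : continuous (fun t : R => Num.max (- t) 0 `^ b).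
Proof.
move=> t; apply: (@continuous_comp _ _ _ (fun t : R => - t) (fun t : R => Num.max t 0 `^ b)).
  exact: opp_continuous.
exact: continuous_powR_max.
Qed.

Let c_g1 : continuous g1.
Proof.
rewrite (_ : g1 = fun t => Num.max t 0 `^ b + Num.max (- t) 0 `^ b); last first.
  by apply/funext => t; rewrite /g1 hE.
by move=> t; apply: cvgD; [exact: continuous_powR_max|exact: c_neg].
Qed.

Let c_g2 : continuous g2.
Proof.
rewrite (_ : g2 = fun t => Num.max t 0 `^ b - Num.max (- t) 0 `^ b); last first.
  by apply/funext => t; rewrite /g2 hE.
by move=> t; apply: cvgB; [exact: continuous_powR_max|exact: c_neg].
Qed.

Let b_g1 t : `|g1 t| <= `|t| `^ b. Proof. by rewrite ger0_norm ?powR_ge0. Qed.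

Let b_g2 t : `|g2 t| <= `|t| `^ b.
Proof. by rewrite normrM normr_sg ger0_norm ?powR_ge0// ler_piMr ?powR_ge0// lern1 leq_b1. Qed.

Let pb : (0 : R) < pi * b / 2 < pi / 2.
Proof. by have pp := pi_gt0 R; have h0 := b0; have h1 := b1; apply/andP; split; nra. Qed.

Let cdf_of r := 2^-1 + (pi * b)^-1 * atan (r * tan (pi * b / 2)).

Let cvg_cdf_of (r_ : nat -> R) r : r_ n @[n --> \oo] --> r -> cdf_of (r_ n) @[n --> \oo] --> cdf_of r.
Proof.
move=> rr; apply: cvgD; first exact: cvg_cst.
apply: cvgM; first exact: cvg_cst.
apply: continuous_cvg; first exact: continuous_atan.
by apply: cvgM => //; exact: cvg_cst.
Qed.

Let pb0 : pi * b != 0 :> R.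
Proof. by rewrite mulf_neq0 ?gt_eqF// pi_gt0. Qed.

Let cdf_of1 : cdf_of 1 = 1.
Proof.
rewrite /cdf_of mul1r tanK; last by rewrite in_itv/=; have /andP[h0 ->] := pb; rewrite andbT (lt_trans _ h0)// oppr_lt0 divr_gt0// pi_gt0.
by move: pb0; move: (pi * b) => z z0; field.
Qed.

Let cdf_ofN1 : cdf_of (-1) = 0.
Proof.
rewrite /cdf_of mulN1r atanN tanK; last by rewrite in_itv/=; have /andP[h0 ->] := pb; rewrite andbT (lt_trans _ h0)// oppr_lt0 divr_gt0// pi_gt0.
by move: pb0; move: (pi * b) => z z0; field.
Qed.

Lemma limit_cdf_right_continuous : right_continuous (limit_cdf X b).
Proof.
move=> x; apply/cvg_at_rightP => u [_ ux].
apply: (cvg_cdf_of (r_ := fun n => sgn_moment X b (u n) / abs_moment X b (u n))).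
have E1 v : abs_moment X b v = \int[P]_w g1 (v - X w * 1).
  by apply: eq_Rintegral => w _; rewrite mulr1.
have E2 v : sgn_moment X b v = \int[P]_w g2 (v - X w * 1).
  by apply: eq_Rintegral => w _; rewrite mulr1.
have L1 := cvg_affine_moment b0 X_int_b c_g1 b_g1 ux (cvg_cst (1 : R)).
have L2 := cvg_affine_moment b0 X_int_b c_g2 b_g2 ux (cvg_cst (1 : R)).
apply: cvgM; first by under eq_fun do rewrite E2; rewrite E2; exact: L2.
apply: cvgV; first by rewrite gt_eqF//; exact: (abs_moment_gt0 Xnd bI X_int).
by under eq_fun do rewrite E1; rewrite E1; exact: L1.
Qed.

(* |u - X|^b / |u|^b = |1 - X / u|^b reduces the behaviour at infinity to continuity at 0. *)
Let ratioE u : u != 0 -> sgn_moment X b u / abs_moment X b u =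
  Num.sg u * (\int[P]_w g2 (1 - X w * u^-1) / \int[P]_w g1 (1 - X w * u^-1)).
Proof.
move=> u0.
have F w : u - X w = u * (1 - X w * u^-1) by rewrite mulrBr mulr1 mulrCA divff// mulr1.
have i1 := integrable_affine b0 X_int_b 1 u^-1 c_g1 b_g1.
have i2 := integrable_affine b0 X_int_b 1 u^-1 c_g2 b_g2.
have -> : abs_moment X b u = `|u| `^ b * \int[P]_w g1 (1 - X w * u^-1).
  rewrite -RintegralZl//; apply: eq_Rintegral => w _.
  by rewrite {1}F normrM powRM.
have -> : sgn_moment X b u = `|u| `^ b * Num.sg u * \int[P]_w g2 (1 - X w * u^-1).
  rewrite -RintegralZl//; apply: eq_Rintegral => w _.
  by rewrite F normrM powRM// sgrM /g2; ring.
have ub : `|u| `^ b != 0 by rewrite gt_eqF// powR_gt0// normr_gt0.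
have K (A r I J : R) : A != 0 -> A * r * I / (A * J) = r * (I / J).
  by move=> A0; rewrite invfM; move: (J^-1) => z; field.
exact: K.
Qed.

Let limit_ratio (q_ : nat -> R) : q_ n @[n --> \oo] --> 0 ->
  \int[P]_w g2 (1 - X w * q_ n) / \int[P]_w g1 (1 - X w * q_ n) @[n --> \oo] --> (1 : R).
Proof.
move=> q0.
have L1 := cvg_affine_moment b0 X_int_b c_g1 b_g1 (cvg_cst (1 : R)) q0.
have L2 := cvg_affine_moment b0 X_int_b c_g2 b_g2 (cvg_cst (1 : R)) q0.
have I1 : \int[P]_w g1 (1 - X w * 0) = 1.
  rewrite -[RHS](Rintegral_cstT P 1); apply: eq_Rintegral => w _.
  by rewrite mulr0 subr0 /g1 normr1 powR1.
have I2 : \int[P]_w g2 (1 - X w * 0) = 1.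
  rewrite -[RHS](Rintegral_cstT P 1); apply: eq_Rintegral => w _.
  by rewrite mulr0 subr0 /g2 normr1 powR1 sgr1 mulr1.
rewrite I1 in L1; rewrite I2 in L2; rewrite -[X in _ --> X](divr1 1).
by apply: cvgM; [exact: L2|apply: cvgV; [exact: oner_neq0|exact: L1]].
Qed.

Let limit_cdf_ratio (u : nat -> R) s : (\forall n \near \oo, u n != 0 /\ Num.sg (u n) = s) ->
  (u n)^-1 @[n --> \oo] --> 0 -> limit_cdf X b (u n) @[n --> \oo] --> cdf_of s.
Proof.
move=> us u0; apply: (cvg_cdf_of (r_ := fun n => sgn_moment X b (u n) / abs_moment X b (u n))).
have := limit_ratio u0 => /(cvgM (cvg_cst (s : R))); rewrite mulr1.
apply: cvg_trans; apply: near_eq_cvg; near=> n.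
have [n0 ns] : u n != 0 /\ Num.sg (u n) = s by near: n.
by rewrite ratioE// ns.
Unshelve. all: by end_near. Qed.

Lemma limit_cdf_pinfty : limit_cdf X b x @[x --> +oo] --> (1 : R).
Proof.
apply/cvg_pinftyP => u uoo.
have up : \forall n \near \oo, 0 < u n by move: uoo => /cvgryPgt/(_ 0).
rewrite -cdf_of1; apply: limit_cdf_ratio; last exact/gtr0_cvgV0.
by apply: filterS up => n n0; rewrite gt_eqF// gtr0_sg.
Qed.

Lemma limit_cdf_ninfty : limit_cdf X b x @[x --> -oo] --> (0 : R).
Proof.
apply/cvg_ninftyP => u uoo.
have up : \forall n \near \oo, u n < 0 by move: uoo => /cvgrNyPlt/(_ 0).
rewrite -cdf_ofN1; apply: limit_cdf_ratio; last exact/ltr0_cvgV0.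
by apply: filterS up => n n0; rewrite lt_eqF// ltr0_sg.
Qed.

Let distribution_affine (g : R -> R) x : continuous g -> (forall t, `|g t| <= `|t| `^ b) ->
  \int[distribution P X]_u g (x - u) = \int[P]_w g (x - X w).
Proof.
move=> cg gb; rewrite /Rintegral; congr fine.
have mg : measurable_fun setT (fun u : R => g (x - u)).
  by apply: (measurableT_comp (continuous_measurable_fun cg)); exact: measurable_funB.
rewrite (@integral_distribution _ _ _ _ _ P X (fun u => (g (x - u))%:E))//; first exact/measurable_EFinP.
have := integrable_affine b0 X_int_b x 1 cg gb.
by rewrite (_ : (fun w => _) = fun w => g (x - X w))//; apply/funext => w; rewrite mulr1.
Qed.

Lemma limit_cdf_distribution x : limit_cdf X b x =
  2^-1 + (pi * b)^-1 *
    atan ((\int[distribution P X]_u (`|u - x| `^ b * Num.sg (x - u))) /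
          (\int[distribution P X]_u (`|u - x| `^ b)) * tan (pi * b / 2)).
Proof.
have -> : \int[distribution P X]_u (`|u - x| `^ b) = abs_moment X b x.
  rewrite -[RHS](distribution_affine x c_g1 b_g1); apply: eq_Rintegral => u _.
  by rewrite /g1 distrC.
have -> : \int[distribution P X]_u (`|u - x| `^ b * Num.sg (x - u)) = sgn_moment X b x.
  rewrite -[RHS](distribution_affine x c_g2 b_g2); apply: eq_Rintegral => u _.
  by rewrite /g2 distrC.
by [].
Qed.

End LimitCdf.

Theorem theorem6 (R : realType) (d : measure_display) (Omega : measurableType d)
    (P : probability Omega R) (X Y : {RV P >-> R})
    (Xs Ys : nat -> {RV P >-> R}) (beta : R)
    (hXY : independent_rv P X Y)
    (hX : nondegenerate_rv P X)
    (hY : {ae P, forall w, 0 <= Y w})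
    (hiid : iid_copies P (fun w => (X w, Y w)) (fun i w => (Xs i w, Ys i w)))
    (hbeta : 0 < beta < 1)
    (hD : in_D beta Y)
    (hmom : exists eps : R, 0 < eps /\
       ('E_P[(fun w => (`|X w| `^ (beta + eps))%R)] < +oo)%E) :
  exists (d' : measure_display) (Omega' : measurableType d')
    (P' : probability Omega' R) (T : {RV P' >-> R}),
    (forall x : R, cdf T x =
       (2^-1 + (pi * beta)^-1 *
         atan ((\int[distribution P X]_u (`|u - x| `^ beta * Num.sg (x - u))) /
               (\int[distribution P X]_u (`|u - x| `^ beta)) *
               tan (pi * beta / 2)))%:E) /\
    cvg_in_distribution (weighted_mean_rv Xs Ys) T.
Proof.
have /andP[b0 b1] := hbeta; have [eps [eps0 Eeps]] := hmom.
have [dlt [bI d1 X_int]] : exists dlt, [/\ 0 < beta < dlt, dlt < 1 &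
    P.-integrable setT (EFin \o (fun w => `|X w| `^ dlt))].
  (* The exponent has to lie strictly between beta and 1, for the Potter bound and the singular
     integrals, and below beta + eps, for the moment of X. *)
  pose dlt := Num.min (beta + eps / 2) ((1 + beta) / 2).
  have dd : dlt <= beta + eps / 2 by rewrite ge_min lexx.
  have dd' : dlt <= (1 + beta) / 2 by rewrite ge_min lexx orbT.
  have bd : beta < dlt by rewrite lt_min; apply/andP; split; lra.
  exists dlt; split; [by rewrite b0|lra|].
  have mX : measurable_fun setT (fun w => `|X w|).
    by apply: measurableT_comp => //; exact: measurable_funPT.
  apply: (@integrable_powR _ _ _ P _ (beta + eps)) => //; first by apply/andP; split; lra.
  apply/integrableP; split.
    by apply/measurable_EFinP; exact: (measurableT_comp (measurable_powR _)).
  apply: le_lt_trans Eeps; rewrite unlock; apply: ge0_le_integral => //.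
  - by apply: measurableT_comp => //; apply/measurable_EFinP; exact: (measurableT_comp (measurable_powR _)).
  - by apply/measurable_EFinP; exact: (measurableT_comp (measurable_powR _)).
  - by move=> w _; rewrite /= lee_fin ger0_norm// powR_ge0.
have L x := cvg_cdf_weighted_mean hXY hX hY hiid bI d1 hD X_int (x := x).
(* Monotonicity is hard to read off the arctangent formula; it is inherited from the cdfs that
   converge to it. *)
have F_nd : nondecreasing (limit_cdf X beta).
  move=> x y xy; apply: (ler_cvg_to (L x) (L y)); apply: nearW => n.
  by rewrite fine_le ?fin_num_measure// cdf_nondecreasing.
have [dsp [Omg [Q [T TE]]]] := exists_rv_cdf F_nd
  (limit_cdf_right_continuous hX bI X_int) (limit_cdf_ninfty bI d1 X_int)
  (limit_cdf_pinfty bI d1 X_int).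
exists dsp, Omg, Q, T; split => [x|x _].
  by rewrite TE (limit_cdf_distribution bI X_int).
have cE n : cdf (weighted_mean_rv Xs Ys n) x = (fine (cdf (weighted_mean_rv Xs Ys n) x))%:E.
  by rewrite fineK ?fin_num_measure.
by rewrite TE (funext cE); apply: cvg_EFin; [exact: nearW|exact: L].
Qed.
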